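(* Given $s>\frac d2$, there is $C=C(s,d)$ such that every $f\in H^s(\mathbb{R}^d)$ has the following property: for each $N>0$, there is $R\in L^2(\mathbb{R}^d)$ with $$\|R\|\le C\left(1+N^{-\frac d2}\right)\left(\int_{\mathbb{R}^d\setminus Q_{\pi N}(0)}(1+|\xi|^2)^s|\hat f(\xi)|^2\,d\xi\right)^{\frac12}$$ such that $$f=\sum_{n\in\mathbb{Z}^d}f(n/N)\,f_{N,n}+R\quad\text{in } L^2(\mathbb{R}^d).$$
   Context: $d\ge1$ is an integer; $\|\cdot\|$ is the norm of $L^2(\mathbb{R}^d)$. The Fourier transform is $\hat f(\xi)=(2\pi)^{-d/2}\int_{\mathbb{R}^d}e^{-ix\cdot\xi}f(x)\,dx$, extended to tempered distributions in the usual way. $H^s(\mathbb{R}^d)$ is the Bessel potential space with norm $\|f\|_{H^s(\mathbb{R}^d)}=\left(\int_{\mathbb{R}^d}(1+|\xi|^2)^s|\hat f(\xi)|^2d\xi\right)^{1/2}$; for $s>d/2$ its elements are identified with their continuous representatives, so point values make sense. $Q_r(x)$ is the closed cube centered at $x$ with side length $2r$. For $N>0$ and $n\in\mathbb{Z}^d$, $f_{N,n}(x)=\prod_{j=1}^d\frac{\sin\pi(Nx_j-n_j)}{\pi(Nx_j-n_j)}$ (with value $1$ for a factor whose denominator vanishes). *)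

(* Defs.v *)
From HB Require Import structures.
From mathcomp Require Import all_boot all_order all_algebra finmap complex.
From mathcomp Require Import all_classical all_reals all_analysis.

Set Implicit Arguments.
Unset Strict Implicit.
Unset Printing Implicit Defensive.

Import Order.TTheory GRing.Theory Num.Theory.
Import numFieldNormedType.Exports.

Local Open Scope classical_set_scope.
Local Open Scope ring_scope.

(* Lebesgue measure on R^n = 'rV[R]_n, with the sigma-algebra generated by the
   coordinates (the Borel one), built as an iterated product of the Lebesgue
   measure of R; R^0 is one point of mass 1. *)
Section LebesgueRn.
Variable R : realType.

Definition rV_display : measure_display := default_measure_display.

Section sigma_algebra.
Variable n : nat.

Definition rV_coord (i : 'I_n) (x : 'rV[R]_n) : measurableTypeR R := x 0 i.

Let rV_set0 : g_sigma_preimage rV_coord set0.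
Proof. exact: sigma_algebra0. Qed.

Let rV_setC A : g_sigma_preimage rV_coord A -> g_sigma_preimage rV_coord (~` A).
Proof. exact: sigma_algebraC. Qed.

Let rV_bigcup (F : (set 'rV[R]_n)^nat) :
  (forall i, g_sigma_preimage rV_coord (F i)) ->
  g_sigma_preimage rV_coord (\bigcup_i (F i)).
Proof. exact: sigma_algebra_bigcup. Qed.

HB.instance Definition _ := @isMeasurable.Build rV_display
  'rV[R]_n (g_sigma_preimage rV_coord) rV_set0 rV_setC rV_bigcup.

End sigma_algebra.

Lemma measurable_rV_coord n (i : 'I_n) : measurable_fun setT (@rV_coord n i).
Proof.
move=> _ Y mY; rewrite setTI; apply: sub_sigma_algebra => /=.
rewrite -bigcup_seq/=; exists i => /=; first by rewrite mem_index_enum.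
by exists Y => //; rewrite setTI.
Qed.

Lemma measurable_fun_rV d (T : measurableType d) n (f : T -> 'rV[R]_n) :
  (forall i, measurable_fun setT (@rV_coord n i \o f)) -> measurable_fun setT f.
Proof.
move=> mf.
suff H : @measurable _ 'rV[R]_n `<=`
    [set A | measurable (f @^-1` A)].
  by move=> _ A mA; rewrite setTI; exact: H.
apply: smallest_sub.
  split=> /=.
  - by rewrite preimage_set0.
  - by move=> A mA; rewrite setTD preimage_setC; exact: measurableC.
  - by move=> F mF; rewrite preimage_bigcup; exact: bigcup_measurable.
move=> A; rewrite -bigcup_seq/= => -[i _] [B mB <-].
by rewrite /= setTI -comp_preimage -[X in measurable X]setTI; exact: mf.
Qed.

Definition rV_cons n (p : measurableTypeR R * 'rV[R]_n) : 'rV[R]_n.+1 :=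
  \row_i oapp (fun j => p.2 0 j) p.1 (unlift ord0 i).

Definition rV_uncons n (x : 'rV[R]_n.+1) : measurableTypeR R * 'rV[R]_n :=
  (x 0 ord0, \row_j x 0 (lift ord0 j)).

Lemma rV_consK n : cancel (@rV_cons n) (@rV_uncons n).
Proof.
move=> [a x]; rewrite /rV_uncons mxE unlift_none/=; congr pair.
by apply/rowP => j; rewrite !mxE liftK.
Qed.

Lemma rV_unconsK n : cancel (@rV_uncons n) (@rV_cons n).
Proof.
move=> x; apply/rowP => i; rewrite mxE.
by case: unliftP => [j|] -> //=; rewrite mxE.
Qed.

Lemma measurable_rV_cons n : measurable_fun setT (@rV_cons n).
Proof.
apply: measurable_fun_rV => i.
have [j ->|->] := unliftP ord0 i.
- rewrite (_ : _ \o _ = @rV_coord n j \o snd).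
    by apply: measurableT_comp => //; exact: measurable_rV_coord.
  by apply/funext => p /=; rewrite /rV_coord mxE liftK.
- rewrite (_ : _ \o _ = fst) //.
  by apply/funext => p /=; rewrite /rV_coord mxE unlift_none.
Qed.

Lemma measurable_rV_uncons n : measurable_fun setT (@rV_uncons n).
Proof.
apply: measurable_fun_pair; first exact: measurable_rV_coord.
apply: measurable_fun_rV => i.
rewrite (_ : _ \o _ = @rV_coord n.+1 (lift ord0 i)).
  exact: measurable_rV_coord.
by apply/funext => x /=; rewrite /rV_coord mxE.
Qed.

Section step.
Variables (n : nat) (m : {sigma_finite_measure set 'rV[R]_n -> \bar R}).

Definition lebesgue_rV_step : set 'rV[R]_n.+1 -> \bar R :=
  pushforward (@lebesgue_measure R \x m)%E (@rV_cons n).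

Let mcons A : measurable A -> measurable (@rV_cons n @^-1` A).
Proof.
by move=> mA; rewrite -[X in measurable X]setTI; exact: measurable_rV_cons.
Qed.

Let lebesgue_rV_step0 : lebesgue_rV_step set0 = 0%E.
Proof. by rewrite /lebesgue_rV_step /pushforward preimage_set0 measure0. Qed.

Let lebesgue_rV_step_ge0 A : (0 <= lebesgue_rV_step A)%E.
Proof. by rewrite /lebesgue_rV_step /pushforward measure_ge0. Qed.

Let lebesgue_rV_step_sigma_additive : semi_sigma_additive lebesgue_rV_step.
Proof.
move=> F mF tF mUF; rewrite /lebesgue_rV_step /pushforward preimage_bigcup.
apply: measure_semi_sigma_additive.
- by move=> k; exact: mcons.
- apply/trivIsetP => /= i j _ _ ij; rewrite -preimage_setI.
  by move/trivIsetP : tF => /(_ _ _ _ _ ij) ->//; rewrite preimage_set0.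
- by rewrite -preimage_bigcup; exact: mcons.
Qed.

HB.instance Definition _ := isMeasure.Build _ _ _ lebesgue_rV_step
  lebesgue_rV_step0 lebesgue_rV_step_ge0 lebesgue_rV_step_sigma_additive.

Let lebesgue_rV_step_sigma_finite : sigma_finite setT lebesgue_rV_step.
Proof.
have /sigma_finiteP[F [TF ndF Foo]] :=
  sigma_finiteT (@lebesgue_stieltjes_measure R idfun).
have /sigma_finiteP[G [TG ndG Goo]] := sigma_finiteT m.
exists (fun k => @rV_uncons n @^-1` (F k `*` G k)).
  rewrite predeqE => x; split=> // _.
  have : setT (rV_uncons x).1 by []; rewrite TF => -[k _ Fk].
  have : setT (rV_uncons x).2 by []; rewrite TG => -[l _ Gl].
  exists (maxn k l) => //; split.
  - by move: Fk; apply/subsetPset/ndF/leq_maxl.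
  - by move: Gl; apply/subsetPset/ndG/leq_maxr.
move=> k; have [mFk Fk] := Foo k; have [mGk Gk] := Goo k; split.
  rewrite -[X in measurable X]setTI; apply: measurable_rV_uncons => //.
  exact: measurableX.
rewrite /lebesgue_rV_step /pushforward.
rewrite (_ : _ @^-1` _ = F k `*` G k); last first.
  by apply/seteqP; split=> p; rewrite /preimage/mkset rV_consK.
by rewrite product_measure1E// lte_mul_pinfty// ge0_fin_numE.
Qed.

HB.instance Definition _ := Measure_isSigmaFinite.Build _ _ _
  lebesgue_rV_step lebesgue_rV_step_sigma_finite.

End step.

Fixpoint lebesgue_rV n : {sigma_finite_measure set 'rV[R]_n -> \bar R} :=
  match n with
  | 0 => @dirac _ 'rV[R]_0 0 R
  | n'.+1 => @lebesgue_rV_step n' (lebesgue_rV n')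
  end.

End LebesgueRn.

(* Pins down lebesgue_rV: the volume of a measurable product set. *)
Lemma lebesgue_rV_box (R : realType) n (A : 'I_n -> set (measurableTypeR R)) :
  (forall i, measurable (A i)) ->
  lebesgue_rV R n [set x : 'rV[R]_n | forall i, A i (x 0 i)] =
  (\prod_(i < n) lebesgue_measure (A i))%E.
Proof.
elim: n A => [|n IH] A mA.
  rewrite big_ord0 /= diracE mem_set//.
  by case.
rewrite big_ord_recl -IH//= /lebesgue_rV_step /pushforward.
set B := [set x : 'rV[R]_n | _].
have mB : measurable B.
  rewrite (_ : B = \bigcap_(i in setT) (rV_coord i @^-1` A (lift ord0 i))).
    apply: fin_bigcap_measurable => // i _.
    by rewrite -[X in measurable X]setTI; exact: measurable_rV_coord.
  by apply/seteqP; split=> x Bx i; [move=> _|]; exact: Bx.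
rewrite -product_measure1E//; congr (_ _).
apply/seteqP; split=> -[a x] /=.
- move=> Aax; split=> /=; first by have := Aax ord0; rewrite mxE unlift_none.
  by move=> i; have := Aax (lift ord0 i); rewrite mxE liftK.
- move=> [/= Aa Bx] i; rewrite mxE.
  by case: unliftP => [j|] ->.
Qed.

Section ComplexFunctions.
Variables (R : realType) (d : nat).
Local Notation mu := (lebesgue_rV R d).
Implicit Types (f g : 'rV[R]_d -> R[i]) (x xi : 'rV[R]_d).

Definition dotp (x y : 'rV[R]_d) : R := \sum_(i < d) x 0 i * y 0 i.

Definition sqnorm x : R := dotp x x.

Definition expi (t : R) : R[i] := (cos t +i* sin t)%C.

Definition ccontinuous f : Prop :=
  continuous (fun x => complex.Re (f x)) /\
  continuous (fun x => complex.Im (f x)).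

Definition cmeasurable f : Prop :=
  measurable_fun setT (fun x => complex.Re (f x)) /\
  measurable_fun setT (fun x => complex.Im (f x)).

Definition cintegrable f : Prop :=
  mu.-integrable setT (fun x => (complex.Re (f x))%:E) /\
  mu.-integrable setT (fun x => (complex.Im (f x))%:E).

Definition cintegral f : R[i] :=
  ((\int[mu]_x complex.Re (f x)) +i* (\int[mu]_x complex.Im (f x)))%C.

Definition L2norm f : \bar R := Lnorm mu 2%:E (fun x => (Normc.normc (f x))%:E).

Definition inL2 f : Prop := cmeasurable f /\ (L2norm f < +oo)%E.

(* Unconditional convergence in L^2: the net of the finite partial sums tends
   to f. *)
Definition L2_sum (I : choiceType) (F : I -> 'rV[R]_d -> R[i]) f : Prop :=
  forall e : R, 0 < e -> exists J0 : {fset I},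
    forall J : {fset I}, (J0 `<=` J)%fset ->
      (L2norm (fun x => (f x - \sum_(n <- J) F n x)%R) < e%:E)%E.

Definition fourier f xi : R[i] :=
  real_complex R ((2 * pi) `^ (- (d%:R / 2))) *
  cintegral (fun x => expi (- dotp x xi) * f x).

End ComplexFunctions.

Section TemperedDistributions.
Variables (R : realType) (d : nat).
Local Notation mu := (lebesgue_rV R d).
Implicit Types (f g phi psi : 'rV[R]_d -> R[i]) (x xi : 'rV[R]_d).

Fixpoint iter_partial (a : seq 'I_d) (h : 'rV[R]_d -> R) : 'rV[R]_d -> R :=
  match a with
  | [::] => h
  | i :: a' => fun x => 'D_(delta_mx 0 i) (iter_partial a' h) x
  end.

Definition real_schwartz (h : 'rV[R]_d -> R) : Prop :=
  forall a : seq 'I_d,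
    (forall x, differentiable (iter_partial a h) x) /\
    forall k : nat, exists M : R, forall x,
      (1 + sqnorm x) ^+ k * `|iter_partial a h x| <= M.

Definition schwartz phi : Prop :=
  real_schwartz (fun x => complex.Re (phi x)) /\
  real_schwartz (fun x => complex.Im (phi x)).

(* The k-th Schwartz seminorm of phi is at most B. *)
Definition schwartz_seminorm_le (k : nat) phi (B : R) : Prop :=
  forall a : seq 'I_d, (size a <= k)%N -> forall x,
    (1 + sqnorm x) ^+ k *
      `|iter_partial a (fun y => complex.Re (phi y)) x| <= B /\
    (1 + sqnorm x) ^+ k *
      `|iter_partial a (fun y => complex.Im (phi y)) x| <= B.

(* A distribution is a functional of which only the values at Schwartz
   functions matter. *)
Definition functional := ('rV[R]_d -> R[i]) -> R[i].

Definition tempered (u : functional) : Prop :=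
  (forall (c : R[i]) phi psi, schwartz phi -> schwartz psi ->
     u (fun x => c * phi x + psi x) = c * u phi + u psi) /\
  exists (k : nat) (M : R), forall phi (B : R), schwartz phi ->
    schwartz_seminorm_le k phi B -> Normc.normc (u phi) <= M * B.

Definition represented_by (u : functional) g : Prop :=
  cmeasurable g /\
  forall phi, schwartz phi ->
    cintegrable (fun x => g x * phi x) /\
    u phi = cintegral (fun x => g x * phi x).

Definition fourier_distribution (u : functional) : functional :=
  fun phi => u (fourier phi).

Definition bessel_energy (s : R) (D : set 'rV[R]_d) g : \bar R :=
  (\int[mu]_(xi in D) ((1 + sqnorm xi) `^ s * Normc.normc (g xi) ^+ 2)%:E)%E.

(* u is in H^s(R^d), and the function uhat is its Fourier transform. *)
Definition bessel_potential (s : R) (u : functional) uhat : Prop :=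
  [/\ tempered u,
      represented_by (fourier_distribution u) uhat &
      (bessel_energy s setT uhat < +oo)%E].

Definition continuous_representative (u : functional) f : Prop :=
  ccontinuous f /\ represented_by u f.

End TemperedDistributions.

Section Sampling.
Variables (R : realType) (d : nat).

Definition cube (x : 'rV[R]_d) (r : R) : set 'rV[R]_d :=
  [set y | forall i, `|y 0 i - x 0 i| <= r].

Definition sinc (t : R) : R := if t == 0 then 1 else sin t / t.

Definition cardinal_fun (N : R) (n : 'rV[int]_d) (x : 'rV[R]_d) : R :=
  \prod_(j < d) sinc (pi * (N * x 0 j - (n 0 j)%:~R)).

Definition sample_point (N : R) (n : 'rV[int]_d) : 'rV[R]_d :=
  \row_j ((n 0 j)%:~R / N).

End Sampling.

(* Main.v *)
Require Import Defs.
From HB Require Import structures.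
From mathcomp Require Import all_boot all_order all_algebra finmap complex.
From mathcomp Require Import all_classical all_reals all_analysis.
From mathcomp Require Import measurable_realfun.
From mathcomp Require Import ring lra zify.

Set Implicit Arguments.
Unset Strict Implicit.
Unset Printing Implicit Defensive.

Import Order.TTheory GRing.Theory Num.Theory.
Import numFieldNormedType.Exports.

Local Open Scope classical_set_scope.
Local Open Scope ring_scope.

(* Write [Q] for the cube of half-width [pi * N] and split [f = G1 + G2] by
   restricting [fhat] to [Q] and to its complement.  On [Q] the lattice
   exponentials [e^(i n.xi / N)] are orthogonal and, for fixed [x], the
   coefficients of [e^(i x.xi)] are the [f_(N,n)(x)]; completeness amounts to
   [sum_k sinc (pi (t - k)) ^ 2 = 1].  Hence [G1] is the pointwise sum of its
   cardinal series, and the remainder of [f] is that of [G2].  Plancherel bounds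
   the norm of [G2], and orthogonality bounds the norm of its cardinal series by
   [N^(-d/2) (sum_n |G2 (n/N)|^2)^(1/2)].  By duality the sum of the squared
   samples is controlled by the square integral of a trigonometric polynomial
   against [(1 + |xi|^2)^(-s)]; this weight is dominated by a step function
   constant on the translates of [Q], for which orthogonality gives
   [sum_n |G2 (n/N)|^2 <= (N + c)^d * int (1 + |xi|^2)^s |G2^|^2]. *)

(** * Complex-valued integrals *)

(** The function [f] and its transform are linked only through pairings with Schwartz functions, and
    nothing is known of the growth of [f] beyond its integrability against them. Pointwise inversion
    is therefore drawn from one family of tests, modulated Gaussians, whose transforms are multiples
    of heat kernels; the kernel of variance 1, itself a test function, majorises the tails of the
    narrower ones. The condition [s > d / 2] acts through the exponent [s / d > 1 / 2]: since
    [1 + |xi|^2 >= 1 + xi_j^2], the weight is at most the product of the [(1 + xi_j^2)^(- s / d)],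
    so the dominating step function can be taken as a product and its integrals against exponentials
    factor. On one axis the steps sum to at most [1 + c / (pi * N)], whence [N + c]; with the
    [N^(-d)] of the cardinal series the samples cost [(1 + c / N)^d], which is at most
    [(1 + c)^d * (1 + N^(-d))]. The remainder is [f] minus the pointwise limit of the series along
    one enumeration of the lattice; Fatou's lemma carries the square-integral bounds to that limit,
    and comparison with arbitrary finite sets of nodes gives the unconditional convergence. *)

Lemma real_complexM (R : realType) (x y : R) :
  real_complex R (x * y) = real_complex R x * real_complex R y.
Proof. exact: rmorphM. Qed.

Lemma real_complex_sum (R : realType) (I : Type) (r : seq I) (F : I -> R) :
  real_complex R (\sum_(i <- r) F i) = \sum_(i <- r) real_complex R (F i).
Proof. exact: rmorph_sum. Qed.

Lemma conjcM (R : realType) (z w : R[i]) : conjc (z * w) = conjc z * conjc w.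
Proof. exact: rmorphM. Qed.

Lemma conjc_sum (R : realType) (I : Type) (r : seq I) (F : I -> R[i]) :
  conjc (\sum_(i <- r) F i) = \sum_(i <- r) conjc (F i).
Proof. exact: rmorph_sum. Qed.

Section normc_theory.
Variable R : realType.
Implicit Types z w : R[i].
Local Notation nc := (@Normc.normc R).

Lemma normcE2 z : nc z ^+ 2 = complex.Re z ^+ 2 + complex.Im z ^+ 2.
Proof. by case: z => a b /=; rewrite sqr_sqrtr// addr_ge0// sqr_ge0. Qed.

Lemma normc_ge0 z : 0 <= nc z.
Proof. by case: z => a b; exact: sqrtr_ge0. Qed.

Lemma Re_le_normc z : `|complex.Re z| <= nc z.
Proof.
rewrite -(ler_pXn2r (n := 2)) ?nnegrE ?normc_ge0//.
by rewrite normcE2 real_normK ?num_real// lerDl sqr_ge0.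
Qed.

Lemma Im_le_normc z : `|complex.Im z| <= nc z.
Proof.
rewrite -(ler_pXn2r (n := 2)) ?nnegrE ?normc_ge0//.
by rewrite normcE2 real_normK ?num_real// lerDr sqr_ge0.
Qed.

Lemma normc_le_ReIm z : nc z <= `|complex.Re z| + `|complex.Im z|.
Proof.
rewrite -(ler_pXn2r (n := 2)) ?nnegrE ?normc_ge0// ?addr_ge0//.
rewrite normcE2 sqrrD !real_normK ?num_real//.
by rewrite -addrA lerD2l lerDr mulrn_wge0// mulr_ge0.
Qed.

Lemma normc_conj z : nc (conjc z) = nc z.
Proof. by case: z => a b /=; rewrite sqrrN. Qed.

Lemma normc_real (x : R) : nc (real_complex R x) = `|x|.
Proof. by rewrite /= expr0n addr0 sqrtr_sqr. Qed.

Lemma mulc_conj z : z * conjc z = real_complex R (nc z ^+ 2).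
Proof.
rewrite normcE2; case: z => a b; apply/eqP; rewrite eq_complex /=.
by apply/andP; split; apply/eqP; ring.
Qed.

Lemma normc_expi (t : R) : nc (expi t) = 1.
Proof. by rewrite /= cos2Dsin2 sqrtr1. Qed.

Lemma expi0 : expi 0 = 1 :> R[i].
Proof. by rewrite /expi cos0 sin0. Qed.

Lemma expiD (s t : R) : expi (s + t) = expi s * expi t.
Proof.
rewrite /expi cosD sinD; apply/eqP; rewrite eq_complex /=.
by apply/andP; split; apply/eqP; ring.
Qed.

Lemma conjc_expi (t : R) : conjc (expi t) = expi (- t).
Proof. by rewrite /expi cosN sinN. Qed.

Lemma expi_sum (I : Type) (r : seq I) (t : I -> R) :
  expi (\sum_(i <- r) t i) = \prod_(i <- r) expi (t i).
Proof.
elim: r => [|i r IH]; first by rewrite !big_nil expi0.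
by rewrite !big_cons expiD IH.
Qed.

Lemma Re_sum (I : Type) (r : seq I) (t : I -> R[i]) :
  complex.Re (\sum_(i <- r) t i) = \sum_(i <- r) complex.Re (t i).
Proof.
elim: r => [|i r IH]; first by rewrite !big_nil.
by rewrite !big_cons -IH; case: (t i) => a b; case: (\sum_(_ <- _) _).
Qed.

Lemma Im_sum (I : Type) (r : seq I) (t : I -> R[i]) :
  complex.Im (\sum_(i <- r) t i) = \sum_(i <- r) complex.Im (t i).
Proof.
elim: r => [|i r IH]; first by rewrite !big_nil.
by rewrite !big_cons -IH; case: (t i) => a b; case: (\sum_(_ <- _) _).
Qed.

Lemma complex_eta z : z = (complex.Re z +i* complex.Im z)%C.
Proof. by case: z. Qed.

Lemma ReM z w : complex.Re (z * w) =
  complex.Re z * complex.Re w - complex.Im z * complex.Im w.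
Proof. by case: z; case: w. Qed.

Lemma ImM z w : complex.Im (z * w) =
  complex.Re z * complex.Im w + complex.Im z * complex.Re w.
Proof. by case: z => a b; case: w => c d /=; rewrite [RHS]addrC addrC. Qed.

Lemma ReD z w : complex.Re (z + w) = complex.Re z + complex.Re w.
Proof. by case: z; case: w. Qed.

Lemma ImD z w : complex.Im (z + w) = complex.Im z + complex.Im w.
Proof. by case: z; case: w. Qed.

Lemma ReN z : complex.Re (- z) = - complex.Re z.
Proof. by case: z. Qed.

Lemma ImN z : complex.Im (- z) = - complex.Im z.
Proof. by case: z. Qed.

Lemma Re_conj z : complex.Re (conjc z) = complex.Re z.
Proof. by case: z. Qed.

Lemma Im_conj z : complex.Im (conjc z) = - complex.Im z.
Proof. by case: z. Qed.

End normc_theory.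

Lemma normc_sqrB (R : realType) (z w : R[i]) : Normc.normc (z - w) ^+ 2 =
  Normc.normc z ^+ 2 + Normc.normc w ^+ 2 - 2 * complex.Re (z * conjc w).
Proof. by rewrite !normcE2; case: z => p q; case: w => p' q' /=; ring. Qed.

Lemma ReM_real (R : realType) (z : R[i]) (b : R) :
  complex.Re (z * real_complex R b) = complex.Re z * b.
Proof. by case: z => p q /=; rewrite mulr0 subr0. Qed.

Section complex_integral.
Context d (T : measurableType d) (R : realType).
Variable mu : {measure set T -> \bar R}.
Implicit Types (f g : T -> R[i]).
Local Notation nc := (@Normc.normc R).

Definition cmfun f : Prop :=
  measurable_fun setT (fun x => complex.Re (f x)) /\
  measurable_fun setT (fun x => complex.Im (f x)).

Definition cintble f : Prop :=
  mu.-integrable setT (fun x => (complex.Re (f x))%:E) /\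
  mu.-integrable setT (fun x => (complex.Im (f x))%:E).

Definition cint f : R[i] :=
  ((\int[mu]_x complex.Re (f x)) +i* (\int[mu]_x complex.Im (f x)))%C.

Lemma cmfun_cst (z : R[i]) : cmfun (fun=> z).
Proof. by split; exact: measurable_cst. Qed.

Lemma cmfunD f g : cmfun f -> cmfun g -> cmfun (fun x => f x + g x).
Proof.
move=> [f1 f2] [g1 g2]; split.
  by under eq_fun do rewrite ReD; exact: measurable_funD.
by under eq_fun do rewrite ImD; exact: measurable_funD.
Qed.

Lemma cmfunN f : cmfun f -> cmfun (fun x => - f x).
Proof.
move=> [f1 f2]; split.
  by under eq_fun do rewrite ReN; exact: measurableT_comp.
by under eq_fun do rewrite ImN; exact: measurableT_comp.
Qed.

Lemma cmfunB f g : cmfun f -> cmfun g -> cmfun (fun x => f x - g x).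
Proof. by move=> mf mg; apply: cmfunD => //; exact: cmfunN. Qed.

Lemma cmfunM f g : cmfun f -> cmfun g -> cmfun (fun x => f x * g x).
Proof.
move=> [f1 f2] [g1 g2]; split.
  under eq_fun do rewrite ReM.
  by apply: measurable_funB; exact: measurable_funM.
under eq_fun do rewrite ImM.
by apply: measurable_funD; exact: measurable_funM.
Qed.

Lemma cmfun_conj f : cmfun f -> cmfun (fun x => conjc (f x)).
Proof.
move=> [f1 f2]; split.
  by under eq_fun do rewrite Re_conj.
by under eq_fun do rewrite Im_conj; exact: measurableT_comp.
Qed.

Lemma cmfun_real (h : T -> R) :
  measurable_fun setT h -> cmfun (fun x => real_complex R (h x)).
Proof. by move=> mh; split => //=; exact: measurable_cst. Qed.

Lemma cmfun_expi (h : T -> R) :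
  measurable_fun setT h -> cmfun (fun x => expi (h x)).
Proof.
move=> mh; split => /=.
  by apply: measurableT_comp => //; apply: continuous_measurable_fun;
     exact: continuous_cos.
by apply: measurableT_comp => //; apply: continuous_measurable_fun;
   exact: continuous_sin.
Qed.

Lemma cmfun_sum (I : Type) (r : seq I) (F : I -> T -> R[i]) :
  (forall i, cmfun (F i)) -> cmfun (fun x => \sum_(i <- r) F i x).
Proof.
move=> mF; elim: r => [|i r IH].
  by under eq_fun do rewrite big_nil; exact: cmfun_cst.
by under eq_fun do rewrite big_cons; exact: cmfunD.
Qed.

Lemma cmfun_prod (I : Type) (r : seq I) (F : I -> T -> R[i]) :
  (forall i, cmfun (F i)) -> cmfun (fun x => \prod_(i <- r) F i x).
Proof.
move=> mF; elim: r => [|i r IH].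
  by under eq_fun do rewrite big_nil; exact: cmfun_cst.
by under eq_fun do rewrite big_cons; exact: cmfunM.
Qed.

Lemma measurable_normc f : cmfun f -> measurable_fun setT (fun x => nc (f x)).
Proof.
move=> [f1 f2].
rewrite (_ : (fun x => _) = fun x =>
  Num.sqrt (complex.Re (f x) ^+ 2 + complex.Im (f x) ^+ 2)); last first.
  by apply/funext => x; case: (f x).
apply: (measurableT_comp (f := @Num.sqrt R)).
  by apply: continuous_measurable_fun; exact: sqrt_continuous.
by apply: measurable_funD; exact: measurable_funX.
Qed.

Lemma cintble_cmfun f : cintble f -> cmfun f.
Proof. by move=> [/measurable_int/measurable_EFinP ? /measurable_int/measurable_EFinP]. Qed.

Lemma le_cintble f (h : T -> R) : cmfun f -> (forall x, nc (f x) <= h x) ->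
  mu.-integrable setT (fun x => (h x)%:E) -> cintble f.
Proof.
move=> [f1 f2] fh ih; split.
- apply: (le_integrable _ _ _ ih) => //; first exact/measurable_EFinP.
  move=> x _; rewrite /= lee_fin (le_trans (Re_le_normc _))//.
  by rewrite (le_trans (fh x))// ler_norm.
- apply: (le_integrable _ _ _ ih) => //; first exact/measurable_EFinP.
  move=> x _; rewrite /= lee_fin (le_trans (Im_le_normc _))//.
  by rewrite (le_trans (fh x))// ler_norm.
Qed.

Lemma cintble_normc f : cintble f ->
  mu.-integrable setT (fun x => (nc (f x))%:E).
Proof.
move=> cf; have mf := cintble_cmfun cf; case: cf => f1 f2.
have := integrableD measurableT (integrable_abse f1) (integrable_abse f2).
apply: le_integrable => //; first by apply/measurable_EFinP; exact: measurable_normc.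
move=> x _ /=; rewrite lee_fin ger0_norm ?normc_ge0// ger0_norm ?addr_ge0//.
exact: normc_le_ReIm.
Qed.

Lemma eq_cint f g : f =1 g -> cint f = cint g.
Proof. by move=> fg; congr cint; apply/funext. Qed.

Lemma cintbleD f g : cintble f -> cintble g -> cintble (fun x => f x + g x).
Proof.
move=> [f1 f2] [g1 g2]; split.
  by under eq_fun do rewrite ReD EFinD; exact: integrableD.
by under eq_fun do rewrite ImD EFinD; exact: integrableD.
Qed.

Lemma cintbleM_bounded f g (M : R) : cintble f -> cmfun g ->
  (forall x, nc (g x) <= M) -> cintble (fun x => f x * g x).
Proof.
move=> cf mg gM; apply: (@le_cintble _ (fun x => M * nc (f x))).
- by apply: cmfunM => //; exact: cintble_cmfun.
- by move=> x; rewrite Normc.normcM mulrC ler_wpM2r ?normc_ge0.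
- under eq_fun do rewrite EFinM.
  by apply: integrableZl => //; exact: cintble_normc.
Qed.

Lemma cintbleZ (z : R[i]) f : cintble f -> cintble (fun x => z * f x).
Proof.
move=> cf; under eq_fun do rewrite mulrC.
by apply: (@cintbleM_bounded _ _ (nc z)) => //; exact: cmfun_cst.
Qed.

Lemma cintbleN f : cintble f -> cintble (fun x => - f x).
Proof. by move=> /(@cintbleZ (-1)); under eq_fun do rewrite mulN1r. Qed.

Lemma cintbleB f g : cintble f -> cintble g -> cintble (fun x => f x - g x).
Proof. by move=> cf /cintbleN; exact: cintbleD. Qed.

Lemma cintble0 : cintble (fun=> 0).
Proof. by split; exact: integrable0. Qed.

Lemma cintble_sum (I : Type) (r : seq I) (F : I -> T -> R[i]) :
  (forall i, cintble (F i)) -> cintble (fun x => \sum_(i <- r) F i x).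
Proof.
move=> iF; elim: r => [|i r IH].
  by under eq_fun do rewrite big_nil; exact: cintble0.
by under eq_fun do rewrite big_cons; exact: cintbleD.
Qed.

Lemma cintble_conj f : cintble f -> cintble (fun x => conjc (f x)).
Proof.
move=> [f1 f2]; split; first by under eq_fun do rewrite Re_conj.
by under eq_fun do rewrite Im_conj EFinN; exact: integrableN.
Qed.

Lemma cintD f g : cintble f -> cintble g ->
  cint (fun x => f x + g x) = cint f + cint g.
Proof.
move=> [f1 f2] [g1 g2]; rewrite /cint.
apply/eqP; rewrite eq_complex /=; apply/andP; split; apply/eqP.
- by rewrite -RintegralD//; apply: eq_Rintegral => x _; rewrite ReD.
- by rewrite -RintegralD//; apply: eq_Rintegral => x _; rewrite ImD.
Qed.

Lemma cintZ (z : R[i]) f : cintble f -> cint (fun x => z * f x) = z * cint f.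
Proof.
move=> [f1 f2]; rewrite /cint; case: z => a b.
have i1 c : mu.-integrable setT (EFin \o (fun x => c * complex.Re (f x))).
  by rewrite /comp; under eq_fun do rewrite EFinM; exact: integrableZl.
have i2 c : mu.-integrable setT (EFin \o (fun x => c * complex.Im (f x))).
  by rewrite /comp; under eq_fun do rewrite EFinM; exact: integrableZl.
apply/eqP; rewrite eq_complex /=; apply/andP; split; apply/eqP.
- rewrite -!RintegralZl// -RintegralB//.
  by apply: eq_Rintegral => x _; rewrite ReM.
- rewrite -!RintegralZl// -RintegralD//.
  by apply: eq_Rintegral => x _; rewrite ImM.
Qed.

Lemma cintN f : cintble f -> cint (fun x => - f x) = - cint f.
Proof.
by move=> cf; rewrite -[RHS]mulN1r -cintZ//; apply: eq_cint => x; rewrite mulN1r.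
Qed.

Lemma cintB f g : cintble f -> cintble g ->
  cint (fun x => f x - g x) = cint f - cint g.
Proof. by move=> cf cg; rewrite cintD// ?cintN//; exact: cintbleN. Qed.

Lemma cint0 : cint (fun=> 0) = 0.
Proof. by rewrite /cint /= Rintegral_cst// mul0r. Qed.

Lemma cint_sum (I : Type) (r : seq I) (F : I -> T -> R[i]) :
  (forall i, cintble (F i)) ->
  cint (fun x => \sum_(i <- r) F i x) = \sum_(i <- r) cint (F i).
Proof.
move=> iF; elim: r => [|i r IH].
  by rewrite big_nil -[RHS]cint0; apply: eq_cint => x; rewrite big_nil.
rewrite big_cons -IH -cintD//; last exact: cintble_sum.
by apply: eq_cint => x; rewrite big_cons.
Qed.

Lemma cint_conj f : cintble f -> cint (fun x => conjc (f x)) = conjc (cint f).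
Proof.
move=> [f1 f2]; rewrite /cint; apply/eqP; rewrite eq_complex /=.
apply/andP; split; apply/eqP.
  by apply: eq_Rintegral => x _; rewrite Re_conj.
rewrite -[RHS]mulN1r -RintegralZl//.
by apply: eq_Rintegral => x _; rewrite Im_conj mulN1r.
Qed.

Lemma cint_real (h : T -> R) :
  cint (fun x => real_complex R (h x)) = real_complex R (\int[mu]_x h x).
Proof. by rewrite /cint /= Rintegral_cst// mul0r. Qed.

(* Rotating the integral to the positive half-line reduces the bound to the
   one for the real part. *)
Lemma normc_cint_le f : cintble f -> nc (cint f) <= \int[mu]_x nc (f x).
Proof.
move=> cf; set z := cint f.
have [->|z0] := eqVneq z 0.
  by rewrite Normc.normc0 Rintegral_ge0// => x _; exact: normc_ge0.
have nz : nc z != 0 by apply: contra_neq z0; exact: Normc.eq0_normc.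
pose c := real_complex R (nc z)^-1 * conjc z.
have ncc : nc c = 1.
  by rewrite Normc.normcM normc_real normc_conj ger0_norm ?invr_ge0 ?normc_ge0// mulVf.
have -> : nc z = complex.Re (cint (fun x => c * f x)).
  rewrite cintZ// -/z -mulrA [conjc z * z]mulrC mulc_conj -rmorphM/=.
  by rewrite expr2 mulrA mulVf// mul1r.
have ccf := cintbleZ c cf.
apply: le_Rintegral => //; first exact: ccf.1.
  exact: cintble_normc.
move=> x _; rewrite (le_trans (ler_norm _))// (le_trans (Re_le_normc _))//.
by rewrite Normc.normcM ncc mul1r.
Qed.

End complex_integral.

Lemma ge0_integrable d (T : measurableType d) (R : realType)
    (mu : {measure set T -> \bar R}) (h : T -> R) :
  measurable_fun setT h -> (forall x, 0 <= h x) ->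
  (\int[mu]_x (h x)%:E < +oo)%E -> mu.-integrable setT (fun x => (h x)%:E).
Proof.
move=> mh h0 hoo; apply/integrableP; split; first exact/measurable_EFinP.
by under eq_integral do rewrite gee0_abs ?lee_fin//.
Qed.

(** * Cauchy-Schwarz inequality and dominated convergence *)

Section real_cauchy_schwarz.
Context d (T : measurableType d) (R : realType).
Variable mu : {measure set T -> \bar R}.
Implicit Types a b : T -> R.

Lemma integrable_prod_sqr a b :
  measurable_fun setT a -> measurable_fun setT b ->
  mu.-integrable setT (fun x => (a x ^+ 2)%:E) ->
  mu.-integrable setT (fun x => (b x ^+ 2)%:E) ->
  mu.-integrable setT (fun x => (a x * b x)%:E).
Proof.
move=> ma mb ia ib.
have := integrableD measurableT ia ib.
apply: le_integrable => //.
  by apply/measurable_EFinP; exact: measurable_funM.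
move=> x _ /=; rewrite lee_fin [leRHS]ger0_norm ?addr_ge0 ?sqr_ge0//.
rewrite normrM -(real_normK (num_real (a x))) -(real_normK (num_real (b x))).
have := sqr_ge0 (`|a x| - `|b x|); have := normr_ge0 (a x); have := normr_ge0 (b x).
nra.
Qed.

(** The quadratic [t |-> int (t a - b)^2] is nonnegative, so its discriminant cannot be positive. *)
Lemma cauchy_schwarz_sqr a b :
  measurable_fun setT a -> measurable_fun setT b ->
  mu.-integrable setT (fun x => (a x ^+ 2)%:E) ->
  mu.-integrable setT (fun x => (b x ^+ 2)%:E) ->
  (\int[mu]_x (a x * b x)) ^+ 2 <=
    \int[mu]_x (a x ^+ 2) * \int[mu]_x (b x ^+ 2).
Proof.
move=> ma mb ia ib; have iab := integrable_prod_sqr ma mb ia ib.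
set A := Rintegral _ _ (fun x => a x ^+ 2); set B := Rintegral _ _ (fun x => b x ^+ 2).
set P := Rintegral _ _ _.
have A0 : 0 <= A by apply: Rintegral_ge0 => x _; exact: sqr_ge0.
have quad t : 0 <= t ^+ 2 * A - 2 * t * P + B.
  rewrite -!RintegralZl//.
  have iA : mu.-integrable setT (EFin \o (fun x => t ^+ 2 * a x ^+ 2)).
    by rewrite /comp; under eq_fun do rewrite EFinM; exact: integrableZl.
  have iP : mu.-integrable setT (EFin \o (fun x => 2 * t * (a x * b x))).
    by rewrite /comp; under eq_fun do rewrite EFinM; exact: integrableZl.
  rewrite -RintegralB// -RintegralD//; last first.
    by rewrite /comp; under eq_fun do rewrite EFinB; exact: integrableB.
  apply: Rintegral_ge0 => x _.
  rewrite (_ : _ + _ = (t * a x - b x) ^+ 2) ?sqr_ge0//; ring.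
have [A_eq0|A_neq0] := eqVneq A 0.
  rewrite A_eq0 mul0r.
  suff -> : P = 0 by rewrite expr0n.
  apply/eqP/negPn/negP => P0.
  (* With [A = 0] the quadratic is affine in [t]; at this [t] its value is -1. *)
  have := quad ((B + 1) / (2 * P)).
  rewrite A_eq0 mulr0 add0r (_ : - _ + B = -1) ?oppr_ge0 ?ler10//.
  by field.
have A_gt0 : 0 < A by rewrite lt_neqAle eq_sym A_neq0.
have := quad (P / A).
rewrite -(pmulr_rge0 _ A_gt0) (_ : A * _ = A * B - P ^+ 2) ?subr_ge0//.
by field.
Qed.

End real_cauchy_schwarz.

Section complex_integral_limits.
Context d (T : measurableType d) (R : realType).
Variable mu : {measure set T -> \bar R}.
Local Notation nc := (@Normc.normc R).

Lemma cint_dominated_cvg (F : (T -> R[i])^nat) (f : T -> R[i]) (h : T -> R) :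
  (forall n, cmfun (F n)) -> cmfun f ->
  (forall n x, nc (F n x) <= h x) -> (forall x, nc (f x) <= h x) ->
  mu.-integrable setT (fun x => (h x)%:E) ->
  (forall x, nc (F n x - f x) @[n --> \oo] --> 0) ->
  nc (cint mu (F n) - cint mu f) @[n --> \oo] --> 0.
Proof.
move=> mF mf Fh fh ih Ff.
have iF n : cintble mu (F n) by exact: (@le_cintble _ _ _ _ _ h).
have if_ : cintble mu f by exact: (@le_cintble _ _ _ _ _ h).
have iD n : mu.-integrable setT (fun x => (nc (F n x - f x))%:E).
  by apply: cintble_normc; exact: cintbleB.
have ih2 : mu.-integrable setT (fun x => (2 * h x)%:E).
  by under eq_fun do rewrite EFinM; exact: integrableZl.
have dom n x : setT x -> (`|(nc (F n x - f x))%:E| <= (2 * h x)%:E)%E.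
  move=> _; rewrite /= lee_fin ger0_norm ?normc_ge0//.
  rewrite (le_trans (le_normcD _ _))// normcN mulr_natl mulr2n lerD//.
have Ff' x : (nc (F n x - f x))%:E @[n --> \oo] --> 0%E.
  by apply: cvg_EFin; [exact: nearW|exact: Ff].
have [_ _ lim0] := @dominated_convergence _ _ _ mu setT measurableT
  (fun n x => (nc (F n x - f x))%:E) (fun=> 0%E) (fun x => (2 * h x)%:E)
  (fun n => measurable_int mu (iD n)) (measurable_cst _)
  (aeW _ (fun x _ => Ff' x)) ih2
  (aeW _ (fun x n => dom n x)).
have {}lim0 : \int[mu]_x nc (F n x - f x) @[n --> \oo] --> 0.
  by apply: fine_cvg; rewrite integral0 in lim0.
apply: (squeeze_cvgr _ (cvg_cst 0) lim0).
apply: nearW => n; apply/andP; split; first exact: normc_ge0.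
by rewrite -cintB//; apply: normc_cint_le; exact: cintbleB.
Qed.

End complex_integral_limits.

Lemma cmfun_comp d1 d2 (T1 : measurableType d1) (T2 : measurableType d2)
    (R : realType) (f : T2 -> R[i]) (phi : T1 -> T2) :
  measurable_fun setT phi -> cmfun f -> cmfun (f \o phi).
Proof. by move=> mphi [f1 f2]; split; [exact: (measurableT_comp f1 mphi)|exact: (measurableT_comp f2 mphi)]. Qed.

(** * Fubini's theorem for complex-valued functions *)

Section complex_fubini.
Context d1 d2 (T1 : measurableType d1) (T2 : measurableType d2) (R : realType).
Variable m1 : {sigma_finite_measure set T1 -> \bar R}.
Variable m2 : {sigma_finite_measure set T2 -> \bar R}.
Local Notation nc := (@Normc.normc R).

Lemma integrable_tensor (a : T1 -> R) (b : T2 -> R) :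
  m1.-integrable setT (EFin \o a) -> m2.-integrable setT (EFin \o b) ->
  (m1 \x m2)%E.-integrable setT (fun p => (a p.1 * b p.2)%:E).
Proof.
move=> ia ib.
have ma : measurable_fun setT a by apply/measurable_EFinP/(measurable_int m1).
have mb : measurable_fun setT b by apply/measurable_EFinP/(measurable_int m2).
have mab : measurable_fun setT (fun p : T1 * T2 => (a p.1 * b p.2)%:E).
  by apply/measurable_EFinP; apply: measurable_funM; exact: measurableT_comp.
apply: (integrable12ltyP m1 m2 mab).2 => /=.
have ib' := integrable_norm ib.
have ia' := integrable_norm ia.
rewrite (eq_integral (fun x => (`|a x| * \int[m2]_y `|b y|)%:E)).
  under eq_integral do rewrite mulrC EFinM.
  rewrite integralZl//; apply: lte_mul_pinfty => //.
  - by rewrite lee_fin Rintegral_ge0.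
  - exact: integrable_lty.
move=> x _; under eq_integral do rewrite normrM EFinM.
rewrite integralZl// EFinM; congr (_ * _)%E.
by rewrite /Rintegral fineK//; exact: integrable_fin_num.
Qed.

Lemma cintble_tensor (a : T1 -> R[i]) (b : T2 -> R[i]) :
  cintble m1 a -> cintble m2 b ->
  cintble (m1 \x m2)%E (fun p => a p.1 * b p.2).
Proof.
move=> ia ib.
have ma := cintble_cmfun ia; have mb := cintble_cmfun ib.
apply: (@le_cintble _ _ _ _ _ (fun p => nc (a p.1) * nc (b p.2))).
- apply: cmfunM; first exact: (cmfun_comp measurable_fst ma).
  exact: (cmfun_comp measurable_snd mb).
- by move=> x; rewrite Normc.normcM.
- exact: (integrable_tensor (cintble_normc ia) (cintble_normc ib)).
Qed.

(** Integrability of every section, and not only of almost every one, makes the inner integral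
    finite at each point, so that it passes from the extended reals to the reals without an
    exceptional set. *)
Lemma cint_prod1 (F : T1 * T2 -> R[i]) :
  (forall x, cintble m2 (fun y => F (x, y))) -> cintble (m1 \x m2)%E F ->
  cint (m1 \x m2)%E F = cint m1 (fun x => cint m2 (fun y => F (x, y))).
Proof.
move=> iF2 [F1 F2]; rewrite /cint; apply/eqP; rewrite eq_complex /=.
apply/andP; split; apply/eqP.
- rewrite /Rintegral -(integral12_prod_meas1 F1); congr fine.
  apply: eq_integral => x _; rewrite fineK//.
  by apply: integrable_fin_num => //; exact: (iF2 x).1.
- rewrite /Rintegral -(integral12_prod_meas1 F2); congr fine.
  apply: eq_integral => x _; rewrite fineK//.
  by apply: integrable_fin_num => //; exact: (iF2 x).2.
Qed.

Lemma cint_prod2 (F : T1 * T2 -> R[i]) :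
  (forall y, cintble m1 (fun x => F (x, y))) -> cintble (m1 \x m2)%E F ->
  cint (m1 \x m2)%E F = cint m2 (fun y => cint m1 (fun x => F (x, y))).
Proof.
move=> iF1 [F1 F2]; rewrite /cint; apply/eqP; rewrite eq_complex /=.
apply/andP; split; apply/eqP.
- rewrite /Rintegral -(integral21_prod_meas1 F1); congr fine.
  apply: eq_integral => x _; rewrite fineK//.
  by apply: integrable_fin_num => //; exact: (iF1 x).1.
- rewrite /Rintegral -(integral21_prod_meas1 F2); congr fine.
  apply: eq_integral => x _; rewrite fineK//.
  by apply: integrable_fin_num => //; exact: (iF1 x).2.
Qed.

Lemma cint_fubini (F : T1 * T2 -> R[i]) :
  (forall x, cintble m2 (fun y => F (x, y))) ->
  (forall y, cintble m1 (fun x => F (x, y))) -> cintble (m1 \x m2)%E F ->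
  cint m1 (fun x => cint m2 (fun y => F (x, y))) =
  cint m2 (fun y => cint m1 (fun x => F (x, y))).
Proof. by move=> F1 F2 iF; rewrite -cint_prod1// -cint_prod2. Qed.

Lemma cmfun_cint (F : T1 * T2 -> R[i]) : cintble (m1 \x m2)%E F ->
  cmfun (fun x => cint m2 (fun y => F (x, y))).
Proof.
move=> [F1 F2]; split => /=.
- exact: (measurableT_comp (fine_measurable measurableT)
    (measurable_fubini_F F1)).
- exact: (measurableT_comp (fine_measurable measurableT)
    (measurable_fubini_F F2)).
Qed.

Lemma cintble_cint1 (F : T1 * T2 -> R[i]) :
  (forall x, cintble m2 (fun y => F (x, y))) -> cintble (m1 \x m2)%E F ->
  cintble m1 (fun x => cint m2 (fun y => F (x, y))).
Proof.
move=> iF [F1 F2]; split.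
- have := integrable_fubini_F F1; apply: eq_integrable => // x _.
  by rewrite /fubini_F /= /Rintegral fineK//; apply: integrable_fin_num => //; exact: (iF x).1.
- have := integrable_fubini_F F2; apply: eq_integrable => // x _.
  by rewrite /fubini_F /= /Rintegral fineK//; apply: integrable_fin_num => //; exact: (iF x).2.
Qed.

Lemma cintble_cint2 (F : T1 * T2 -> R[i]) :
  (forall y, cintble m1 (fun x => F (x, y))) -> cintble (m1 \x m2)%E F ->
  cintble m2 (fun y => cint m1 (fun x => F (x, y))).
Proof.
move=> iF [F1 F2].
have main (f : T1 * T2 -> R) : (m1 \x m2)%E.-integrable setT (EFin \o f) ->
    (forall y, m1.-integrable setT (fun x => (f (x, y))%:E)) ->
    m2.-integrable setT (fun y => (\int[m1]_x f (x, y))%:E).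
  move=> if_ ifs; have mG := measurable_fubini_G if_.
  have EG y : (\int[m1]_x f (x, y))%:E = fubini_G m1 (EFin \o f) y.
    by rewrite /fubini_G /= /Rintegral fineK//; exact: integrable_fin_num.
  under eq_fun do rewrite EG.
  apply/integrableP; split=> //.
  apply: le_lt_trans ((integrable21ltyP m1 m2 (measurable_int _ if_)).1 if_).
  apply: ge0_le_integral => //.
  - exact: measurableT_comp.
  - apply: (measurable_fun_fubini_tonelli_G (abse \o (EFin \o f))) => //=.
    by apply: measurableT_comp => //; exact: measurable_int if_.
  - by move=> y _; apply: le_abse_integral => //; exact: measurable_int (ifs y).
by split; [apply: (main (fun p => complex.Re (F p)) F1) => y; exact: (iF y).1
          |apply: (main (fun p => complex.Im (F p)) F2) => y; exact: (iF y).2].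
Qed.

End complex_fubini.

(** * Integrals of products over the coordinates *)

Section lebesgue_rV_integral.
Variable R : realType.
Local Notation nc := (@Normc.normc R).
Local Notation leb := (@lebesgue_measure R).
Local Notation mu n := (lebesgue_rV R n).

(** Lebesgue measure on [R^0] is a Dirac mass, so this is the base of the induction on the dimension
    in [cint_tensor]. *)
Lemma cint_dirac d (T : measurableType d) (a : T) (f : T -> R[i]) :
  cmfun f -> cint (@dirac _ T a R) f = f a.
Proof.
move=> [f1 f2]; rewrite /cint /Rintegral !integral_dirac//=; last 2 first.
- exact/measurable_EFinP.
- exact/measurable_EFinP.
by rewrite indicT !mul1r [RHS]complex_eta.
Qed.

Lemma cintble_dirac d (T : measurableType d) (a : T) (f : T -> R[i]) :
  cmfun f -> cintble (@dirac _ T a R) f.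
Proof.
move=> [f1 f2]; split; apply/integrableP; split.
- exact/measurable_EFinP.
- rewrite integral_dirac//=; last by apply/measurable_EFinP; exact: measurableT_comp.
  by rewrite diracT mul1e ltry.
- exact/measurable_EFinP.
- rewrite integral_dirac//=; last by apply/measurable_EFinP; exact: measurableT_comp.
  by rewrite diracT mul1e ltry.
Qed.

Lemma integrable_rV_cons n (f : 'rV[R]_n.+1 -> \bar R) :
  measurable_fun setT f ->
  (leb \x mu n)%E.-integrable setT (f \o @rV_cons R n) ->
  (mu n.+1).-integrable setT f.
Proof.
by move=> mf ifc; apply: (integrable_pushforward (@measurable_rV_cons R n) mf).
Qed.

Lemma Rintegral_rV_cons n (f : 'rV[R]_n.+1 -> R) :
  measurable_fun setT f ->
  (leb \x mu n)%E.-integrable setT (EFin \o f \o @rV_cons R n) ->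
  \int[mu n.+1]_x f x = \int[(leb \x mu n)%E]_p f (rV_cons p).
Proof.
move=> mf ifc; congr fine.
by apply: (integral_pushforward (@measurable_rV_cons R n)) => //; exact/measurable_EFinP.
Qed.

Lemma cintble_rV_cons n (f : 'rV[R]_n.+1 -> R[i]) : cmfun f ->
  cintble (leb \x mu n)%E (f \o @rV_cons R n) -> cintble (mu n.+1) f.
Proof.
by move=> [m1 m2] [f1 f2]; split; apply: integrable_rV_cons => //; exact/measurable_EFinP.
Qed.

Lemma cint_rV_cons n (f : 'rV[R]_n.+1 -> R[i]) : cmfun f ->
  cintble (leb \x mu n)%E (f \o @rV_cons R n) ->
  cint (mu n.+1) f = cint (leb \x mu n)%E (f \o @rV_cons R n).
Proof. by move=> [m1 m2] [f1 f2]; rewrite /cint !Rintegral_rV_cons. Qed.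

Lemma cmfun_tensor n (h : 'I_n -> R -> R[i]) :
  (forall i, cmfun (T := measurableTypeR R) (h i)) ->
  cmfun (fun x : 'rV[R]_n => \prod_(i < n) h i (x 0 i)).
Proof.
move=> mh; apply: (@cmfun_prod _ _ _ _ _ (fun i (x : 'rV[R]_n) => h i (x 0 i))) => i.
exact: (cmfun_comp (measurable_rV_coord i) (mh i)).
Qed.

Lemma tensor_rV_cons n (h : 'I_n.+1 -> R -> R[i]) (p : R * 'rV[R]_n) :
  \prod_(i < n.+1) h i (rV_cons p 0 i) =
  h ord0 p.1 * \prod_(i < n) h (lift ord0 i) (p.2 0 i).
Proof.
rewrite big_ord_recl mxE unlift_none/=; congr (_ * _).
by apply: eq_bigr => i _; rewrite mxE liftK.
Qed.

(** Every explicit integral on [R^n] below (Gaussians, exponentials on the cube, step functions) is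
    reduced by this to one dimension. Fubini peels off one coordinate at a time. *)
Lemma cint_tensor n (h : 'I_n -> R -> R[i]) :
  (forall i, cintble leb (h i)) ->
  cintble (mu n) (fun x => \prod_(i < n) h i (x 0 i)) /\
  cint (mu n) (fun x => \prod_(i < n) h i (x 0 i)) =
    \prod_(i < n) cint leb (h i).
Proof.
elim: n h => [|n IH] h ih.
  have mf : cmfun (fun x : 'rV[R]_0 => \prod_(i < 0) h i (x 0 i)).
    by apply: cmfun_tensor => -[].
  split; first exact: cintble_dirac.
  by rewrite big_ord0 [LHS]cint_dirac// big_ord0.
have [IH1 IH2] := IH (fun i => h (lift ord0 i)) (fun i => ih (lift ord0 i)).
have mf : cmfun (fun x : 'rV[R]_n.+1 => \prod_(i < n.+1) h i (x 0 i)).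
  by apply: cmfun_tensor => i; exact: cintble_cmfun (ih i).
have E : (fun x : 'rV[R]_n.+1 => \prod_(i < n.+1) h i (x 0 i)) \o @rV_cons R n =
  (fun p => h ord0 p.1 * \prod_(i < n) h (lift ord0 i) (p.2 0 i)).
  by apply/funext => p /=; rewrite tensor_rV_cons.
have iE := cintble_tensor (ih ord0) IH1.
split; first by apply: cintble_rV_cons => //; rewrite E.
rewrite cint_rV_cons//; last by rewrite E.
rewrite E cint_prod1//; last by move=> x /=; exact: cintbleZ.
rewrite big_ord_recl -IH2 [RHS]mulrC -cintZ//.
by apply: eq_cint => x /=; rewrite cintZ// mulrC.
Qed.

End lebesgue_rV_integral.

Section real_dominated_cvg.
Context d (T : measurableType d) (R : realType).
Variable mu : {measure set T -> \bar R}.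

Lemma Rintegral_dominated_cvg (F : (T -> R)^nat) (f h : T -> R) :
  (forall n, measurable_fun setT (F n)) -> measurable_fun setT f ->
  (forall n x, `|F n x| <= h x) -> mu.-integrable setT (fun x => (h x)%:E) ->
  (forall x, F n x @[n --> \oo] --> f x) ->
  \int[mu]_x F n x @[n --> \oo] --> \int[mu]_x f x.
Proof.
move=> mF mf Fh ih Ff.
have Ff' x : setT x -> (F n x)%:E @[n --> \oo] --> (f x)%:E.
  by move=> _; apply: cvg_EFin; [exact: nearW|exact: Ff].
have dom x n : setT x -> (`|(F n x)%:E| <= (h x)%:E)%E by rewrite lee_fin Fh.
have mF' n : measurable_fun setT (EFin \o F n) by exact/measurable_EFinP.
have mf' : measurable_fun setT (EFin \o f) by exact/measurable_EFinP.
have [if_ _ lim] := dominated_convergence measurableT mF' mf' (aeW _ Ff') ih (aeW _ dom).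
by apply: fine_cvg; rewrite /Rintegral fineK//; exact: integrable_fin_num.
Qed.

End real_dominated_cvg.

(** * Gaussians *)

Section gaussian_1d.
Variable R : realType.
Local Notation leb := (@lebesgue_measure R).
Implicit Types (e a b t : R).

Definition gauss e t : R := expR (- (e / 2 * t ^+ 2)).

Lemma gauss_ge0 e t : 0 <= gauss e t. Proof. exact: expR_ge0. Qed.

Lemma continuous_gauss e : continuous (gauss e).
Proof.
move=> x; apply: (@continuous_comp _ _ _ (fun t : R => - (e / 2 * t ^+ 2)) expR).
  apply: (@continuousN _ _ _ (fun t : R => e / 2 * t ^+ 2)).
  apply: (@continuousM _ _ (fun=> e / 2) (fun t : R => t ^+ 2)); first exact: cst_continuous.
  exact: exprn_continuous.
exact: continuous_expR.
Qed.

Lemma measurable_gauss e : measurable_fun setT (gauss e).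
Proof. exact: continuous_measurable_fun (@continuous_gauss e). Qed.

(** Makes the integral of a Gaussian that of a probability density of variance [1 / e]. *)
Lemma gauss_normal_pdf e c t : 0 < e ->
  gauss e (t - c) = Num.sqrt (2 * pi / e) * normal_pdf c (Num.sqrt e)^-1 t.
Proof.
move=> e0; have s0 : (Num.sqrt e)^-1 != 0 by rewrite gt_eqF// invr_gt0 sqrtr_gt0.
rewrite normal_pdfE// /normal_peak /normal_fun /gauss.
have -> : (Num.sqrt e)^-1 ^+ 2 = e^-1 by rewrite exprVn sqr_sqrtr// ltW.
rewrite -[_ * pi *+ 2]mulr_natr -[e^-1 *+ 2]mulr_natr.
rewrite (_ : 2 * pi / e = e^-1 * pi * 2); last by ring.
rewrite [RHS]mulrA mulfV ?mul1r; last first.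
  by rewrite gt_eqF// sqrtr_gt0 !mulr_gt0 ?invr_gt0 ?pi_gt0.
by congr expR; field; rewrite gt_eqF.
Qed.

Lemma integrable_gauss_center e c : 0 < e ->
  leb.-integrable setT (fun t => (gauss e (t - c))%:E).
Proof.
move=> e0; under eq_fun do rewrite (gauss_normal_pdf _ _ e0) EFinM.
apply: integrableZl => //; apply: integrable_normal_pdf.
Qed.

Lemma integrable_gauss e : 0 < e -> leb.-integrable setT (EFin \o gauss e).
Proof. by move/(integrable_gauss_center 0); under eq_fun do rewrite subr0. Qed.

Lemma Rintegral_gauss_center e c : 0 < e ->
  \int[leb]_t gauss e (t - c) = Num.sqrt (2 * pi / e).
Proof.
move=> e0; under eq_Rintegral do rewrite (gauss_normal_pdf _ _ e0).
rewrite RintegralZl//; last exact: integrable_normal_pdf.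
by rewrite /Rintegral integral_normal_pdf// mulr1.
Qed.

Lemma Rintegral_gauss e : 0 < e ->
  \int[leb]_t gauss e t = Num.sqrt (2 * pi / e).
Proof.
by move/(Rintegral_gauss_center 0); under eq_Rintegral do rewrite subr0.
Qed.

(** Half of the exponent absorbs [|t|]: with [1 + y <= expR y] the claim becomes that
    [sqrt e * |t| / 2 - 1] has a nonnegative square. It yields an integrable majorant for the
    derivative of the Fourier integral. *)
Lemma le_id_gauss e t : 0 < e ->
  `|t| * gauss e t <= (Num.sqrt e)^-1 * gauss (e / 2) t.
Proof.
move=> e0; have se : 0 < Num.sqrt e by rewrite sqrtr_gt0.
have -> : gauss e t = expR (- (e / 4 * t ^+ 2)) * gauss (e / 2) t.
  by rewrite /gauss -expRD; congr expR; field.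
rewrite mulrA ler_wpM2r ?gauss_ge0// expRN.
rewrite ler_pdivrMr ?expR_gt0// ler_pdivlMl//.
apply: (le_trans _ (expR_ge1Dx _)).
rewrite -(real_normK (num_real t)) -{2}[e](sqr_sqrtr (ltW e0)).
rewrite -subr_ge0 (_ : _ - _ = (Num.sqrt e * `|t| / 2 - 1) ^+ 2) ?sqr_ge0//.
by field.
Qed.

Lemma integrable_id_gauss e : 0 < e ->
  leb.-integrable setT (fun t => (`|t| * gauss e t)%:E).
Proof.
move=> e0; have e20 : 0 < e / 2 by rewrite divr_gt0.
have := integrableZl measurableT (Num.sqrt e)^-1 (integrable_gauss e20).
apply: le_integrable => //.
  apply/measurable_EFinP; apply: measurable_funM; last exact: measurable_gauss.
  exact: normr_measurable.
move=> t _ /=; rewrite lee_fin [leRHS]ger0_norm ?mulr_ge0 ?gauss_ge0 ?invr_ge0//.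
by rewrite ger0_norm ?mulr_ge0 ?gauss_ge0//; exact: le_id_gauss.
Qed.

Lemma cvg_gauss_nat e : 0 < e -> gauss e n%:R @[n --> \oo] --> 0.
Proof.
move=> e0.
have c : 2 / e * n.+1%:R^-1 @[n --> \oo] --> 0.
  rewrite -[X in _ --> X](mulr0 (2 / e)); apply: cvgM; first exact: cvg_cst.
  exact: cvg_harmonic.
rewrite -cvg_shiftS; apply: (squeeze_cvgr _ (cvg_cst 0) c).
apply: nearW => n /=; rewrite gauss_ge0 /gauss expRN /=.
rewrite -[leRHS]invrK lef_pV2 ?posrE ?expR_gt0 ?invr_gt0 ?mulr_gt0 ?divr_gt0 ?invr_gt0//.
apply: (le_trans _ (expR_ge1Dx _)).
rewrite invfM invrK invf_div.
apply: ler_wpDl => //.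
by rewrite ler_wpM2l ?divr_ge0 ?(ltW e0)// expr2 ler_peMl// ler1n.
Qed.

(** The fundamental theorem of calculus on [[- n.+1, n.+1]], then dominated convergence. This is
    integration by parts on the line once [F] is a product. *)
Lemma Rintegral_derive_eq0 (F f : R -> R) :
  (forall x, is_derive x (1 : R) F (f x)) -> continuous f ->
  leb.-integrable setT (EFin \o f) ->
  F n%:R @[n --> \oo] --> 0 -> F (- n%:R) @[n --> \oo] --> 0 ->
  \int[leb]_x f x = 0.
Proof.
move=> dF cf intf F1 F2.
pose A n := `[- n.+1%:R, n.+1%:R]%classic : set R.
have fA n : (\int[leb]_x ((f \_ (A n)) x)%:E = (F n.+1%:R - F (- n.+1%:R))%:E)%E.
  rewrite EFinB -(@continuous_FTC2 _ f F).
  - by rewrite [RHS]integral_mkcond restrict_EFin.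
  - by rewrite gtrN.
  - exact: continuous_subspaceT.
  - have dF' x : derivable F x 1 by exact: ex_derive.
    split; first by move=> x _.
      by apply: cvg_at_right_filter; apply: differentiable_continuous; apply/derivable1_diffP.
    by apply: cvg_at_left_filter; apply: differentiable_continuous; apply/derivable1_diffP.
  - by move=> x _; rewrite derive1E derive_val.
have mA n : measurable (A n) by exact: measurable_itv.
have mf : measurable_fun setT (EFin \o f) := measurable_int leb intf.
have mfA n : measurable_fun setT (fun x => ((f \_ (A n)) x)%:E).
  apply/measurable_EFinP/(measurable_restrictT _ _).1 => //.
  by apply: measurable_funTS; exact/measurable_EFinP.
have fA_f x : ((f \_ (A n)) x)%:E @[n --> \oo] --> (f x)%:E.
  apply: cvg_near_cst; exists (Num.truncn `|x|).+1 => // n /= xn.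
  rewrite patchE mem_set//=; last first.
  rewrite /A/= in_itv/= -ler_norml.
  apply: (le_trans (ltW (truncnS_gt `|x|))).
  by rewrite ler_nat; exact: (leq_trans xn (leqnSn n)).
have lim' : \int[leb]_x ((f \_ (A n)) x) @[n --> \oo] --> \int[leb]_x f x.
  apply: (Rintegral_dominated_cvg _ _ _ (integrable_norm intf)).
  - by move=> n; apply/measurable_EFinP; exact: mfA.
  - exact/measurable_EFinP.
  - by move=> n x; rewrite /= patchE; case: ifPn => // _; rewrite normr0.
  - by move=> x; exact: (fine_cvg (fA_f x)).
have lim0 : F n.+1%:R - F (- n.+1%:R) @[n --> \oo] --> 0 - 0.
  by apply: cvgB; [rewrite (cvg_shiftS (fun n => F n%:R))|rewrite (cvg_shiftS (fun n => F (- n%:R)))].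
rewrite subr0 in lim0.
apply/(cvg_unique _ lim') => //.
apply: cvg_trans lim0; apply: near_eq_cvg; apply: nearW => n.
by rewrite /Rintegral fA.
Qed.

Lemma integrable_cos_gauss e a b : 0 < e ->
  leb.-integrable setT (fun t => (cos (a * t + b) * gauss e t)%:E).
Proof.
move=> e0; apply: (le_integrable _ _ _ (integrable_gauss e0)) => //.
  apply/measurable_EFinP; apply: measurable_funM; last exact: measurable_gauss.
  apply: (measurableT_comp (continuous_measurable_fun (@continuous_cos R))).
  by apply: measurable_funD => //; exact: measurable_funM.
move=> t _ /=; rewrite lee_fin normrM ler_piMl//.
by rewrite ler_norml cos_geN1 cos_le1.
Qed.

(** The phase [b] treats both parts of the Fourier integral at once: [b = 0] gives the cosine and
    [b = - pi / 2] the sine. *)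
Definition cos_gauss_int e b a := \int[leb]_t (cos (a * t + b) * gauss e t).

(** The derivative in [t] of [sin (a * t + b) * gauss e t] has integral zero. *)
Lemma sin_gauss_by_parts e a b : 0 < e ->
  \int[leb]_t (- t * sin (a * t + b) * gauss e t) = - (a / e) * cos_gauss_int e b a.
Proof.
move=> e0.
pose h t := a * cos (a * t + b) * gauss e t - e * (t * sin (a * t + b) * gauss e t).
have dh t : is_derive t (1 : R) (fun t => sin (a * t + b) * gauss e t) (h t).
  rewrite /gauss; apply: is_derive_eq.
  by rewrite /h /gauss /GRing.scale /=; field.
have isg : leb.-integrable setT (EFin \o (fun t => t * sin (a * t + b) * gauss e t)).
  apply: (le_integrable _ _ _ (integrable_id_gauss e0)) => //.
    apply/measurable_EFinP; apply: measurable_funM; last exact: measurable_gauss.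
    apply: measurable_funM => //.
    apply: (measurableT_comp (continuous_measurable_fun (@continuous_sin R))).
    by apply: measurable_funD => //; exact: measurable_funM.
  move=> t _ /=; rewrite lee_fin [leRHS]ger0_norm ?mulr_ge0 ?gauss_ge0//.
  rewrite !normrM (ger0_norm (gauss_ge0 _ _)) ler_wpM2r ?gauss_ge0// ler_piMr//.
  by rewrite ler_norml sin_geN1 sin_le1.
have i1 : leb.-integrable setT (EFin \o (fun t => a * cos (a * t + b) * gauss e t)).
  rewrite /comp; under eq_fun do rewrite -mulrA EFinM.
  by apply: integrableZl => //; exact: integrable_cos_gauss.
have i2 : leb.-integrable setT (EFin \o (fun t => e * (t * sin (a * t + b) * gauss e t))).
  by rewrite /comp; under eq_fun do rewrite EFinM; exact: integrableZl.
have ih : leb.-integrable setT (EFin \o h).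
  by rewrite /comp /h; under eq_fun do rewrite EFinB; exact: integrableB.
have lim0 (u : nat -> R) : (forall n, gauss e (u n) = gauss e n%:R) ->
    sin (a * u n + b) * gauss e (u n) @[n --> \oo] --> 0.
  move=> ug; apply: norm_cvg0; apply: (squeeze_cvgr _ (cvg_cst 0) (cvg_gauss_nat e0)).
  apply: nearW => n; rewrite normr_ge0/= normrM (ger0_norm (gauss_ge0 _ _)) ug.
  by rewrite ler_piMl ?gauss_ge0// ler_norml sin_geN1 sin_le1.
have ch : continuous h.
  move=> t; apply: differentiable_continuous; apply/derivable1_diffP.
  by rewrite /h /gauss.
have := Rintegral_derive_eq0 dh ch ih (lim0 _ (fun=> erefl)) (lim0 _ (fun n => _)).
rewrite /h RintegralB// => /(_ _)/wrap[|/eqP].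
  by move=> n; rewrite /gauss sqrrN.
under eq_Rintegral do rewrite -mulrA; rewrite !RintegralZl//; last exact: integrable_cos_gauss.
rewrite -/(cos_gauss_int e b a) subr_eq0 => /eqP E.
rewrite mulNr (_ : a / e * _ = \int[leb]_t (t * sin (a * t + b) * gauss e t)).
  rewrite -mulN1r -RintegralZl//; apply: eq_Rintegral => t _.
  by rewrite !mulrA mulN1r.
by rewrite mulrAC E mulrAC mulfV ?mul1r// gt_eqF.
Qed.

(** Differentiation under the integral is dominated by [|t| * gauss e t], and integration by parts
    turns the result back into the same integral: a linear differential equation in [a]. *)
Lemma is_derive_cos_gauss_int e b a : 0 < e ->
  is_derive a (1 : R) (cos_gauss_int e b) (- (a / e) * cos_gauss_int e b a).
Proof.
move=> e0.
have d1 x y : is_derive x (1 : R) (fun a => cos (a * y + b) * gauss e y)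
    (- y * sin (x * y + b) * gauss e y).
  by apply: is_derive_eq; rewrite /GRing.scale /=; ring.
have d1E x y : partial1of2 (fun a t => cos (a * t + b) * gauss e t) x y =
    - y * sin (x * y + b) * gauss e y.
  by rewrite partial1of2E derive_val.
have := @cvg_differentiation_under_integral R _ _ leb (fun a t => cos (a * t + b) * gauss e t)
   setT measurableT a (a - 1) (a + 1) _ _ _ (fun t => `|t| * gauss e t) _ (integrable_id_gauss e0) _.
rewrite (_ : \int[leb]_y partial1of2 _ a y = - (a / e) * cos_gauss_int e b a); last first.
  by rewrite -sin_gauss_by_parts//; apply: eq_Rintegral => y _; exact: d1E.
move=> H.
have {}H : h^-1 *: (cos_gauss_int e b (h + a) - cos_gauss_int e b a) @[h --> 0^'] -->
    - (a / e) * cos_gauss_int e b a.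
  apply: H.
  - by rewrite /= in_itv/= ltrBlDr ltrDl ltr01.
  - by move=> x _; exact: integrable_cos_gauss.
  - by move=> x y _ _; exact: ex_derive.
  - by move=> y; rewrite mulr_ge0 ?gauss_ge0.
  - move=> x y _ _; rewrite d1E !normrM (ger0_norm (gauss_ge0 _ _)) normrN.
    by rewrite ler_wpM2r ?gauss_ge0// ler_piMr// ler_norml sin_geN1 sin_le1.
have dE : (fun h : R => h^-1 *: (cos_gauss_int e b (h *: (1 : R) + a) - cos_gauss_int e b a)) =
    (fun h => h^-1 *: (cos_gauss_int e b (h + a) - cos_gauss_int e b a)).
  by apply/funext => h; rewrite scaler1.
apply: DeriveDef.
  by apply/cvg_ex; exists (- (a / e) * cos_gauss_int e b a); rewrite dE.
by rewrite /derive dE; exact/cvg_lim.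
Qed.

Lemma cos_gauss_intE e b a : 0 < e ->
  cos_gauss_int e b a = cos b * Num.sqrt (2 * pi / e) * gauss e^-1 a.
Proof.
move=> e0.
(* The integrating factor of that equation; the product is constant, and at [a = 0] it is a Gaussian
   integral. *)
pose H a := cos_gauss_int e b a * expR (e^-1 / 2 * a ^+ 2).
have dH x : is_derive x (1 : R) H 0.
  have := is_derive_cos_gauss_int b x e0 => D.
  apply: is_derive_eq.
  rewrite /GRing.scale /=; field.
  by rewrite gt_eqF.
have := is_derive_0_is_cst a 0 dH.
rewrite /H expr0n mulr0 expR0 mulr1.
rewrite {2}/cos_gauss_int; under [in RHS]eq_Rintegral do rewrite mul0r add0r.
rewrite RintegralZl//; last exact: integrable_gauss.
rewrite Rintegral_gauss// => <-.
by rewrite /gauss expRN mulfK// gt_eqF// expR_gt0.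
Qed.

Lemma cintble_expi_gauss e a : 0 < e ->
  cintble leb (fun t => expi (a * t) * real_complex R (gauss e t)).
Proof.
move=> e0; apply: (le_cintble _ _ (integrable_gauss e0)).
  apply: cmfunM; last by apply: cmfun_real; exact: measurable_gauss.
  by apply: cmfun_expi; exact: measurable_funM.
by move=> t; rewrite Normc.normcM normc_expi mul1r normc_real ger0_norm ?gauss_ge0.
Qed.

Lemma cint_expi_gauss e a : 0 < e ->
  cint leb (fun t => expi (a * t) * real_complex R (gauss e t)) =
  real_complex R (Num.sqrt (2 * pi / e) * gauss e^-1 a).
Proof.
move=> e0; rewrite /cint /=; apply/eqP; rewrite eq_complex /=.
apply/andP; split; apply/eqP.
  have := cos_gauss_intE 0 a e0; rewrite cos0 mul1r => <-; rewrite /cos_gauss_int.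
  by apply: eq_Rintegral => t _; rewrite mulr0 subr0 addr0.
transitivity (cos_gauss_int e (- (pi / 2)) a).
  apply: eq_Rintegral => t _; rewrite mulr0 add0r; congr (_ * _).
  by rewrite cosD cosN sinN cos_pihalf sin_pihalf; ring.
by rewrite cos_gauss_intE// cosN cos_pihalf !mul0r.
Qed.

End gaussian_1d.

(** * Modulated Gaussians are Schwartz functions *)

Section gaussian_schwartz.
Variables (R : realType) (n : nat).
Local Notation V := 'rV[R]_n.
Implicit Types (a c x y v : V) (b e t : R).

Lemma is_derive_coord (i : 'I_n) x v : is_derive x v (fun y : V => y 0 i) (v 0 i).
Proof.
have E : (fun h : R => h^-1 *: ((h *: v + x) 0 i - x 0 i)) @ 0^' --> v 0 i.
  apply: cvg_near_cst; near=> h.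
  rewrite !mxE addrK scalerA mulVf ?scale1r//; near: h; exact: nbhs_dnbhs_neq.
by apply: DeriveDef; [apply/cvg_ex; exists (v 0 i)|apply/cvg_lim].
Unshelve. all: by end_near. Qed.

Lemma is_derive_chain (p : V -> R) (g : R -> R) x v (dp dg : R) :
  differentiable p x -> is_derive x v p dp -> is_derive (p x) (1 : R) g dg ->
  is_derive x v (g \o p) (dg * dp).
Proof.
move=> diffp Dp Dg.
have diffg : differentiable g (p x) by apply/derivable1_diffP; exact: ex_derive.
have diffgp : differentiable (g \o p) x by exact: differentiable_comp.
apply: DeriveDef; first exact: diff_derivable.
rewrite deriveE// diff_comp//= -(deriveE _ diffp) (@derive_val _ _ _ _ _ _ _ Dp).
rewrite diff1E// /GRing.scale/= derive1E (@derive_val _ _ _ _ _ _ _ Dg) mulrC//.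
Qed.

Lemma dotp_delta a i : dotp a (delta_mx 0 i) = a 0 i.
Proof.
rewrite /dotp (bigD1 i)//= big1 ?addr0 ?mxE ?eqxx ?mulr1// => j /negPf ji.
by rewrite mxE ji andbF mulr0.
Qed.

Lemma differentiable_dotp a x : differentiable (fun y => dotp a y) x.
Proof.
rewrite /dotp (_ : (fun y => _) = \sum_(i < n) (fun y : V => a 0 i * y 0 i)); last first.
  by apply/funext => y; rewrite fct_sumE.
apply: differentiable_sum => i; apply: differentiableM => //.
exact: differentiable_coord.
Qed.

Lemma is_derive_dotp a x v : is_derive x v (fun y => dotp a y) (dotp a v).
Proof.
rewrite /dotp (_ : (fun y => _) = \sum_(i < n) (fun y : V => a 0 i * y 0 i)); last first.
  by apply/funext => y; rewrite fct_sumE.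
apply: is_derive_sum => i; have := is_derive_coord i x v => D.
exact: (is_deriveZ (a 0 i)).
Qed.

Lemma differentiable_sqnorm c x : differentiable (fun y => sqnorm (y - c)) x.
Proof.
rewrite /sqnorm /dotp (_ : (fun y => _) =
    \sum_(i < n) (fun y : V => (y 0 i - c 0 i) * (y 0 i - c 0 i))); last first.
  by apply/funext => y; rewrite fct_sumE; apply: eq_bigr => i _; rewrite !mxE.
apply: differentiable_sum => i.
have D : differentiable (fun y : V => y 0 i - c 0 i) x.
  by apply: differentiableB => //; exact: differentiable_coord.
exact: differentiableM.
Qed.

Lemma is_derive_sqnorm c x v :
  is_derive x v (fun y => sqnorm (y - c)) (2 * dotp (x - c) v).
Proof.
rewrite /sqnorm /dotp (_ : (fun y => _) =
    \sum_(i < n) (fun y : V => (y 0 i - c 0 i) * (y 0 i - c 0 i))); last first.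
  by apply/funext => y; rewrite fct_sumE; apply: eq_bigr => i _; rewrite !mxE.
rewrite mulr_sumr; apply: is_derive_sum => i; have := is_derive_coord i x v => D.
by apply: is_derive_eq; rewrite /GRing.scale /= !mxE; ring.
Qed.

(** Differentiating the cosine only shifts [b] by [pi / 2], so one family contains the sines and
    cosines of all derivatives. *)
Definition cos_gaussd e a c b x : R :=
  cos (dotp a x + b) * expR (- (e / 2 * sqnorm (x - c))).

Lemma differentiable_cos_gaussd e a c b x : differentiable (cos_gaussd e a c b) x.
Proof.
apply: (@differentiableM _ _ (fun y => cos (dotp a y + b))
  (fun y => expR (- (e / 2 * sqnorm (y - c))))).
  apply: (@differentiable_comp _ _ _ _ (fun y => dotp a y + b) cos).
    by apply: differentiableD => //; exact: differentiable_dotp.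
  exact/derivable1_diffP.
apply: (@differentiable_comp _ _ _ _ (fun y => - (e / 2 * sqnorm (y - c))) expR).
  by apply: differentiableN; apply: differentiableM => //; exact: differentiable_sqnorm.
exact/derivable1_diffP.
Qed.

Lemma is_derive_cos_gaussd e a c b x i :
  is_derive x (delta_mx 0 i) (cos_gaussd e a c b)
    (a 0 i * cos_gaussd e a c (b + pi / 2) x +
     (- e * (x 0 i * cos_gaussd e a c b x) + e * c 0 i * cos_gaussd e a c b x)).
Proof.
pose p y := dotp a y + b; pose q y := - (e / 2 * sqnorm (y - c)).
have diffp : differentiable p x.
  by apply: differentiableD => //; exact: differentiable_dotp.
have diffq : differentiable q x.
  by apply: differentiableN; apply: differentiableM => //; exact: differentiable_sqnorm.
have E : cos_gaussd e a c b = (cos \o p) * (expR \o q) by apply/funext.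
have Dp : is_derive x (delta_mx 0 i) p (a 0 i).
  have := is_derive_dotp a x (delta_mx 0 i); rewrite dotp_delta => D.
  by apply: is_derive_eq; rewrite addr0.
have Dq : is_derive x (delta_mx 0 i) q (- e * (x 0 i - c 0 i)).
  have := is_derive_sqnorm c x (delta_mx 0 i); rewrite dotp_delta => D.
  by apply: is_derive_eq; rewrite /GRing.scale /= !mxE; field.
have D1 := is_derive_chain diffp Dp (is_derive_cos _).
have D2 := is_derive_chain diffq Dq (is_derive_expR _).
have -> : cos_gaussd e a c (b + pi / 2) x = - sin (p x) * expR (q x).
  by rewrite /cos_gaussd addrA cosDpihalf.
have -> : cos_gaussd e a c b x = cos (p x) * expR (q x) by [].
by rewrite E; apply: is_derive_eq; rewrite /GRing.scale /=; ring.
Qed.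

Lemma expR_dominates_poly (k : nat) e : 0 < e -> exists2 K : R, 0 < K &
  forall y : R, 0 <= y -> (1 + y) ^+ k <= K * expR (e * y).
Proof.
(* The exponential is split into [k.+1] equal factors, each bounding [1 + y] up to [K0]; [k.+1]
   rather than [k] keeps the division meaningful at [k = 0]. *)
move=> e0; pose K0 := 1 + k.+1%:R / e.
have K0_gt0 : 0 < K0 by rewrite ltr_pwDl// divr_ge0 ?ltW.
exists (K0 ^+ k); first exact: exprn_gt0.
move=> y y0.
have le1 : 1 + y <= K0 * expR (e * y / k.+1%:R).
  apply: (@le_trans _ _ (K0 * (1 + e * y / k.+1%:R))); last first.
    by rewrite ler_pM2l// expR_ge1Dx.
  rewrite /K0 mulrDl mul1r mulrDr mulr1.
  have -> : k.+1%:R / e * (e * y / k.+1%:R) = y.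
    have : (k.+1%:R : R) != 0 by rewrite pnatr_eq0.
    by move: (k.+1%:R : R) => r r0; field; rewrite r0 gt_eqF.
  rewrite addrA -addrA lerD// ?lerDl ?divr_ge0 ?mulr_ge0 ?(ltW e0)//.
  by rewrite lerDr divr_ge0// ltW.
apply: (@le_trans _ _ ((K0 * expR (e * y / k.+1%:R)) ^+ k)).
  by rewrite lerXn2r ?nnegrE ?addr_ge0 ?mulr_ge0 ?expR_ge0// ltW.
rewrite exprMn ler_pM2l ?exprn_gt0// -expRM_natl ler_expR.
rewrite mulrC mulrAC -mulrA ler_piMr ?mulr_ge0 ?(ltW e0)//.
by rewrite ler_pdivrMr// mul1r ler_nat.
Qed.

Lemma sqnorm_ge0 x : 0 <= sqnorm x.
Proof. by apply: sumr_ge0 => i _; rewrite -expr2 sqr_ge0. Qed.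

Lemma sqr_coord_le_sqnorm x i : x 0 i ^+ 2 <= sqnorm x.
Proof.
rewrite /sqnorm /dotp (bigD1 i)//= -expr2 lerDl.
by apply: sumr_ge0 => j _; rewrite -expr2 sqr_ge0.
Qed.

Lemma sqnorm_le_shift x c : sqnorm x <= 2 * sqnorm (x - c) + 2 * sqnorm c.
Proof.
rewrite /sqnorm /dotp !mulr_sumr -big_split /=; apply: ler_sum => i _.
rewrite !mxE; have := sqr_ge0 (x 0 i - 2 * c 0 i); nra.
Qed.

Lemma cos_gaussd_decay e a c b (k : nat) : 0 < e -> exists M : R,
  forall x, (1 + sqnorm x) ^+ k * `|cos_gaussd e a c b x| <= M.
Proof.
(* The rate is [e / 4] and not [e / 2] because recentring from [c] to 0 by [sqnorm_le_shift] doubles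
   the squared norm. *)
move=> e0; have [K K0 HK] := expR_dominates_poly k (divr_gt0 e0 (ltr0n _ 4)).
exists (K * expR (e / 2 * sqnorm c)) => x.
have H1 : `|cos_gaussd e a c b x| <= expR (- (e / 2 * sqnorm (x - c))).
  rewrite normrM (ger0_norm (expR_ge0 _)) ler_piMl ?expR_ge0//.
  by rewrite ler_norml cos_geN1 cos_le1.
apply: (le_trans (ler_pM _ _ (HK _ (sqnorm_ge0 x)) H1)) => //.
  by rewrite exprn_ge0// addr_ge0// sqnorm_ge0.
rewrite -[leLHS]mulrA -expRD ler_pM2l// ler_expR.
have := sqnorm_le_shift x c; nra.
Qed.

(* Closed under partial derivatives, which makes its members Schwartz. *)
Inductive gauss_class e a c : (V -> R) -> Prop :=
| gc_base b : gauss_class e a c (cos_gaussd e a c b)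
| gc_coord i h : gauss_class e a c h -> gauss_class e a c (fun x => x 0 i * h x)
| gc_scale (k : R) h : gauss_class e a c h -> gauss_class e a c (fun x => k * h x)
| gc_add h g : gauss_class e a c h -> gauss_class e a c g ->
    gauss_class e a c (fun x => h x + g x).

Lemma gauss_class_differentiable e a c h x :
  gauss_class e a c h -> differentiable h x.
Proof.
elim=> {h} [b|i h _ IH|k h _ IH|h g _ IHh _ IHg].
- exact: differentiable_cos_gaussd.
- by apply: differentiableM => //; exact: differentiable_coord.
- exact: differentiableM.
- exact: differentiableD.
Qed.

Lemma gauss_class_derive e a c h i : gauss_class e a c h ->
  exists2 h', gauss_class e a c h' &
    forall x, is_derive x (delta_mx 0 i) h (h' x).
Proof.
elim=> {h} [b|j h ch [h' ch' Dh]|k h ch [h' ch' Dh]|h g ch [h' ch' Dh] cg [g' cg' Dg]].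
- exists (fun x => a 0 i * cos_gaussd e a c (b + pi / 2) x +
     (- e * (x 0 i * cos_gaussd e a c b x) + e * c 0 i * cos_gaussd e a c b x)).
    apply: gc_add; first by apply: gc_scale; exact: gc_base.
    apply: gc_add; apply: gc_scale; last exact: gc_base.
    by apply: gc_coord; exact: gc_base.
  by move=> x; exact: is_derive_cos_gaussd.
- exists (fun x => (j == i)%:R * h x + x 0 j * h' x).
    by apply: gc_add; [exact: gc_scale|exact: gc_coord].
  move=> x; have D := Dh x; have D' := is_derive_coord j x (delta_mx 0 i).
  by apply: is_derive_eq; rewrite mxE eqxx/= /GRing.scale/=; ring.
- exists (fun x => k * h' x); first exact: gc_scale.
  by move=> x; have D := Dh x; exact: (is_deriveZ k).
- exists (fun x => h' x + g' x); first exact: gc_add.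
  by move=> x; have D := Dh x; have D' := Dg x; exact: is_deriveD.
Qed.

Lemma gauss_class_decay e a c h (k : nat) : 0 < e -> gauss_class e a c h ->
  exists M : R, forall x, (1 + sqnorm x) ^+ k * `|h x| <= M.
Proof.
move=> e0 ch; elim: ch k => {h}
    [b|i h _ IH|r h _ IH|h g _ IHh _ IHg] k.
- exact: cos_gaussd_decay.
(* A coordinate factor costs one power of the weight, since [|x_i| <= 1 + x_i^2]. *)
- have [M HM] := IH k.+1; exists M => x; apply: le_trans (HM x).
  rewrite normrM mulrA exprSr ler_wpM2r// ler_wpM2l ?exprn_ge0 ?addr_ge0 ?sqnorm_ge0//.
  apply: (@le_trans _ _ (1 + x 0 i ^+ 2)); last by rewrite lerD2l sqr_coord_le_sqnorm.
  rewrite -(real_normK (num_real (x 0 i))).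
  have := sqr_ge0 (`|x 0 i| - 1); have := normr_ge0 (x 0 i); nra.
- have [M HM] := IH k; exists (`|r| * M) => x.
  by rewrite normrM mulrCA ler_wpM2l.
- have [M HM] := IHh k; have [N HN] := IHg k; exists (M + N) => x.
  apply: le_trans (lerD (HM x) (HN x)); rewrite -mulrDr ler_wpM2l ?ler_normD//.
  by rewrite exprn_ge0// addr_ge0// sqnorm_ge0.
Qed.

Lemma gauss_class_iter_partial e a c h (s : seq 'I_n) : gauss_class e a c h ->
  gauss_class e a c (iter_partial s h).
Proof.
move=> ch; elim: s => //= i s IH.
have [h' ch' Dh] := gauss_class_derive i IH.
rewrite (_ : (fun x => _) = h')//; apply/funext => x.
exact: derive_val.
Qed.

Lemma gauss_class_real_schwartz e a c h : 0 < e -> gauss_class e a c h ->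
  real_schwartz h.
Proof.
move=> e0 ch s; have cs := gauss_class_iter_partial s ch; split; last first.
  by move=> k; exact: gauss_class_decay cs.
by move=> x; exact: gauss_class_differentiable cs.
Qed.

End gaussian_schwartz.

Section measurable_rV.
Variables (R : realType) (n : nat).
Local Notation V := 'rV[R]_n.

Lemma measurable_coord (i : 'I_n) : measurable_fun setT (fun x : V => x 0 i).
Proof. exact: measurable_rV_coord. Qed.

Lemma measurable_dotp (a : V) : measurable_fun setT (fun x : V => dotp a x).
Proof.
apply: (@measurable_sum _ V _ _ _ _ (fun i (x : V) => a 0 i * x 0 i)) => i.
by apply: measurable_funM => //; exact: measurable_coord.
Qed.

Lemma measurable_dotp2 : measurable_fun setT (fun p : V * V => dotp p.1 p.2).
Proof.
apply: (@measurable_sum _ (V * V)%type _ _ _ _ (fun i (p : V * V) => p.1 0 i * p.2 0 i)) => i.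
apply: measurable_funM.
  exact: (measurableT_comp (measurable_coord i) measurable_fst).
exact: (measurableT_comp (measurable_coord i) measurable_snd).
Qed.

Lemma measurable_sqnormB (c : V) : measurable_fun setT (fun x : V => sqnorm (x - c)).
Proof.
apply: (@measurable_sum _ V _ _ _ _ (fun i (x : V) => (x - c) 0 i * (x - c) 0 i)) => i.
have m : measurable_fun setT (fun x : V => (x - c) 0 i).
  rewrite (_ : (fun x => _) = (fun x : V => x 0 i - c 0 i)); last first.
    by apply/funext => x; rewrite !mxE.
  by apply: measurable_funB => //; exact: measurable_coord.
exact: measurable_funM.
Qed.

Lemma measurable_sqnorm : measurable_fun setT (fun x : V => sqnorm x).
Proof. by have := measurable_sqnormB 0; under eq_fun do rewrite subr0. Qed.

Lemma measurable_sqnormB2 :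
  measurable_fun setT (fun p : V * V => sqnorm (p.1 - p.2)).
Proof.
apply: (@measurable_sum _ (V * V)%type _ _ _ _
  (fun i (p : V * V) => (p.1 - p.2) 0 i * (p.1 - p.2) 0 i)) => i.
have m : measurable_fun setT (fun p : V * V => (p.1 - p.2) 0 i).
  rewrite (_ : (fun x => _) = (fun p : V * V => p.1 0 i - p.2 0 i)); last first.
    by apply/funext => x; rewrite !mxE.
  apply: measurable_funB.
    exact: (measurableT_comp (measurable_coord i) measurable_fst).
  exact: (measurableT_comp (measurable_coord i) measurable_snd).
exact: measurable_funM.
Qed.

Lemma dotpC (x y : V) : dotp x y = dotp y x.
Proof. by apply: eq_bigr => i _; rewrite mulrC. Qed.

Lemma dotpDl (x y z : V) : dotp (x + y) z = dotp x z + dotp y z.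
Proof. by rewrite -big_split; apply: eq_bigr => i _; rewrite mxE mulrDl. Qed.

Lemma dotpNl (x z : V) : dotp (- x) z = - dotp x z.
Proof. by rewrite /dotp -sumrN; apply: eq_bigr => i _; rewrite mxE mulNr. Qed.

Lemma dotpBl (x y z : V) : dotp (x - y) z = dotp x z - dotp y z.
Proof. by rewrite dotpDl dotpNl. Qed.

Lemma sqnormN (x : V) : sqnorm (- x) = sqnorm x.
Proof. by rewrite /sqnorm dotpNl dotpC dotpNl opprK. Qed.

Lemma expi_dotp (x y : V) : expi (dotp x y) = \prod_(i < n) expi (x 0 i * y 0 i).
Proof. exact: expi_sum. Qed.

End measurable_rV.

(** * Gaussians in several variables and the heat kernel *)

Section gaussian_rV.
Variables (R : realType) (n : nat).
Local Notation V := 'rV[R]_n.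
Local Notation mu := (lebesgue_rV R n).
Local Notation nc := (@Normc.normc R).
Implicit Types (e : R) (x a c : V).

Definition gaussd e x : R := expR (- (e / 2 * sqnorm x)).

Lemma gaussd_ge0 e x : 0 <= gaussd e x. Proof. exact: expR_ge0. Qed.

Lemma gaussd_le1 e x : 0 <= e -> gaussd e x <= 1.
Proof.
by move=> e0; rewrite -expR0 ler_expR oppr_le0 mulr_ge0 ?divr_ge0 ?sqnorm_ge0.
Qed.

Lemma gaussd_prod e x : gaussd e x = \prod_(i < n) gauss e (x 0 i).
Proof.
by rewrite -expR_sum /gaussd mulr_sumr -sumrN; under eq_bigr do rewrite -expr2.
Qed.

Lemma gaussdN e x : gaussd e (- x) = gaussd e x.
Proof. by rewrite /gaussd sqnormN. Qed.

Lemma gaussdBC e x c : gaussd e (x - c) = gaussd e (c - x).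
Proof. by rewrite -gaussdN opprB. Qed.

Lemma measurable_gaussdB e c : measurable_fun setT (fun x => gaussd e (x - c)).
Proof.
apply: (measurableT_comp (@measurable_expR R)).
apply: (measurableT_comp (@oppr_measurable R setT)).
by apply: measurable_funM => //; exact: measurable_sqnormB.
Qed.

Lemma measurable_gaussd e : measurable_fun setT (gaussd e).
Proof. by have := measurable_gaussdB e 0; under eq_fun do rewrite subr0. Qed.

Lemma measurable_gaussdB2 e :
  measurable_fun setT (fun p : V * V => gaussd e (p.1 - p.2)).
Proof.
apply: (measurableT_comp (@measurable_expR R)).
apply: (measurableT_comp (@oppr_measurable R setT)).
by apply: measurable_funM => //; exact: measurable_sqnormB2.
Qed.

Lemma cint_expi_gaussd e a : 0 < e ->
  cintble mu (fun x => expi (dotp a x) * real_complex R (gaussd e x)) /\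
  cint mu (fun x => expi (dotp a x) * real_complex R (gaussd e x)) =
  real_complex R (Num.sqrt (2 * pi / e) ^+ n * gaussd e^-1 a).
Proof.
move=> e0.
pose h (i : 'I_n) t := expi (a 0 i * t) * real_complex R (gauss e t).
have ih i : cintble (@lebesgue_measure R) (h i) by exact: cintble_expi_gauss.
have [h1 h2] := cint_tensor ih.
have E : (fun x => expi (dotp a x) * real_complex R (gaussd e x)) =
    (fun x => \prod_(i < n) h i (x 0 i)).
  by apply/funext => x; rewrite expi_dotp gaussd_prod rmorph_prod -big_split.
rewrite E; split=> //; rewrite h2 (eq_bigr (fun i => real_complex R
  (Num.sqrt (2 * pi / e) * gauss e^-1 (a 0 i)))) => [|i _]; last exact: cint_expi_gauss.
by rewrite -rmorph_prod big_split prodr_const card_ord gaussd_prod.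
Qed.

Lemma Rintegral_gaussdB e c : 0 < e ->
  mu.-integrable setT (fun x => (gaussd e (x - c))%:E) /\
  \int[mu]_x gaussd e (x - c) = Num.sqrt (2 * pi / e) ^+ n.
Proof.
move=> e0.
pose h (i : 'I_n) t := real_complex R (gauss e (t - c 0 i)).
have ih i : cintble (@lebesgue_measure R) (h i).
  have m : measurable_fun setT (fun t : measurableTypeR R => gauss e ((t : R) - c 0 i)).
    apply: (measurableT_comp (@measurable_gauss R e)).
    exact: measurable_funB.
  apply: (le_cintble _ _ (integrable_gauss_center (c 0 i) e0)).
    exact: cmfun_real.
  by move=> t; rewrite normc_real ger0_norm// gauss_ge0.
have [h1 h2] := cint_tensor ih.
have E : (fun x => real_complex R (gaussd e (x - c))) =
    (fun x => \prod_(i < n) h i (x 0 i)).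
  apply/funext => x; rewrite gaussd_prod rmorph_prod.
  by apply: eq_bigr => i _; rewrite !mxE.
rewrite -E in h1 h2; split; first exact: h1.1.
have := h2; rewrite cint_real (eq_bigr (fun i => real_complex R
  (Num.sqrt (2 * pi / e)))) => [|i _]; last first.
  by rewrite cint_real Rintegral_gauss_center.
by rewrite prodr_const card_ord -rmorphXn => -[].
Qed.

(* Gaussian density of covariance e. *)
Definition heat e x : R :=
  (Num.sqrt (2 * pi) ^+ n)^-1 * (Num.sqrt e ^+ n)^-1 * gaussd e^-1 x.

Lemma fourier_cst : (2 * pi : R) `^ (- (n%:R / 2)) = (Num.sqrt (2 * pi) ^+ n)^-1.
Proof.
rewrite powRN; congr _^-1; rewrite [n%:R / 2]mulrC powRrM powR12_sqrt ?mulr_ge0 ?pi_ge0//.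
by rewrite powR_mulrn// sqrtr_ge0.
Qed.

Lemma sqrt2pi_gt0 : 0 < Num.sqrt (2 * pi : R).
Proof. by rewrite sqrtr_gt0 mulr_gt0 ?pi_gt0. Qed.

Lemma sqrt2pi_div e : 0 < e ->
  Num.sqrt (2 * pi / e) = Num.sqrt (2 * pi) / Num.sqrt e.
Proof.
by move=> e0; rewrite (@sqrtrM _ (2 * pi)) ?mulr_ge0 ?pi_ge0// sqrtrV// ltW.
Qed.

Lemma heat_ge0 e x : 0 <= heat e x.
Proof. by rewrite !mulr_ge0 ?invr_ge0 ?exprn_ge0 ?gaussd_ge0. Qed.

(** The shape in which the kernel leaves [cint_expi_gaussd]: two Fourier normalisations times the
    integral of an exponential against a Gaussian. *)
Lemma heatE e x : 0 < e -> heat e x =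
  (Num.sqrt (2 * pi) ^+ n)^-1 ^+ 2 * (Num.sqrt (2 * pi / e) ^+ n * gaussd e^-1 x).
Proof.
move=> e0; rewrite /heat sqrt2pi_div// exprMn [(Num.sqrt e)^-1 ^+ n]exprVn.
have := sqrt2pi_gt0; move/(exprn_gt0 n) => q0.
have s0 : 0 < Num.sqrt e ^+ n by rewrite exprn_gt0// sqrtr_gt0.
by field; rewrite !gt_eqF.
Qed.

Lemma Rintegral_heatB e c : 0 < e ->
  mu.-integrable setT (fun x => (heat e (x - c))%:E) /\
  \int[mu]_x heat e (x - c) = 1.
Proof.
move=> e0; have ei0 : 0 < e^-1 by rewrite invr_gt0.
have [h1 h2] := Rintegral_gaussdB c ei0; split.
  by rewrite /heat; under eq_fun do rewrite EFinM; exact: integrableZl.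
rewrite /heat RintegralZl// h2 sqrt2pi_div// sqrtrV ?(ltW e0)// invrK exprMn.
have := sqrt2pi_gt0; move/(exprn_gt0 n) => q0.
have s0 : 0 < Num.sqrt e ^+ n by rewrite exprn_gt0// sqrtr_gt0.
by field; rewrite !gt_eqF.
Qed.

End gaussian_rV.

(** * Fourier inversion and Plancherel *)

Section inversion.
Variables (R : realType) (n : nat).
Local Notation V := 'rV[R]_n.
Local Notation mu := (lebesgue_rV R n).
Local Notation nc := (@Normc.normc R).
Local Notation rc := (real_complex R).
Implicit Types (e : R) (x a c : V).

Definition inverse_fourier (g : V -> R[i]) (x : V) : R[i] :=
  rc (Num.sqrt (2 * pi) ^+ n)^-1 * cint mu (fun xi => expi (dotp x xi) * g xi).

Lemma cintble_expi (h : V -> R[i]) x : cintble mu h ->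
  cintble mu (fun xi => expi (dotp x xi) * h xi).
Proof.
move=> ih; under eq_fun do rewrite mulrC.
apply: (cintbleM_bounded (M := 1)) => //.
  by apply: cmfun_expi; exact: measurable_dotp.
by move=> xi; rewrite normc_expi.
Qed.

Definition mod_gauss e a x : R[i] := expi (dotp a x) * rc (gaussd e x).

Lemma mod_gauss_schwartz e a : 0 < e -> schwartz (mod_gauss e a).
Proof.
move=> e0; split.
  apply: (@gauss_class_real_schwartz R n e a 0) => //.
  rewrite (_ : (fun x => _) = cos_gaussd e a 0 0); first exact: gc_base.
  by apply/funext => x; rewrite /= /cos_gaussd addr0 subr0 mulr0 subr0.
apply: (@gauss_class_real_schwartz R n e a 0) => //.
rewrite (_ : (fun x => _) = cos_gaussd e a 0 (- (pi / 2))); first exact: gc_base.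
apply/funext => x; rewrite /= /cos_gaussd subr0 mulr0 add0r; congr (_ * _).
by rewrite cosD cosN sinN cos_pihalf sin_pihalf; ring.
Qed.

Lemma fourier_mod_gauss e a : 0 < e ->
  fourier (mod_gauss e a) = (fun x => rc (Num.sqrt (2 * pi) ^+ n * heat e (x - a))).
Proof.
move=> e0; apply/funext => x; rewrite /fourier fourier_cst.
have -> : cintegral (fun y => expi (- dotp y x) * mod_gauss e a y) =
   cint mu (fun y => expi (dotp (a - x) y) * rc (gaussd e y)).
  apply: eq_cint => y; rewrite /mod_gauss mulrA -expiD; congr (expi _ * _).
  by rewrite dotpBl addrC (dotpC x).
rewrite (cint_expi_gaussd _ e0).2 -rmorphM heatE// gaussdBC.
have := sqrt2pi_gt0 R; move/(exprn_gt0 n) => q0.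
by congr (rc _); field; rewrite gt_eqF.
Qed.

Lemma fourier_mod_gauss_schwartz e a : 0 < e -> schwartz (fourier (mod_gauss e a)).
Proof.
move=> e0; rewrite fourier_mod_gauss//; have ei : 0 < e^-1 by rewrite invr_gt0.
split.
  apply: (@gauss_class_real_schwartz R n e^-1 0 a) => //.
  rewrite (_ : (fun x => _) = (fun x => Num.sqrt (2 * pi) ^+ n *
     ((Num.sqrt (2 * pi) ^+ n)^-1 * (Num.sqrt e ^+ n)^-1) * cos_gaussd e^-1 0 a 0 x)).
    by apply: gc_scale; exact: gc_base.
  apply/funext => x; rewrite /= /heat /cos_gaussd addr0.
  rewrite (_ : dotp 0 x = 0) ?cos0 ?mul1r ?mulrA//.
  by rewrite /dotp big1// => i _; rewrite mxE mul0r.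
apply: (@gauss_class_real_schwartz R n e^-1 0 a) => //.
rewrite (_ : (fun x => _) = (fun x => 0 * cos_gaussd e^-1 0 a 0 x)).
  by apply: gc_scale; exact: gc_base.
by apply/funext => x; rewrite /= mul0r.
Qed.

(* Testing against the modulated Gaussian, whose transform is a heat kernel. *)
Lemma heat_regularization (u : functional R n) (fhat f : V -> R[i]) e a :
  represented_by (fourier_distribution u) fhat -> represented_by u f -> 0 < e ->
  cintble mu (fun x => f x * rc (heat e (x - a))) /\
  cint mu (fun x => f x * rc (heat e (x - a))) =
  rc (Num.sqrt (2 * pi) ^+ n)^-1 *
    cint mu (fun xi => expi (dotp a xi) * fhat xi * rc (gaussd e xi)).
Proof.
move=> [_ /(_ _ (mod_gauss_schwartz a _))Hfh] [_ /(_ _ (fourier_mod_gauss_schwartz a _))Hf] e0.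
have [_ H1] := Hfh e e0; have [ifg H2] := Hf e e0.
have q0 : Num.sqrt (2 * pi : R) ^+ n != 0 by rewrite gt_eqF// exprn_gt0// sqrt2pi_gt0.
have E : (fun x => f x * rc (heat e (x - a))) =
    (fun x => rc (Num.sqrt (2 * pi) ^+ n)^-1 * (f x * fourier (mod_gauss e a) x)).
  apply/funext => x; rewrite fourier_mod_gauss// mulrCA -rmorphM.
  by rewrite mulrA mulVf// mul1r.
have ifg' : cintble mu (fun x => f x * fourier (mod_gauss e a) x) := ifg.
rewrite E; split; first exact: cintbleZ.
rewrite cintZ//; congr (_ * _); transitivity (u (fourier (mod_gauss e a))) => //.
transitivity (cintegral (fun x => fhat x * mod_gauss e a x)) => //.
apply: (@eq_cint _ _ _ mu) => x.
by rewrite /mod_gauss; ring.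
Qed.

(** Neighbourhoods of row vectors are balls for the largest coordinate, whereas the kernels decay in
    [sqnorm]. *)
Lemma ccontinuous_near_sqnorm (f : V -> R[i]) a (d : R) : ccontinuous f -> 0 < d ->
  exists2 r : R, 0 < r & forall x, sqnorm (x - a) < r -> nc (f x - f a) <= d.
Proof.
move=> [c1 c2] d0; have d20 : 0 < d / 2 by rewrite divr_gt0.
have := c1 a; move/cvgrPdist_le => /(_ _ d20) N1.
have := c2 a; move/cvgrPdist_le => /(_ _ d20) N2.
have [r /= r0 Hr] := (nbhs_ballP a _).1 (filterI N1 N2).
exists (r ^+ 2); first exact: exprn_gt0.
move=> x xr; have /Hr[/= H1 H2] : ball a r x.
  split=> // i j; rewrite ord1.
  rewrite -ball_normE /ball_ /= -(ltr_pXn2r (n := 2)) ?nnegrE ?(ltW r0)//.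
  apply: le_lt_trans xr; apply: le_trans (sqr_coord_le_sqnorm _ j).
  by rewrite real_normK ?num_real// !mxE -sqrrN opprB.
apply: (le_trans (normc_le_ReIm _)).
rewrite ReD ImD ReN ImN [leRHS](splitr d) lerD//.
  by rewrite distrC.
by rewrite distrC.
Qed.

Lemma cvg_harmonic_scale (K : R) : K / m.+1%:R @[m --> \oo] --> 0.
Proof.
rewrite -[X in _ --> X](mulr0 K); apply: cvgM; first exact: cvg_cst.
exact: cvg_harmonic.
Qed.

(** The tail of a narrow kernel is compared with the fixed kernel [heat 1], against which [f] is
    known to be integrable. Away from the origin the gain [expR (- (r / 2 * m))] beats the growth of
    the normalisation. *)
Lemma heat_tail (r : R) : 0 < r -> exists2 K : R, 0 <= K & forall (m : nat) (x : V),
  r <= sqnorm x -> heat m.+1%:R^-1 x <= K / m.+1%:R * heat 1 x.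
Proof.
move=> r0; have r20 : 0 < r / 2 by rewrite divr_gt0.
(* The normalisation uses at most [n] powers of [m.+1]; the extra one supplies the factor
   [1 / m.+1]. *)
have [K K0 HK] := expR_dominates_poly n.+1 r20.
exists K; first exact: ltW.
move=> m x rx; set M : R := m.+1%:R.
have M0 : 0 < M by rewrite ltr0n.
have M1 : 1 <= M by rewrite ler1n.
have M_n : (Num.sqrt M^-1 ^+ n)^-1 <= M ^+ n.
  have -> : (Num.sqrt M^-1 ^+ n)^-1 = Num.sqrt M ^+ n.
    by rewrite sqrtrV ?(ltW M0)// exprVn invrK.
  rewrite lerXn2r ?nnegrE ?sqrtr_ge0 ?(ltW M0)//.
  rewrite -(ler_pXn2r (n := 2)) ?nnegrE ?sqrtr_ge0 ?(ltW M0)//.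
  by rewrite sqr_sqrtr ?(ltW M0)// expr2 ler_peMl// ltW.
have g_n : gaussd M x <= gaussd 1 x * expR (- (r / 2 * m%:R)).
  rewrite /gaussd -expRD ler_expR -opprD lerN2.
  have -> : M = m%:R + 1 by rewrite /M -natr1.
  have m0 : 0 <= m%:R :> R by [].
  nra.
have M_K : M ^+ n * expR (- (r / 2 * m%:R)) <= K / M.
  rewrite expRN ler_pdivrMr ?expR_gt0// mulrAC ler_pdivlMr// -exprSr.
  by have := HK m%:R (ler0n _ _); rewrite addrC natr1.
rewrite /heat invrK invr1 sqrtr1 expr1n invr1 mulr1 mulrCA -[leLHS]mulrA.
rewrite ler_wpM2l ?invr_ge0 ?exprn_ge0 ?sqrtr_ge0//.
apply: (le_trans (ler_pM _ _ M_n g_n)).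
- by rewrite invr_ge0 exprn_ge0// sqrtr_ge0.
- exact: gaussd_ge0.
- by rewrite mulrCA mulrC ler_wpM2r ?gaussd_ge0.
Qed.

Lemma cvg_gaussd_1 x : gaussd m.+1%:R^-1 x @[m --> \oo] --> (1 : R).
Proof.
suff H : expR (- (m.+1%:R^-1 / 2 * sqnorm x)) @[m --> \oo] --> expR (0 : R).
  by rewrite -[X in _ --> X]expR0.
suff H : - (m.+1%:R^-1 / 2 * sqnorm x) @[m --> \oo] --> (0 : R).
  exact: (cvg_comp _ _ H (@continuous_expR R 0)).
rewrite -[X in _ --> X]oppr0; apply: cvgN.
rewrite (_ : (fun m => _) = (fun m => (sqnorm x / 2) / m.+1%:R)); last first.
  by apply/funext => m; ring.
exact: cvg_harmonic_scale.
Qed.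

(** Let the variance tend to zero in [heat_regularization]. The side of [fhat] converges by
    domination, [fhat] being integrable; on the side of [f] the kernel has mass one and concentrates
    at [a], where [f] is continuous, and [heat_tail] disposes of the rest. *)
Lemma fourier_inversion (u : functional R n) (fhat f : V -> R[i]) a :
  represented_by (fourier_distribution u) fhat -> continuous_representative u f ->
  cintble mu fhat -> f a = inverse_fourier fhat a.
Proof.
move=> Hfh [cf Hf] ifh.
pose q : R := (Num.sqrt (2 * pi) ^+ n)^-1.
pose e (m : nat) : R := m.+1%:R^-1.
have e0 m : 0 < e m by rewrite invr_gt0.
have HR m := heat_regularization a Hfh Hf (e0 m).
have Bcvg : nc (cint mu (fun xi => expi (dotp a xi) * fhat xi * rc (gaussd (e m) xi)) -
   cint mu (fun xi => expi (dotp a xi) * fhat xi)) @[m --> \oo] --> 0.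
  have m1 : cmfun (fun xi => expi (dotp a xi) * fhat xi).
    apply: cmfunM; last exact: cintble_cmfun ifh.
    by apply: cmfun_expi; exact: measurable_dotp.
  apply: (cint_dominated_cvg _ m1 _ _ (cintble_normc ifh)).
  - by move=> m; apply: cmfunM => //; apply: cmfun_real; exact: measurable_gaussd.
  - move=> m x; rewrite !Normc.normcM normc_expi mul1r normc_real.
    by rewrite ger0_norm ?gaussd_ge0// ler_piMr ?normc_ge0// gaussd_le1// ltW.
  - by move=> x; rewrite Normc.normcM normc_expi mul1r.
  - move=> x; rewrite (_ : (fun m => _) = (fun m => nc (fhat x) * `|gaussd (e m) x - 1|)).
      rewrite -[X in _ --> X](mulr0 (nc (fhat x))); apply: cvgM; first exact: cvg_cst.
      rewrite -(normr0 R); apply: cvg_norm.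
      rewrite -(subrr 1); apply: cvgB; [exact: cvg_gaussd_1|exact: cvg_cst].
    apply/funext => m; rewrite -[X in _ - X]mulr1 -mulrBr !Normc.normcM normc_expi mul1r.
    by rewrite -(rmorph1 rc) -rmorphB normc_real.
have ifd m : cintble mu (fun x => (f x - f a) * rc (heat (e m) (x - a))).
  under eq_fun do rewrite mulrBl; apply: cintbleB; first exact: (HR m).1.
  apply: cintbleZ; split; last by rewrite /=; exact: integrable0.
  exact: (Rintegral_heatB a (e0 m)).1.
have E1 m : cint mu (fun x => f x * rc (heat (e m) (x - a))) - f a =
    cint mu (fun x => (f x - f a) * rc (heat (e m) (x - a))).
  have ih : cintble mu (fun x => rc (heat (e m) (x - a))).
    split; last by rewrite /=; exact: integrable0.
    exact: (Rintegral_heatB a (e0 m)).1.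
  transitivity (cint mu (fun x => f x * rc (heat (e m) (x - a)) - f a * rc (heat (e m) (x - a)))).
    rewrite cintB//; [|exact: (HR m).1|exact: cintbleZ].
    by rewrite cintZ// cint_real (Rintegral_heatB a (e0 m)).2 rmorph1 mulr1.
  by apply: eq_cint => x; rewrite mulrBl.
pose D x := nc (f x - f a).
have iD m : mu.-integrable setT (fun x => (D x * heat (e m) (x - a))%:E).
  have := cintble_normc (ifd m); apply: eq_integrable => // x _.
  by rewrite Normc.normcM normc_real ger0_norm// heat_ge0.
suff small (d : R) : 0 < d -> nc (inverse_fourier fhat a - f a) <= d.
  apply/eqP; rewrite eq_sym -subr_eq0; apply/eqP/Normc.eq0_normc/eqP.
  rewrite eq_le normc_ge0 andbT; apply/ler_addgt0Pr => d d0; rewrite add0r.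
  exact: small.
move=> d0; have [r r0 Hr] := ccontinuous_near_sqnorm a cf d0.
have [K K0 HK] := heat_tail r0.
(* Since [e 0 = 1], this is the integral of [D] against the fixed kernel of [heat_tail]. *)
pose M1 := \int[mu]_x (D x * heat (e 0) (x - a)).
have bound m : nc (cint mu (fun x => (f x - f a) * rc (heat (e m) (x - a)))) <=
    d + K * M1 / m.+1%:R.
  apply: (le_trans (normc_cint_le (ifd m))).
  have i1 : mu.-integrable setT (fun x => (d * heat (e m) (x - a))%:E).
    under eq_fun do rewrite EFinM; apply: integrableZl => //.
    exact: (Rintegral_heatB a (e0 m)).1.
  have i2 : mu.-integrable setT (fun x => (K / m.+1%:R * (D x * heat (e 0) (x - a)))%:E).
    by under eq_fun do rewrite EFinM; exact: integrableZl.
  apply: (@le_trans _ _ (\int[mu]_x (d * heat (e m) (x - a) +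
      K / m.+1%:R * (D x * heat (e 0) (x - a))))).
    apply: le_Rintegral => //; first exact: cintble_normc.
      by rewrite /comp; under eq_fun do rewrite EFinD; exact: integrableD.
    move=> x _; rewrite Normc.normcM normc_real ger0_norm ?heat_ge0//.
    have [xr|xr] := ltP (sqnorm (x - a)) r.
      rewrite ler_wpDr ?ler_wpM2r ?heat_ge0 ?Hr//.
      by rewrite mulr_ge0 ?divr_ge0// mulr_ge0 ?normc_ge0 ?heat_ge0.
    apply: ler_wpDl; first by apply: mulr_ge0; [exact: ltW|exact: heat_ge0].
    have -> : e 0 = 1 by rewrite /e invr1.
    by rewrite [leRHS]mulrCA; apply: ler_wpM2l; [exact: normc_ge0|exact: HK].
  rewrite RintegralD// RintegralZl//; last exact: (Rintegral_heatB a (e0 m)).1.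
  rewrite (Rintegral_heatB a (e0 m)).2 mulr1 RintegralZl//; last exact: iD.
  by rewrite -/M1 mulrAC.
have lim : q * nc (cint mu (fun xi => expi (dotp a xi) * fhat xi * rc (gaussd (e m) xi)) -
   cint mu (fun xi => expi (dotp a xi) * fhat xi)) + (d + K * M1 / m.+1%:R) @[m --> \oo] --> q * 0 + (d + 0).
  apply: cvgD; first by apply: cvgM => //; exact: cvg_cst.
  by apply: cvgD; [exact: cvg_cst|exact: cvg_harmonic_scale].
rewrite mulr0 add0r addr0 in lim.
rewrite -(cvg_lim _ lim)//; apply: limr_ge; first by apply/cvg_ex; exists d.
apply: nearW => m; apply: le_trans (lerD (lexx _) (bound m)); rewrite -E1 (HR m).2.
set B := cint _ _; set B' := cint _ _.
have -> : q * nc (B - B') = nc (inverse_fourier fhat a - rc q * B).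
  rewrite /inverse_fourier -/q -/B' -mulrBr Normc.normcM normc_real ger0_norm.
    by rewrite -normcN opprB.
  by rewrite invr_ge0 exprn_ge0// sqrtr_ge0.
by apply: le_trans (le_normcD _ _); rewrite addrA subrK.
Qed.

End inversion.

Section fatou.
Context d (T : measurableType d) (R : realType).
Variable mu : {measure set T -> \bar R}.

Lemma limn_einf_ub (u : (\bar R)^nat) (A : \bar R) :
  (forall n, u n <= A)%E -> (limn_einf u <= A)%E.
Proof.
move=> uA; rewrite limn_einf_lim; apply: lime_le; first exact: is_cvg_einfs.
apply: nearW => m; apply: (@le_trans _ _ (u m)); last exact: uA.
by apply: ereal_inf_lbound; exists m => /=.
Qed.

(** Serves to remove truncations: Gaussian damping in Plancherel, growing boxes in the weighted
    bound, partial sums of the cardinal series. *)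
Lemma fatou_bound (h_ : (T -> R)^nat) (h : T -> R) (A : \bar R) :
  (forall n, measurable_fun setT (h_ n)) -> (forall n x, 0 <= h_ n x) ->
  (forall x, h_ n x @[n --> \oo] --> h x) ->
  (forall n, (\int[mu]_x (h_ n x)%:E <= A)%E) ->
  (\int[mu]_x (h x)%:E <= A)%E.
Proof.
move=> mh h0 hh hA.
have mh' n : measurable_fun setT (EFin \o h_ n) by exact/measurable_EFinP.
have h0' n x : setT x -> (0 <= (EFin \o h_ n) x)%E by rewrite /= lee_fin.
have := fatou mu measurableT mh' h0'.
rewrite (eq_integral (fun x => (h x)%:E)) => [H|x _]; last first.
  have /cvg_limn_einf_sup[->//] : (h_ n x)%:E @[n --> \oo] --> (h x)%:E.
  by apply: cvg_EFin; [exact: nearW|exact: hh].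
by apply: (le_trans H); exact: limn_einf_ub.
Qed.

End fatou.

(** * Plancherel's inequality *)

Section plancherel.
Variables (R : realType) (n : nat).
Local Notation V := 'rV[R]_n.
Local Notation mu := (lebesgue_rV R n).
Local Notation nc := (@Normc.normc R).
Local Notation rc := (real_complex R).
Variable g : V -> R[i].
Hypothesis ig : cintble mu g.
Hypothesis ig2 : mu.-integrable setT (fun x => (nc (g x) ^+ 2)%:E).
Let q : R := (Num.sqrt (2 * pi) ^+ n)^-1.
Let G := inverse_fourier g.

Let mg : cmfun g. Proof. exact: cintble_cmfun ig. Qed.

Let i_exp x := cintble_expi x ig.

Lemma cintble_phase (h : V * V -> R) (a b : V -> R[i]) :
  measurable_fun setT h -> cintble mu a -> cintble mu b ->
  cintble (mu \x mu)%E (fun p : V * V => expi (h p) * (a p.1 * b p.2)).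
Proof.
move=> mh ia ib; under eq_fun do rewrite mulrC.
apply: (cintbleM_bounded (M := 1)); first exact: cintble_tensor.
  exact: cmfun_expi.
by move=> p; rewrite normc_expi.
Qed.

Lemma cintble_gaussd e : 0 < e -> cintble mu (fun x => rc (gaussd e x)).
Proof.
move=> e0; split; last by rewrite /=; exact: integrable0.
have := (Rintegral_gaussdB (0 : V) e0).1.
by under eq_fun do rewrite subr0.
Qed.

Lemma normc_inverse_fourier_le x : nc (G x) <= q * \int[mu]_xi nc (g xi).
Proof.
have q0 : 0 <= q by rewrite invr_ge0 exprn_ge0// sqrtr_ge0.
rewrite /G /inverse_fourier Normc.normcM normc_real ger0_norm//.
rewrite ler_wpM2l//; apply: (le_trans (normc_cint_le (cintble_expi x ig))).
rewrite le_eqVlt; apply/orP; left; apply/eqP; apply: eq_Rintegral => xi _.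
by rewrite Normc.normcM normc_expi mul1r.
Qed.

(** Measurability comes from Fubini, which asks for integrability in both variables jointly, and the
    phase gives none in [x]. A Gaussian in [x] is inserted under the integral and divided out
    afterwards. *)
Lemma cmfun_inverse_fourier : cmfun G.
Proof.
have ik := cintble_phase (@measurable_dotp2 R n) (cintble_gaussd (@ltr01 R)) ig.
have mk := cmfun_cint ik.
have E : G = (fun x => rc q * rc (gaussd 1 x)^-1 *
    cint mu (fun y => expi (dotp x y) * (rc (gaussd 1 x) * g y))).
  apply/funext => x; rewrite /G /inverse_fourier -/q -mulrA; congr (_ * _).
  have -> : cint mu (fun y => expi (dotp x y) * (rc (gaussd 1 x) * g y)) =
      rc (gaussd 1 x) * cint mu (fun y => expi (dotp x y) * g y).
    by rewrite -cintZ//; apply: eq_cint => y; ring.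
  by rewrite mulrA -rmorphM mulVf ?mul1r// gt_eqF// expR_gt0.
rewrite E; apply: cmfunM => //; apply: cmfunM; first exact: cmfun_cst.
apply: cmfun_real; apply: (eq_measurable_fun (fun x => expR (1 / 2 * sqnorm x))).
  by move=> x _; rewrite /gaussd expRN invrK.
apply: (measurableT_comp (@measurable_expR R)).
by apply: measurable_funM => //; exact: measurable_sqnorm.
Qed.

Section regularized.
Variable e : R.
Hypothesis e0 : 0 < e.

(** The damping makes [G * H], that is [|G|^2 * gaussd e], integrable before [G] is known to be
    square integrable. *)
Let H x := conjc (G x) * rc (gaussd e x).

Let iH : cintble mu H.
Proof.
rewrite /H; under eq_fun do rewrite mulrC.
apply: (cintbleM_bounded (M := q * \int[mu]_xi nc (g xi))).
- exact: cintble_gaussd.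
- by apply: cmfun_conj; exact: cmfun_inverse_fourier.
- by move=> x; rewrite normc_conj; exact: normc_inverse_fourier_le.
Qed.

Let M xi := rc q * cint mu (fun x => expi (dotp x xi) * H x).

Let i_expH xi : cintble mu (fun x => expi (dotp x xi) * H x).
Proof.
under eq_fun do rewrite mulrC.
apply: (cintbleM_bounded (M := 1)) => //; last by move=> x; rewrite normc_expi.
by apply: cmfun_expi; under eq_fun do rewrite dotpC; exact: measurable_dotp.
Qed.

Let heat_le (xi eta : V) : `|heat e (xi - eta)| <= q * (Num.sqrt e ^+ n)^-1.
Proof.
rewrite ger0_norm ?heat_ge0//; apply: ler_piMr.
  by rewrite mulr_ge0// invr_ge0 exprn_ge0// sqrtr_ge0.
by rewrite gaussd_le1// invr_ge0 ltW.
Qed.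

Let measurable_heat (xi : V) : measurable_fun setT (fun eta : V => heat e (xi - eta)).
Proof.
have := measurable_gaussdB e^-1 xi => m.
by apply: measurable_funM => //; under eq_fun do rewrite gaussdBC.
Qed.

Let ig' : cintble mu (fun eta => conjc (g eta)). Proof. exact: cintble_conj. Qed.

Let i_gheat xi : cintble mu (fun eta => conjc (g eta) * rc (heat e (xi - eta))).
Proof.
apply: (cintbleM_bounded (M := q * (Num.sqrt e ^+ n)^-1)) => //.
  exact: cmfun_real.
by move=> eta; rewrite normc_real.
Qed.

Let conjG x : conjc (G x) =
  rc q * cint mu (fun eta => expi (- dotp x eta) * conjc (g eta)).
Proof.
rewrite /G /inverse_fourier conjcM conjc_real -/q; congr (_ * _).
by rewrite -cint_conj//; apply: eq_cint => eta; rewrite conjcM conjc_expi.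
Qed.

Let i_exp' x : cintble mu (fun eta => expi (- dotp x eta) * conjc (g eta)).
Proof.
have := cintble_conj (cintble_expi x ig).
by under eq_fun do rewrite conjcM conjc_expi.
Qed.

(** Damping on one side is convolution on the other: Fubini moves the Gaussian integral inside,
    where it becomes the heat kernel. *)
Let ME xi : M xi = cint mu (fun eta => conjc (g eta) * rc (heat e (xi - eta))).
Proof.
pose a x := expi (dotp x xi) * rc (gaussd e x).
have ia : cintble mu a.
  by have := (cint_expi_gaussd xi e0).1; under eq_fun do rewrite dotpC.
have mh : measurable_fun setT (fun p : V * V => - dotp p.1 p.2).
  exact: (measurableT_comp (@oppr_measurable R setT) (@measurable_dotp2 R n)).
have iF := cintble_phase mh ia ig'.
have E1 x : expi (dotp x xi) * H x = rc q *
    cint mu (fun eta => expi (- dotp x eta) * (a x * conjc (g eta))).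
  have -> : cint mu (fun eta => expi (- dotp x eta) * (a x * conjc (g eta))) =
      a x * cint mu (fun eta => expi (- dotp x eta) * conjc (g eta)).
    by rewrite -cintZ//; apply: eq_cint => eta; rewrite mulrCA.
  by rewrite /H conjG /a; ring.
have iF1 x : cintble mu (fun eta => expi (- dotp x eta) * (a x * conjc (g eta))).
  by have := cintbleZ (a x) (i_exp' x); under eq_fun do rewrite mulrCA.
have E2 eta : (fun x => expi (- dotp x eta) * (a x * conjc (g eta))) =
    (fun x => conjc (g eta) * (expi (dotp (xi - eta) x) * rc (gaussd e x))).
  by apply/funext => x; rewrite /a dotpBl expiD (dotpC eta) (dotpC xi); ring.
have iF2 eta : cintble mu (fun x => expi (- dotp x eta) * (a x * conjc (g eta))).
  by rewrite E2; apply: cintbleZ; exact: (cint_expi_gaussd _ e0).1.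
rewrite /M; under eq_fun do rewrite E1.
rewrite cintZ; last exact: (cintble_cint1 iF1 iF).
rewrite (cint_fubini iF1 iF2 iF) mulrA -cintZ; last exact: (cintble_cint2 iF2 iF).
apply: eq_cint => eta; rewrite E2 cintZ; last exact: (cint_expi_gaussd _ e0).1.
rewrite (cint_expi_gaussd _ e0).2 heatE// !rmorphM; ring.
Qed.

(** Fubini turns the left side into [int g * M], and by [ME] the modulus of [M] is at most the
    convolution of [|g|] with a kernel of mass one. *)
Lemma regularized_le :
  (\int[mu]_x (nc (G x) ^+ 2 * gaussd e x)%:E <= \int[mu]_x (nc (g x) ^+ 2)%:E)%E.
Proof.
have iGH : cintble mu (fun x => G x * H x).
  under eq_fun do rewrite mulrC; apply: (cintbleM_bounded (M := q * \int[mu]_xi nc (g xi))) => //.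
    exact: cmfun_inverse_fourier.
  exact: normc_inverse_fourier_le.
have GH x : G x * H x = rc (nc (G x) ^+ 2 * gaussd e x).
  by rewrite /H mulrA mulc_conj -rmorphM.
have iR : mu.-integrable setT (fun x => (nc (G x) ^+ 2 * gaussd e x)%:E).
  by have := iGH.1; under eq_fun do rewrite GH.
have mF : cintble (mu \x mu)%E (fun p : V * V => expi (dotp p.1 p.2) * (H p.1 * g p.2)).
  exact: cintble_phase (@measurable_dotp2 R n) iH ig.
have F1 x : cintble mu (fun xi => expi (dotp x xi) * (H x * g xi)).
  by have := cintbleZ (H x) (i_exp x); under eq_fun do rewrite mulrCA.
have F2 xi : cintble mu (fun x => expi (dotp x xi) * (H x * g xi)).
  by have := cintbleZ (g xi) (i_expH xi); under eq_fun do rewrite mulrC -mulrA.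
have gME xi : rc q * cint mu (fun x => expi (dotp x xi) * (H x * g xi)) = g xi * M xi.
  have -> : cint mu (fun x => expi (dotp x xi) * (H x * g xi)) =
      g xi * cint mu (fun x => expi (dotp x xi) * H x).
    by rewrite -cintZ//; apply: eq_cint => x; ring.
  by rewrite /M mulrCA.
have E : cint mu (fun x => G x * H x) = cint mu (fun xi => g xi * M xi).
  have E1 x : G x * H x = rc q * cint mu (fun xi => expi (dotp x xi) * (H x * g xi)).
    have -> : cint mu (fun xi => expi (dotp x xi) * (H x * g xi)) =
        H x * cint mu (fun xi => expi (dotp x xi) * g xi).
      by rewrite -cintZ//; apply: eq_cint => xi; rewrite mulrCA.
    by rewrite /G /inverse_fourier -/q; ring.
  under eq_fun do rewrite E1.
  rewrite cintZ; last exact: (cintble_cint1 F1 mF).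
  rewrite (cint_fubini F1 F2 mF) -cintZ; last exact: (cintble_cint2 F2 mF).
  by apply: eq_cint => xi; rewrite -gME.
have igM : cintble mu (fun xi => g xi * M xi).
  under eq_fun do rewrite -gME; apply: cintbleZ; exact: (cintble_cint2 F2 mF).
pose b xi := \int[mu]_eta (nc (g eta) ^+ 2 * heat e (xi - eta)).
have igh xi : mu.-integrable setT (fun eta => (nc (g eta) ^+ 2 * heat e (xi - eta))%:E).
  have := integrableZl measurableT (q * (Num.sqrt e ^+ n)^-1) ig2.
  apply: le_integrable => //.
    apply/measurable_EFinP; apply: measurable_funM => //.
    by apply: measurable_funX; exact: measurable_normc.
  move=> eta _; rewrite /= lee_fin normrM [leRHS]normrM mulrC ler_wpM2r//.
  exact: (le_trans (heat_le _ _) (ler_norm _)).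
(* The inequality [2 |g xi| |g eta| <= |g xi|^2 + |g eta|^2], averaged in [eta] against the
   kernel. *)
have ib xi : nc (g xi) * nc (M xi) <= 2^-1 * nc (g xi) ^+ 2 + 2^-1 * b xi.
  have i1 : mu.-integrable setT (fun eta => (nc (g eta) * heat e (xi - eta))%:E).
    have := cintble_normc (i_gheat xi); apply: eq_integrable => // eta _.
    by rewrite Normc.normcM normc_conj normc_real ger0_norm ?heat_ge0.
  have i2 : mu.-integrable setT (fun eta => (heat e (xi - eta))%:E).
    have := (Rintegral_heatB xi e0).1; apply: eq_integrable => // eta _.
    by rewrite /heat gaussdBC.
  have i3 : \int[mu]_eta heat e (xi - eta) = 1.
    rewrite -(Rintegral_heatB xi e0).2; apply: eq_Rintegral => eta _.
    by rewrite /heat gaussdBC.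
  have M_le : nc (M xi) <= \int[mu]_eta (nc (g eta) * heat e (xi - eta)).
    rewrite ME; apply: (le_trans (normc_cint_le (i_gheat xi))).
    rewrite le_eqVlt; apply/orP; left; apply/eqP; apply: eq_Rintegral => eta _.
    by rewrite Normc.normcM normc_conj normc_real ger0_norm ?heat_ge0.
  apply: (le_trans (ler_wpM2l (normc_ge0 _) M_le)).
  pose s := nc (g xi) ^+ 2.
  have j1 : mu.-integrable setT (EFin \o (fun eta => 2^-1 * s * heat e (xi - eta))).
    by rewrite /comp; under eq_fun do rewrite EFinM; exact: integrableZl.
  have j2 : mu.-integrable setT (EFin \o (fun eta => 2^-1 * (nc (g eta) ^+ 2 * heat e (xi - eta)))).
    by rewrite /comp; under eq_fun do rewrite EFinM; exact: integrableZl.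
  have -> : 2^-1 * nc (g xi) ^+ 2 + 2^-1 * b xi = \int[mu]_eta
      (2^-1 * s * heat e (xi - eta) + 2^-1 * (nc (g eta) ^+ 2 * heat e (xi - eta))).
    rewrite RintegralD// (RintegralZl (f := fun eta : V => heat e (xi - eta)))// i3 mulr1.
    congr (_ + _); symmetry.
    exact: (RintegralZl _ measurableT (igh xi)).
  rewrite -RintegralZl//; apply: le_Rintegral => //.
  - by rewrite /comp; under eq_fun do rewrite EFinM; exact: integrableZl.
  - by rewrite /comp; under eq_fun do rewrite EFinD; exact: integrableD.
  move=> eta _; rewrite /s.
  move: (heat e (xi - eta)) (heat_ge0 e (xi - eta)) => t t0.
  by have := mulr_ge0 t0 (sqr_ge0 (nc (g xi) - nc (g eta))); nra.
have -> : (\int[mu]_x (nc (G x) ^+ 2 * gaussd e x)%:E)%E =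
    (complex.Re (cint mu (fun xi => g xi * M xi)))%:E.
  rewrite -E (eq_cint _ GH) cint_real /= /Rintegral fineK//.
  exact: integrable_fin_num.
apply: (@le_trans _ _ (\int[mu]_xi (nc (g xi) * nc (M xi)))%:E).
  rewrite lee_fin (le_trans (ler_norm _))// (le_trans (Re_le_normc _))//.
  apply: (le_trans (normc_cint_le igM)).
  by under eq_Rintegral do rewrite Normc.normcM.
rewrite /Rintegral fineK; last first.
  apply: integrable_fin_num => //; have := cintble_normc igM.
  by under eq_fun do rewrite Normc.normcM.
have B xi : (b xi)%:E = (\int[mu]_eta (nc (g eta) ^+ 2 * heat e (xi - eta))%:E)%E.
  by rewrite /b /Rintegral fineK//; exact: integrable_fin_num.
have mgh : measurable_fun setT (fun p : V * V => (nc (g p.2) ^+ 2 * heat e (p.1 - p.2))%:E).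
  apply/measurable_EFinP; apply: measurable_funM.
    apply: measurable_funX; apply: measurable_normc.
    exact: (cmfun_comp measurable_snd mg).
  by apply: measurable_funM => //; exact: measurable_gaussdB2.
have gh0 p : (0 <= (nc (g p.2) ^+ 2 * heat e (p.1 - p.2))%:E)%E.
  by rewrite lee_fin mulr_ge0 ?sqr_ge0 ?heat_ge0.
have mb : measurable_fun setT (fun xi => (b xi)%:E).
  under eq_fun do rewrite B.
  exact: (measurable_fun_fubini_tonelli_F
    (fun p : V * V => (nc (g p.2) ^+ 2 * heat e (p.1 - p.2))%:E)).
(* By Tonelli [xi] is integrated first, and the kernel has mass one in that variable as well. *)
have intb : (\int[mu]_xi (b xi)%:E = \int[mu]_x (nc (g x) ^+ 2)%:E)%E.
  under eq_integral do rewrite B.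
  rewrite (fubini_tonelli
    (fun p : V * V => (nc (g p.2) ^+ 2 * heat e (p.1 - p.2))%:E))//.
  apply: eq_integral => eta _ /=.
  under eq_integral do rewrite EFinM.
  rewrite integralZl//; last exact: (Rintegral_heatB eta e0).1.
  rewrite -[RHS]mule1; congr (_ * _)%E.
  have [i1 i2] := Rintegral_heatB eta e0.
  rewrite -i2 /Rintegral fineK//; exact: integrable_fin_num.
have mg2 : measurable_fun setT (fun x => (nc (g x) ^+ 2)%:E).
  exact: measurable_int ig2.
have b0 xi : 0 <= b xi.
  by apply: Rintegral_ge0 => eta _; rewrite mulr_ge0 ?sqr_ge0 ?heat_ge0.
apply: (@le_trans _ _ (\int[mu]_xi (2^-1%:E * (nc (g xi) ^+ 2)%:E + 2^-1%:E * (b xi)%:E))%E).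
  apply: ge0_le_integral => //.
  - by move=> xi _; rewrite lee_fin mulr_ge0 ?normc_ge0.
  - apply/measurable_EFinP; have := measurable_normc (cintble_cmfun igM).
    by under eq_fun do rewrite Normc.normcM.
  - by apply: emeasurable_funD; exact: measurable_funeM.
  - by move=> xi _; rewrite -!EFinM -EFinD lee_fin; exact: ib.
rewrite ge0_integralD//; last 4 first.
- by move=> xi _; rewrite -EFinM lee_fin mulr_ge0 ?sqr_ge0.
- exact: measurable_funeM.
- by move=> xi _; rewrite -EFinM lee_fin mulr_ge0.
- exact: measurable_funeM.
rewrite !ge0_integralZl_EFin ?intb//; last 2 first.
- by move=> xi _; rewrite lee_fin.
- by move=> xi _; rewrite lee_fin sqr_ge0.
set A := integral _ _ _; rewrite -ge0_muleDl ?lee_fin//.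
by rewrite -EFinD (_ : 2^-1 + 2^-1 = 1)%R ?mul1e//; field.
Qed.

End regularized.

Lemma plancherel_le :
  (\int[mu]_x (nc (G x) ^+ 2)%:E <= \int[mu]_x (nc (g x) ^+ 2)%:E)%E.
Proof.
apply: (@fatou_bound _ _ _ _ (fun m x => nc (G x) ^+ 2 * gaussd m.+1%:R^-1 x)).
- move=> m; apply: measurable_funM; last exact: measurable_gaussd.
  by apply: measurable_funX; apply: measurable_normc; exact: cmfun_inverse_fourier.
- by move=> m x; rewrite mulr_ge0 ?sqr_ge0 ?gaussd_ge0.
- move=> x; rewrite -[X in _ --> X]mulr1; apply: cvgM; first exact: cvg_cst.
  exact: cvg_gaussd_1.
- by move=> m; apply: regularized_le; rewrite invr_gt0.
Qed.

End plancherel.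

(** * Lattice exponentials on the cube *)

Section exponentials_1d.
Variable R : realType.
Local Notation leb := (@lebesgue_measure R).
Local Notation rc := (real_complex R).
Implicit Types (a b c h t : R).

Definition window c h t : R := (`|t - c| <= h)%R%:R.

Lemma window_itv c h : window c h = \1_(`[c - h, c + h]%classic : set R).
Proof.
apply/funext => t; rewrite /window indicE; congr (_%:R); congr nat_of_bool.
rewrite ler_distl; apply/idP/idP => [H|].
  by rewrite mem_set//= in_itv.
by rewrite inE/= in_itv.
Qed.

Lemma window_ge0 c h t : 0 <= window c h t. Proof. exact: ler0n. Qed.

Lemma integrable_window c h : leb.-integrable setT (EFin \o window c h).
Proof. rewrite window_itv; exact: integrable_indic_itv. Qed.

Lemma measurable_window c h : measurable_fun setT (window c h : measurableTypeR R -> R).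
Proof. by apply/measurable_EFinP; exact: measurable_int (integrable_window c h). Qed.

(** The phase [b] again covers cosine and sine together; the value of [sinc] at 0 accounts for the
    case [a = 0]. *)
Lemma Rintegral_cos_window a b c h : 0 < h ->
  \int[leb]_t (cos (a * t + b) * window c h t) =
  cos (a * c + b) * (2 * h * sinc (a * h)).
Proof.
move=> h0; have ch : c - h < c + h by rewrite ltrD2l gtrN.
have E : \int[leb]_t (cos (a * t + b) * window c h t) =
    \int[leb]_(t in `[c - h, c + h]) cos (a * t + b).
  rewrite [RHS]Rintegral_mkcond; apply: eq_Rintegral => t _.
  rewrite window_itv indicE patchE; case: ifPn => _; first by rewrite mulr1.
  by rewrite mulr0.
rewrite E; have [->|a0] := eqVneq a 0.
  rewrite !mul0r add0r /sinc eqxx mulr1.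
  under eq_Rintegral do rewrite mul0r add0r.
  rewrite Rintegral_cst//.
  congr (_ * _); transitivity (fine (c + h - (c - h))%:E); last by rewrite /=; ring.
  congr fine; have := lebesgue_measure_itv (`[c - h, c + h] : interval R).
  by rewrite /= lte_fin ch -EFinB.
have dF t : is_derive t (1 : R) (fun t => sin (a * t + b) / a) (cos (a * t + b)).
  by apply: is_derive_eq; rewrite /GRing.scale/=; field.
have cF : continuous (fun t => sin (a * t + b) / a).
  move=> t; apply: differentiable_continuous; apply/derivable1_diffP.
  exact: ex_derive.
rewrite /Rintegral (@continuous_FTC2 _ _ (fun t => sin (a * t + b) / a)) //=.
- rewrite /sinc mulf_eq0 (negPf a0) (gt_eqF h0)/= -mulrBl.
  rewrite (_ : a * (c + h) + b = (a * c + b) + a * h); last by ring.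
  rewrite (_ : a * (c - h) + b = (a * c + b) - a * h); last by ring.
  rewrite sinD sinB; field.
  by rewrite a0 gt_eqF.
- apply: continuous_subspaceT => t.
  by apply: differentiable_continuous; apply/derivable1_diffP.
- have dF' x : derivable (fun t => sin (a * t + b) / a) x 1 by exact: ex_derive.
  split; first by move=> x _.
    exact: (cvg_at_right_filter (cF (c - h))).
  exact: (cvg_at_left_filter (cF (c + h))).
- by move=> x _; rewrite derive1E derive_val.
Qed.

Lemma cintble_expi_window a c h :
  cintble leb (fun t => expi (a * t) * rc (window c h t)).
Proof.
apply: (le_cintble _ _ (integrable_window c h)).
  apply: cmfunM; last by apply: cmfun_real; exact: measurable_window.
  by apply: cmfun_expi; exact: measurable_funM.
by move=> t; rewrite Normc.normcM normc_expi mul1r normc_real ger0_norm ?window_ge0.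
Qed.

Lemma cint_expi_window a c h : 0 < h ->
  cint leb (fun t => expi (a * t) * rc (window c h t)) =
  expi (a * c) * rc (2 * h * sinc (a * h)).
Proof.
move=> h0; rewrite /cint /expi; apply/eqP; rewrite eq_complex /=.
apply/andP; split; apply/eqP.
  rewrite mulr0 subr0 -[a * c in RHS]addr0 -Rintegral_cos_window//.
  by apply: eq_Rintegral => t _; rewrite mulr0 subr0 addr0.
have sE s : sin s = cos (s - pi / 2).
  by rewrite cosD cosN sinN cos_pihalf sin_pihalf; ring.
rewrite mulr0 add0r sE -Rintegral_cos_window//.
by apply: eq_Rintegral => t _; rewrite mulr0 add0r sE.
Qed.

Lemma sin_pi_nat (m : nat) : sin (pi * m%:R) = 0 :> R.
Proof.
elim: m => [|m IH]; first by rewrite mulr0 sin0.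
by rewrite -natr1 mulrDr mulr1 sinDpi IH oppr0.
Qed.

Lemma sin_pi_int (l : int) : sin (pi * l%:~R) = 0 :> R.
Proof.
case: l => m; first exact: sin_pi_nat.
by rewrite NegzE mulrNz mulrN sinN sin_pi_nat oppr0.
Qed.

Lemma sinc_pi_int (l : int) : sinc (pi * l%:~R) = (l == 0)%:R :> R.
Proof.
rewrite /sinc mulf_eq0 gt_eqF ?pi_gt0//= intr_eq0.
by have [//|_] := eqVneq l 0; rewrite sin_pi_int mul0r.
Qed.

Lemma expi_2pi_int (l : int) : expi (2 * pi * l%:~R) = 1 :> R[i].
Proof.
have s0 := sin_pi_int l; rewrite /expi -mulrA mulr_natl.
rewrite cos_mulr2n sin_mulr2n cos2sin2 s0 expr0n mulr0 mul0rn subr0 mulr2n addrK.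
by [].
Qed.

End exponentials_1d.

Section lattice_1d.
Variables (R : realType) (N : R) (ks : seq int) (v : int -> R).
Hypothesis N0 : 0 < N.
Local Notation leb := (@lebesgue_measure R).
Local Notation rc := (real_complex R).

(* Constant on each period of the exponentials t |-> e^(ilt/N). *)
Definition comb (t : R) : R :=
  \sum_(k <- ks) v k * window (2 * pi * N * k%:~R) (pi * N) t.

(** The integral of [comb]: every window has length [2 * pi * N]. *)
Definition comb_weight : R := 2 * pi * N * \sum_(k <- ks) v k.

Lemma comb_expiE a (t : R) : expi (a * t) * rc (comb t) =
  \sum_(k <- ks) rc (v k) * (expi (a * t) * rc (window (2 * pi * N * k%:~R) (pi * N) t)).
Proof.
rewrite /comb real_complex_sum mulr_sumr; apply: eq_bigr => k _.
by rewrite rmorphM mulrCA.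
Qed.

Lemma cintble_expi_comb a : cintble leb (fun t => expi (a * t) * rc (comb t)).
Proof.
under eq_fun do rewrite comb_expiE.
apply: cintble_sum => k; apply: cintbleZ; exact: cintble_expi_window.
Qed.

(** Moving the window by [2 * pi * N * k] multiplies the integral by [expi (2 * pi * l * k) = 1], so
    all windows contribute alike, through [sinc (pi * l)], which vanishes unless [l = 0]. *)
Lemma cint_expi_comb (l : int) :
  cint leb (fun t => expi (l%:~R / N * t) * rc (comb t)) =
  rc (comb_weight * (l == 0)%:R).
Proof.
transitivity (cint leb (fun t : R => \sum_(k <- ks) rc (v k) *
    (expi (l%:~R / N * t) * rc (window (2 * pi * N * k%:~R) (pi * N) t)))).
  by apply: eq_cint => t; exact: comb_expiE.
rewrite cint_sum; last first.
  by move=> k; apply: cintbleZ; exact: cintble_expi_window.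
rewrite /comb_weight mulr_sumr mulr_suml real_complex_sum; apply: eq_bigr => k _.
rewrite cintZ; last exact: cintble_expi_window.
rewrite cint_expi_window ?mulr_gt0 ?pi_gt0//.
rewrite (_ : l%:~R / N * (2 * pi * N * k%:~R) = 2 * pi * (l * k)%:~R); last first.
  by rewrite intrM; field; rewrite gt_eqF.
rewrite expi_2pi_int mul1r (_ : l%:~R / N * (pi * N) = pi * l%:~R); last first.
  by field; rewrite gt_eqF.
by rewrite sinc_pi_int -rmorphM; congr (rc _); ring.
Qed.

End lattice_1d.

Section lattice_rV.
Variables (R : realType) (d : nat) (N : R).
Hypothesis N0 : 0 < N.
Local Notation V := 'rV[R]_d.
Local Notation mu := (lebesgue_rV R d).
Local Notation nc := (@Normc.normc R).
Local Notation rc := (real_complex R).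
Local Notation sp := (@sample_point R d N).
Implicit Types (l n m : 'rV[int]_d) (J : seq 'rV[int]_d) (a : 'rV[int]_d -> R[i]).

Definition trigpoly J a (xi : V) : R[i] := \sum_(n <- J) a n * expi (dotp (sp n) xi).

Section comb_weights.
Variables (ks : seq int) (v : int -> R).
Local Notation comb := (comb N ks v).
Local Notation w := (comb_weight N ks v).

Definition combd (xi : V) : R := \prod_(j < d) comb (xi 0 j).

Lemma cint_expi_combd_gen (x : V) :
  cintble mu (fun xi => expi (dotp x xi) * rc (combd xi)) /\
  cint mu (fun xi => expi (dotp x xi) * rc (combd xi)) =
  \prod_(j < d) cint (@lebesgue_measure R) (fun t => expi (x 0 j * t) * rc (comb t)).
Proof.
pose h (j : 'I_d) t := expi (x 0 j * t) * rc (comb t).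
have ih j : cintble (@lebesgue_measure R) (h j) by exact: cintble_expi_comb.
have E : (fun xi => expi (dotp x xi) * rc (combd xi)) =
    (fun xi => \prod_(j < d) h j (xi 0 j)).
  by apply/funext => xi; rewrite expi_dotp rmorph_prod -big_split.
by rewrite E; exact: cint_tensor ih.
Qed.

Lemma cint_expi_combd l :
  cint mu (fun xi => expi (dotp (sp l) xi) * rc (combd xi)) =
  rc (w ^+ d * (l == 0)%:R).
Proof.
rewrite (cint_expi_combd_gen _).2.
rewrite (eq_bigr (fun j => rc (w * (l 0 j == 0)%:R))) => [|j _]; last first.
  by rewrite mxE cint_expi_comb.
rewrite -rmorph_prod big_split prodr_const card_ord/=; congr (rc (_ * _)).
have [->|l0] := eqVneq l 0; first by rewrite big1// => j _; rewrite mxE eqxx.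
have [j lj] : exists j, l 0 j != 0.
  apply/existsP; apply: contraNT l0 => /existsPn H; apply/eqP/rowP => j.
  by rewrite mxE; apply/eqP/negPn/H.
by rewrite (bigD1 j)//= (negPf lj) mul0r.
Qed.

Lemma dotp_sampleB n m (xi : V) :
  dotp (sp (n - m)) xi = dotp (sp n) xi - dotp (sp m) xi.
Proof.
by rewrite -dotpBl; congr dotp; apply/rowP => j; rewrite !mxE intrB mulrBl.
Qed.

Lemma sqr_trigpoly_combE J a (xi : V) :
  rc (nc (trigpoly J a xi) ^+ 2 * combd xi) =
  \sum_(n <- J) \sum_(m <- J) (a n * conjc (a m)) *
    (expi (dotp (sp (n - m)) xi) * rc (combd xi)).
Proof.
rewrite real_complexM -mulc_conj /trigpoly conjc_sum mulr_suml mulr_suml.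
apply: eq_bigr => n _; rewrite mulr_sumr mulr_suml; apply: eq_bigr => m _.
by rewrite dotp_sampleB expiD conjcM conjc_expi; ring.
Qed.

(** In the expanded square only the diagonal survives: for [n != m] the exponential of [n - m]
    integrates to zero against the step function. *)
Lemma Rintegral_sqr_trigpoly J a : uniq J ->
  mu.-integrable setT (fun xi => (nc (trigpoly J a xi) ^+ 2 * combd xi)%:E) /\
  \int[mu]_xi (nc (trigpoly J a xi) ^+ 2 * combd xi) =
    w ^+ d * \sum_(n <- J) nc (a n) ^+ 2.
Proof.
move=> uJ.
have i0 n m : cintble mu (fun xi => (a n * conjc (a m)) *
    (expi (dotp (sp (n - m)) xi) * rc (combd xi))).
  by apply: cintbleZ; exact: (cint_expi_combd_gen _).1.
have i1 n : cintble mu (fun xi => \sum_(m <- J) (a n * conjc (a m)) *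
    (expi (dotp (sp (n - m)) xi) * rc (combd xi))).
  by apply: cintble_sum => m.
split.
  have : cintble mu (fun xi => rc (nc (trigpoly J a xi) ^+ 2 * combd xi)).
    by under eq_fun do rewrite sqr_trigpoly_combE; exact: cintble_sum.
  by case.
have : rc (\int[mu]_xi (nc (trigpoly J a xi) ^+ 2 * combd xi)) =
    rc (w ^+ d * \sum_(n <- J) nc (a n) ^+ 2).
  rewrite -cint_real (eq_cint _ (sqr_trigpoly_combE J a)) cint_sum//.
  rewrite mulr_sumr real_complex_sum; apply: eq_big_seq => n nJ.
  rewrite cint_sum// (bigD1_seq n)//= big1_seq ?addr0.
    rewrite cintZ; last exact: (cint_expi_combd_gen _).1.
    rewrite cint_expi_combd subrr eqxx mulr1 mulc_conj -rmorphM; congr (rc _).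
    by rewrite mulrC.
  move=> m /andP[mn _]; rewrite cintZ; last exact: (cint_expi_combd_gen _).1.
  by rewrite cint_expi_combd subr_eq0 eq_sym (negPf mn) mulr0 rmorph0 mulr0.
by case.
Qed.

End comb_weights.

Definition boxw (xi : V) : R := \prod_(j < d) window 0 (pi * N) (xi 0 j).

(** The cube is the step function with a single window, so the orthogonality statements above apply
    to it. *)
Lemma boxw_combd : boxw = combd [:: 0] (fun=> 1).
Proof.
apply/funext => xi; apply: eq_bigr => j _.
by rewrite /comb big_seq1 mul1r mulr0z mulr0.
Qed.

Lemma boxwE (xi : V) : boxw xi = \1_(cube 0 (pi * N)) xi.
Proof.
rewrite indicE; have [/set_mem H|H] := boolP (xi \in _).
  by rewrite /boxw big1// => j _; have := H j; rewrite mxE /window => ->.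
have [j lj] : exists j : 'I_d, ~~ (`|xi 0 j - 0| <= pi * N).
  apply: contrapT => K; move/negP: H; apply; apply/mem_set => j; rewrite mxE.
  by apply: contrapT => /negP L; apply: K; exists j.
by rewrite /boxw (bigD1 j)//= /window (negPf lj) mul0r.
Qed.

Lemma boxw_sqr (xi : V) : boxw xi ^+ 2 = boxw xi.
Proof. by rewrite boxwE indicE; case: (_ \in _); rewrite ?expr1n ?expr0n. Qed.

Lemma measurable_boxw : measurable_fun setT boxw.
Proof.
apply: (@measurable_prod _ V _ _ _ _ (fun j xi => window 0 (pi * N) (xi 0 j))) => j _.
exact: (measurableT_comp (@measurable_window R 0 _) (measurable_coord j)).
Qed.

Lemma Rintegral_sqr_trigpoly_box J a : uniq J ->
  mu.-integrable setT (fun xi => (nc (trigpoly J a xi) ^+ 2 * boxw xi)%:E) /\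
  \int[mu]_xi (nc (trigpoly J a xi) ^+ 2 * boxw xi) =
    (2 * pi * N) ^+ d * \sum_(n <- J) nc (a n) ^+ 2.
Proof.
move=> uJ; have := Rintegral_sqr_trigpoly [:: 0] (fun=> 1) a uJ.
by rewrite -boxw_combd /comb_weight big_seq1 mulr1.
Qed.

Lemma cint_expi_box (x : V) n :
  cintble mu (fun xi => expi (dotp x xi - dotp (sp n) xi) * rc (boxw xi)) /\
  cint mu (fun xi => expi (dotp x xi - dotp (sp n) xi) * rc (boxw xi)) =
  rc ((2 * pi * N) ^+ d * cardinal_fun N n x).
Proof.
have := cint_expi_combd_gen [:: 0] (fun=> 1) (x - sp n); rewrite -boxw_combd.
under eq_fun do rewrite dotpBl.
move=> [H1 H2]; split=> //; rewrite {}H2.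
rewrite (eq_bigr (fun j => rc (2 * pi * N * sinc (pi * (N * x 0 j - (n 0 j)%:~R))))) => [|j _].
  by rewrite -rmorph_prod big_split prodr_const card_ord.
transitivity (cint (@lebesgue_measure R) (fun t => expi ((x 0 j - (n 0 j)%:~R / N) * t) *
    rc (window 0 (pi * N) t))).
  apply: eq_cint => t; rewrite !mxE /comb big_seq1 mul1r mulr0z mulr0.
  by rewrite mulrBl.
rewrite cint_expi_window ?mulr_gt0 ?pi_gt0// mulr0 expi0 mul1r; congr (rc (_ * sinc _)).
  by rewrite mulrA.
by field; rewrite gt_eqF.
Qed.

End lattice_rV.

Lemma ler_sum_uniq (R : realType) (I : eqType) (s r : seq I) (F : I -> R) :
  uniq s -> uniq r -> {subset s <= r} -> (forall i, 0 <= F i) ->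
  \sum_(i <- s) F i <= \sum_(i <- r) F i.
Proof.
move=> us ur sr F0; have -> : \sum_(i <- s) F i = \sum_(i <- r | i \in s) F i.
  rewrite -[RHS]big_filter; apply: perm_big; apply: uniq_perm => //.
    by rewrite filter_uniq.
  move=> i; rewrite mem_filter; apply/idP/andP => [si|[]//].
  by split=> //; exact: sr.
by rewrite [leRHS](bigID (mem s))/= lerDl sumr_ge0.
Qed.

(** * Squares of the cardinal functions *)

Section sinc_squares.
Variable R : realType.
Implicit Types (t u c : R).

(** The difference [sin t - t * cos t] vanishes at 0 and its derivative [t * sin t] is nonnegative
    up to [pi]. *)
Lemma mul_cos_le_sin u : 0 <= u <= pi -> u * cos u <= sin u.
Proof.
move=> /andP[]; rewrite le_eqVlt => /predU1P[<-|u0] upi.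
  by rewrite mul0r sin0.
pose g t := sin t - t * cos t.
have dg t : is_derive t (1 : R) g (t * sin t).
  by apply: is_derive_eq; rewrite /GRing.scale/=; ring.
have cg : {within `[0, u], continuous g}.
  apply: continuous_subspaceT => t; apply: differentiable_continuous.
  by apply/derivable1_diffP; exact: ex_derive.
have [t tu] := MVT u0 (fun t _ => dg t) cg.
rewrite {1 2}/g sin0 mul0r subr0 subr0 => E.
rewrite -subr_ge0 E !mulr_ge0 ?(ltW u0)//; move: tu; rewrite in_itv/= => /andP[t0 tu].
- exact: ltW.
- by rewrite sin_ge0_pi// (ltW t0)/= (le_trans (ltW tu)).
- by rewrite subr0 ltW.
Qed.

Lemma sincN u : sinc (- u) = sinc u.
Proof. by rewrite /sinc oppr_eq0 sinN invrN mulrNN. Qed.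

Lemma cos_sqr_le_sinc_sqr u : `|u| <= pi / 2 -> cos u ^+ 2 <= sinc u ^+ 2.
Proof.
wlog u0 : u / 0 <= u => [H|].
  have [/H//|/ltW u0 hu] := leP 0 u.
  by rewrite -sincN -cosN; apply: H; rewrite ?oppr_ge0// normrN.
rewrite ger0_norm// => hu.
have [->|u_neq0] := eqVneq u 0; first by rewrite cos0 /sinc eqxx.
have u_gt0 : 0 < u by rewrite lt_neqAle eq_sym u_neq0.
have c0 : 0 <= cos u by rewrite cos_ge0_pihalf// hu andbT (le_trans _ u0)// oppr_le0 divr_ge0 ?pi_ge0.
have le1 : cos u <= sinc u.
  rewrite /sinc (negPf u_neq0) ler_pdivlMr// mulrC mul_cos_le_sin// u0/=.
  by rewrite (le_trans hu)// ler_pdivrMr// ler_peMr ?pi_ge0// ler1n.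
by rewrite lerXn2r// nnegrE (le_trans c0).
Qed.

Lemma sinc_double u : sinc (2 * u) = cos u * sinc u.
Proof.
rewrite /sinc mulf_eq0 pnatr_eq0/=; case: eqVneq => [->|u0].
  by rewrite cos0 mulr1.
by rewrite mulr_natl sin_mulr2n -mulr_natl; field; rewrite u0.
Qed.

Lemma cos_sqr_shift t (k : int) : cos (pi * (t - k%:~R)) ^+ 2 = cos (pi * t) ^+ 2.
Proof.
rewrite mulrBr cosB sin_pi_int mulr0 addr0 exprMn.
by rewrite [cos (pi * k%:~R) ^+ 2]cos2sin2 sin_pi_int expr0n subr0 mulr1.
Qed.

Definition sinc_sum (ks : seq int) t : R :=
  \sum_(k <- ks) sinc (pi * (t - k%:~R)) ^+ 2.

(** The integer nearest to [t] is within [1 / 2] of it, where [sinc] dominates the cosine. This is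
    the defect [c = 1] from which the halving starts. *)
Lemma sinc_sum_base t : exists2 ks, uniq ks & 1 - sin (pi * t) ^+ 2 <= sinc_sum ks t.
Proof.
pose k := Num.floor (t + 1 / 2); exists [:: k] => //.
rewrite /sinc_sum big_seq1 -cos2sin2 -(cos_sqr_shift t k) cos_sqr_le_sinc_sqr//.
rewrite normrM ger0_norm ?pi_ge0// ler_pM2l ?pi_gt0//.
have /andP[k1 k2] := floor_itv (t + 1 / 2).
rewrite -/k in k1 k2; rewrite ler_norml; rewrite intrD in k2.
apply/andP; split; lra.
Qed.

(** By [sinc (2 u) = cos u * sinc u], even nodes [2 k] become integer nodes seen from [t / 2], and
    odd nodes [2 k - 1] integer nodes seen from [(t + 1) / 2], where the cosine turns into a sine up
    to sign. *)
Lemma sinc_sum_split ks1 ks2 t :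
  sinc_sum ([seq 2 * k | k <- ks1] ++ [seq 2 * k - 1 | k <- ks2]) t =
  cos (pi * (t / 2)) ^+ 2 * sinc_sum ks1 (t / 2) +
  sin (pi * (t / 2)) ^+ 2 * sinc_sum ks2 ((t + 1) / 2).
Proof.
rewrite /sinc_sum big_cat !big_map/= !mulr_sumr; congr (_ + _); apply: eq_bigr => k _.
  rewrite (_ : pi * (t - (2 * k)%:~R) = 2 * (pi * (t / 2 - k%:~R))); last first.
    by rewrite intrM; field.
  by rewrite sinc_double exprMn cos_sqr_shift.
rewrite (_ : pi * (t - (2 * k - 1)%:~R) = 2 * (pi * ((t + 1) / 2 - k%:~R))); last first.
  by rewrite intrB intrM; field.
rewrite sinc_double exprMn cos_sqr_shift.
rewrite (_ : pi * ((t + 1) / 2) = pi * (t / 2) + pi / 2); last by field.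
by rewrite cosDpihalf sqrrN.
Qed.

(* The defect is halved by the splitting into even and odd nodes, because
   2 sin^2(a) cos^2(a) = sin^2(2a) / 2. *)
Lemma sinc_sum_halve c :
  (forall t, exists2 ks, uniq ks & 1 - c * sin (pi * t) ^+ 2 <= sinc_sum ks t) ->
  forall t, exists2 ks, uniq ks & 1 - c / 2 * sin (pi * t) ^+ 2 <= sinc_sum ks t.
Proof.
move=> H t; have [ks1 u1 h1] := H (t / 2); have [ks2 u2 h2] := H ((t + 1) / 2).
exists ([seq 2 * k | k <- ks1] ++ [seq 2 * k - 1 | k <- ks2]).
  rewrite cat_uniq !map_inj_uniq ?u1 ?u2 ?andbT/=; last 2 first.
  - by move=> x y /addIr /(mulfI (isT : (2 : int) != 0)).
  - by move=> x y /(mulfI (isT : (2 : int) != 0)).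
  apply/hasPn => _ /mapP[x _ ->]; apply/mapP => -[y _ E].
  by lia.
rewrite sinc_sum_split; set a := pi * (t / 2).
have a2 : pi * ((t + 1) / 2) = a + pi / 2 by rewrite /a; field.
rewrite a2 sinDpihalf in h2.
have -> : sin (pi * t) = 2 * (cos a * sin a).
  have -> : pi * t = a *+ 2 by rewrite mulr2n /a; field.
  by rewrite sin_mulr2n mulr_natl.
have := cos2Dsin2 a; set C := cos a ^+ 2; set S := sin a ^+ 2 => CS.
have C0 : 0 <= C by exact: sqr_ge0.
have S0 : 0 <= S by exact: sqr_ge0.
rewrite exprMn exprMn -/C -/S.
apply: (le_trans _ (lerD (ler_wpM2l C0 h1) (ler_wpM2l S0 h2))).
rewrite -/a -/S -/C le_eqVlt; apply/orP; left; apply/eqP.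
have -> : S = 1 - C by rewrite -CS; ring.
by field.
Qed.

(** Finite lists of nodes stand in for the infinite identity; after [j] halvings the defect is
    [2^(-j) * sin^2]. *)
Lemma sinc_sum_lower t (e : R) : 0 < e ->
  exists2 ks, uniq ks & 1 - e <= sinc_sum ks t.
Proof.
move=> e0.
have H (j : nat) : forall t, exists2 ks, uniq ks &
    1 - (2^-1) ^+ j * sin (pi * t) ^+ 2 <= sinc_sum ks t.
  elim: j => [|j IH] {}t.
    by rewrite expr0 mul1r; exact: sinc_sum_base.
  by rewrite exprSr; exact: sinc_sum_halve.
have [j hj] : exists j : nat, (2^-1 : R) ^+ j <= e.
  exists (Num.truncn e^-1).+1; set j := _.+1.
  rewrite exprVn invf_ple ?posrE ?exprn_gt0//.
  apply: (le_trans (ltW (truncnS_gt _))); rewrite -/j -natrX ler_nat.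
  exact/ltnW/ltn_expl.
have [ks uks hks] := H j t; exists ks => //; apply: le_trans hks.
rewrite lerD2l lerN2 -[leRHS]mulr1; apply: ler_pM => //; rewrite ?sqr_ge0 ?exprn_ge0//.
Qed.

End sinc_squares.

(** * Bessel's inequality and Parseval's identity for the cardinal functions *)

Section bessel_parseval.
Variables (R : realType) (d : nat) (N : R).
Hypothesis N0 : 0 < N.
Local Notation V := 'rV[R]_d.
Local Notation mu := (lebesgue_rV R d).
Local Notation nc := (@Normc.normc R).
Local Notation rc := (real_complex R).
Local Notation sp := (@sample_point R d N).
Local Notation card := (@cardinal_fun R d N).
Implicit Types (n m : 'rV[int]_d) (J : seq 'rV[int]_d).

Definition exp_remainder J (x xi : V) : R[i] :=
  expi (dotp x xi) - trigpoly N J (fun n => rc (card n x)) xi.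

(** The sum of squares enters once with a plus sign, from the norm of the polynomial, and twice with
    a minus sign, from the cross term computed by [cint_expi_box]; nonnegativity of the result is
    Bessel's inequality. *)
Lemma Rintegral_exp_remainder J x : uniq J ->
  mu.-integrable setT (fun xi => (nc (exp_remainder J x xi) ^+ 2 * boxw N xi)%:E) /\
  \int[mu]_xi (nc (exp_remainder J x xi) ^+ 2 * boxw N xi) =
    (2 * pi * N) ^+ d * (1 - \sum_(n <- J) card n x ^+ 2).
Proof.
move=> uJ; set P := (2 * pi * N) ^+ d; set S := \sum_(n <- J) _.
pose A := trigpoly N J (fun n => rc (card n x)).
have [iA IA] := Rintegral_sqr_trigpoly_box N0 (fun n => rc (card n x)) uJ.
(* The volume of the cube, read off from the polynomial whose only frequency is 0. *)
have [i1 I1] := Rintegral_sqr_trigpoly_box N0 (fun=> 1) (isT : uniq [:: 0 : 'rV[int]_d]).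
have one xi : nc (trigpoly N [:: 0 : 'rV[int]_d] (fun=> 1) xi) = 1.
  by rewrite /trigpoly big_seq1 mul1r normc_expi.
have {}i1 : mu.-integrable setT (fun xi => (boxw N xi)%:E).
  by move: i1; under eq_fun do rewrite one expr1n mul1r.
have {}I1 : \int[mu]_xi boxw N xi = P.
  move: I1; rewrite big_seq1 Normc.normc1 expr1n mulr1 -/P => <-.
  by apply: eq_Rintegral => xi _; rewrite one expr1n mul1r.
pose X n xi := rc (card n x) * (expi (dotp x xi - dotp (sp n) xi) * rc (boxw N xi)).
have iX n : cintble mu (X n) by apply: cintbleZ; exact: (cint_expi_box N0 x n).1.
have EX xi : expi (dotp x xi) * conjc (A xi) * rc (boxw N xi) = \sum_(n <- J) X n xi.
  rewrite /A /trigpoly conjc_sum mulr_sumr mulr_suml; apply: eq_bigr => n _.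
  by rewrite conjcM conjc_real conjc_expi /X expiD; ring.
have icross : cintble mu (fun xi => expi (dotp x xi) * conjc (A xi) * rc (boxw N xi)).
  by under eq_fun do rewrite EX; exact: cintble_sum.
have cross : cint mu (fun xi => expi (dotp x xi) * conjc (A xi) * rc (boxw N xi)) =
    rc (P * S).
  rewrite (eq_cint _ EX) cint_sum// mulr_sumr real_complex_sum; apply: eq_bigr => n _.
  rewrite cintZ; last exact: (cint_expi_box N0 x n).1.
  by rewrite (cint_expi_box N0 x n).2 -real_complexM; congr (rc _); rewrite mulrCA expr2.
have E xi : nc (exp_remainder J x xi) ^+ 2 * boxw N xi =
    boxw N xi + nc (A xi) ^+ 2 * boxw N xi -
      2 * complex.Re (expi (dotp x xi) * conjc (A xi) * rc (boxw N xi)).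
  by rewrite /exp_remainder -/A normc_sqrB normc_expi expr1n ReM_real; ring.
have iR : mu.-integrable setT (EFin \o (fun xi =>
    2 * complex.Re (expi (dotp x xi) * conjc (A xi) * rc (boxw N xi)))).
  by rewrite /comp; under eq_fun do rewrite EFinM; apply: integrableZl => //; exact: icross.1.
have i2 : mu.-integrable setT (EFin \o (fun xi => boxw N xi + nc (A xi) ^+ 2 * boxw N xi)).
  by rewrite /comp; under eq_fun do rewrite EFinD; exact: integrableD.
split.
  by under eq_fun do rewrite E EFinB; exact: integrableB.
under eq_Rintegral do rewrite E.
rewrite RintegralB// RintegralD// RintegralZl//; last exact: icross.1.
rewrite I1 IA; have -> : \int[mu]_xi complex.Re (expi (dotp x xi) * conjc (A xi) * rc (boxw N xi)) = P * S.
  by have /(congr1 (@complex.Re R)) := cross.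
rewrite (_ : \sum_(n <- J) nc (rc (card n x)) ^+ 2 = S); first by rewrite -/P; ring.
by apply: eq_bigr => n _; rewrite normc_real real_normK ?num_real.
Qed.

Lemma bessel_cardinal J x : uniq J -> \sum_(n <- J) card n x ^+ 2 <= 1.
Proof.
move=> uJ; rewrite -subr_ge0.
have P0 : 0 < (2 * pi * N) ^+ d by rewrite exprn_gt0// !mulr_gt0// pi_gt0.
rewrite -(pmulr_rge0 _ P0) -(Rintegral_exp_remainder x uJ).2.
apply: Rintegral_ge0 => xi _; rewrite mulr_ge0 ?sqr_ge0//.
by rewrite boxwE indicE ler0n.
Qed.

(** Over a product set of nodes the sum of squares factors into one-dimensional sums, each close to
    1. *)
Lemma parseval_cardinal x (e : R) : 0 < e ->
  exists2 J, uniq J & 1 - e <= \sum_(n <- J) card n x ^+ 2.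
Proof.
move=> e0; case: (posnP d) => [d0|d0].
  exists [:: 0] => //; rewrite big_seq1 /cardinal_fun big1 ?expr1n; last first.
    by move=> i _; have := ltn_ord i; rewrite {2}d0.
  by rewrite lerBlDr lerDl ltW.
(* Bernoulli's inequality loses [d * e'] in the [d]-th power; the cap 1 keeps [1 - e']
   nonnegative. *)
pose e' := Num.min 1 (e / d%:R).
have e'0 : 0 < e' by rewrite lt_min ltr01 divr_gt0// ltr0n.
have [ks uks hks] : exists2 ks : 'I_d -> seq int, (forall j, uniq (ks j)) &
    (forall j, 1 - e' <= sinc_sum (ks j) (N * x 0 j)).
  have H j := sinc_sum_lower (N * x 0 j) e'0.
  exists (fun j => sval (cid2 (H j))) => j; by case: (cid2 (H j)).
(* A list common to all coordinates, so that the nodes are indexed by the functions from ['I_d] to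
   ['I_(size K)] and the product of sums distributes. *)
pose K := undup (flatten [seq ks j | j <- enum 'I_d]).
have uK : uniq K by exact: undup_uniq.
have hK j : 1 - e' <= \sum_(k <- K) sinc (pi * (N * x 0 j - k%:~R)) ^+ 2.
  apply: (le_trans (hks j)); rewrite /sinc_sum.
  apply: ler_sum_uniq => // [k kj|k]; last exact: sqr_ge0.
  by rewrite mem_undup; apply/flattenP; exists (ks j) => //; apply/mapP; exists j; rewrite ?mem_enum.
pose row (f : {ffun 'I_d -> 'I_(size K)}) : 'rV[int]_d := \row_j nth 0 K (f j).
have row_inj : injective row.
  move=> f g /rowP fg; apply/ffunP => j; have := fg j; rewrite !mxE => /eqP.
  by rewrite nth_uniq// => /eqP/val_inj.
exists [seq row f | f <- enum {: {ffun 'I_d -> 'I_(size K)}}].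
  by rewrite map_inj_uniq// enum_uniq.
rewrite big_map big_enum/=.
have -> : \sum_(f : {ffun 'I_d -> 'I_(size K)}) card (row f) x ^+ 2 =
    \prod_(j < d) \sum_(i < size K) sinc (pi * (N * x 0 j - (nth 0 K i)%:~R)) ^+ 2.
  rewrite bigA_distr_bigA/=; apply: eq_bigr => f _.
  by rewrite -prodrXl; apply: eq_bigr => j _; rewrite mxE.
have e'1 : 0 <= 1 - e' by rewrite subr_ge0 ge_min lexx.
apply: (@le_trans _ _ ((1 - e') ^+ d)).
  have bern (k : nat) : 1 - k%:R * e' <= (1 - e') ^+ k.
    elim: k => [|k IH]; first by rewrite mul0r subr0 expr0.
    rewrite exprS -natr1; apply: (le_trans _ (ler_wpM2l e'1 IH)).
    rewrite -subr_ge0 (_ : _ - _ = k%:R * e' ^+ 2); last by ring.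
    by rewrite mulr_ge0// sqr_ge0.
  apply: (le_trans _ (bern d)); rewrite lerD2l lerN2.
  have : e' <= e / d%:R by rewrite ge_min lexx orbT.
  by rewrite ler_pdivlMr ?ltr0n// mulrC.
rewrite -[in leLHS](card_ord d) -prodr_const; apply: ler_prod => j _; rewrite e'1/=.
by have := hK j; rewrite (big_nth 0) big_mkord.
Qed.

End bessel_parseval.

(** * The Bessel weight and the sampling bound *)

Section weight_1d.
Variables (R : realType) (sg : R).
Hypothesis sg_gt : 1 / 2 < sg.
Implicit Types (a b t N : R).

Let sg0 : 0 < sg. Proof. by apply: lt_trans sg_gt; rewrite divr_gt0. Qed.

Let r : R := 2 * sg - 1.

Let r0 : 0 < r. Proof. by rewrite /r; move: sg_gt; lra. Qed.

Lemma ler_powRN a b : 0 < a -> a <= b -> b `^ (- sg) <= a `^ (- sg).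
Proof.
move=> a0 ab; have b0 := lt_le_trans a0 ab.
rewrite !powRN lef_pV2 ?posrE ?powR_gt0//.
by apply: ge0_ler_powR; rewrite ?nnegrE// ltW.
Qed.

(* Tangent line of x^(1-2sg) at b. *)
Lemma powR_tangent a b : 0 < a -> 0 < b ->
  r * (b - a) * b `^ (- (2 * sg)) <= a `^ (- r) - b `^ (- r).
Proof.
move=> a0 b0.
have bE : b `^ (- (2 * sg)) = b `^ (- r) / b.
  have -> : - (2 * sg) = - r - 1 by rewrite /r; ring.
  rewrite powRD; last by apply/implyP => _; rewrite gt_eqF.
  by rewrite [b `^ (- 1)]powRN powRr1 ?(ltW b0).
have h : 1 + r * (1 - a / b) <= (a / b) `^ (- r).
  rewrite /powR gt_eqF ?divr_gt0//.
  apply: (le_trans _ (expR_ge1Dx _)); rewrite lerD2l mulNr -mulrN.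
  rewrite ler_wpM2l ?(ltW r0)// lerNr opprB.
  have := @le_ln1Dx R (a / b - 1).
  by rewrite [1 + _]addrC subrK; apply; rewrite ltrBrDl subrr divr_gt0.
have aE : a `^ (- r) = (a / b) `^ (- r) * b `^ (- r).
  by rewrite -powRM ?divr_ge0 ?(ltW a0) ?(ltW b0)// divfK// gt_eqF.
have -> : r * (b - a) * b `^ (- (2 * sg)) = r * (1 - a / b) * b `^ (- r).
  by rewrite bE; field; rewrite gt_eqF.
have := ler_wpM2r (powR_ge0 b (- r)) h; rewrite -aE mulrDl mul1r; lra.
Qed.

(** Comparison with an integral in discrete form: the tangent at [1 + N * m.+1] bounds each term by
    a difference of consecutive values of [x^(-r)], divided by [r * N]. *)
Lemma sum_powR_telescope N (K : nat) : 0 < N ->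
  \sum_(m < K) (1 + N * m.+1%:R) `^ (- (2 * sg)) <= (r * N)^-1.
Proof.
move=> N0; have pos m : 0 < 1 + N * m%:R by rewrite ltr_pwDl// mulr_ge0// ltW.
have step m : (1 + N * m.+1%:R) `^ (- (2 * sg)) <=
    (r * N)^-1 * ((1 + N * m%:R) `^ (- r) - (1 + N * m.+1%:R) `^ (- r)).
  rewrite ler_pdivlMl ?mulr_gt0//; apply: le_trans (powR_tangent (pos m) (pos m.+1)).
  by rewrite -natr1 le_eqVlt; apply/orP; left; apply/eqP; ring.
apply: (@le_trans _ _ (\sum_(m < K) (r * N)^-1 *
    ((1 + N * m%:R) `^ (- r) - (1 + N * m.+1%:R) `^ (- r)))).
  by apply: ler_sum.
rewrite -mulr_sumr ler_piMr ?invr_ge0 ?mulr_ge0 ?(ltW r0) ?(ltW N0)//.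
rewrite -(big_mkord xpredT (fun m => (1 + N * m%:R) `^ (- r) - (1 + N * m.+1%:R) `^ (- r))).
under eq_bigr do rewrite -opprB.
rewrite sumrN telescope_sumr// opprB mulr0 addr0 powR1 lerBlDr lerDl powR_ge0//.
Qed.

Definition weight_ks (K : nat) : seq int :=
  0 :: [seq (Posz m.+1) | m <- iota 0 K] ++ [seq - (Posz m.+1) | m <- iota 0 K].

(** Used with [pi * N] for [N]: for [k != 0], points of the window of half-width [pi * N] around
    [2 * pi * N * k] satisfy [|t| >= pi * N * (2 * |k| - 1) >= pi * N * |k|], so this value bounds
    the weight there. *)
Definition weight_v N (k : int) : R := (1 + (N * k%:~R) ^+ 2) `^ (- sg).

(** The inequality [(1 + y)^2 <= 2 * (1 + y^2)] makes the terms telescope at the cost of [2^sg]; the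
    other factor 2 counts the two signs of [k]. *)
Lemma weight_v_sum N (K : nat) : 0 < N ->
  \sum_(k <- weight_ks K) weight_v N k <= 1 + 2 * 2 `^ sg / r / N.
Proof.
move=> N0; rewrite /weight_ks big_cons big_cat !big_map/=.
have -> : weight_v N 0 = 1 by rewrite /weight_v mulr0 expr0n addr0 powR1.
have v_le m : weight_v N (Posz m.+1) <= 2 `^ sg * (1 + N * m.+1%:R) `^ (- (2 * sg)).
  rewrite /weight_v -[_%:~R]/(m.+1%:R); set y := N * _.
  have y0 : 0 <= y by rewrite mulr_ge0// ltW.
  have -> : 2 `^ sg * (1 + y) `^ (- (2 * sg)) = ((1 + y) ^+ 2 / 2) `^ (- sg).
    rewrite powRM ?invr_ge0 ?sqr_ge0// mulrC; congr (_ * _).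
      by rewrite -mulrN powRrM powR_mulrn// addr_ge0.
    by rewrite -[2^-1]powR_inv1// -powRrM mulN1r opprK.
  apply: ler_powRN; first by rewrite divr_gt0// exprn_gt0// ltr_pwDl.
  by rewrite ler_pdivrMr//; have := sqr_ge0 (1 - y); nra.
have vN k : weight_v N (- k) = weight_v N k.
  by rewrite /weight_v mulrNz mulrN sqrrN.
under [X in _ + (_ + X)]eq_bigr do rewrite vN.
rewrite lerD2l; set S := bigop _ _ _.
have S_le : S <= 2 `^ sg * (r * N)^-1.
  apply: (@le_trans _ _ (\sum_(m <- iota 0 K) 2 `^ sg * (1 + N * m.+1%:R) `^ (- (2 * sg)))).
    by apply: ler_sum.
  rewrite -mulr_sumr ler_wpM2l ?powR_ge0//.
  have := sum_powR_telescope K N0; rewrite -(big_mkord xpredT (fun m => (1 + N * m.+1%:R) `^ (- (2 * sg)))).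
  by rewrite /index_iota subn0.
have -> : 2 * 2 `^ sg / r / N = 2 `^ sg * (r * N)^-1 + 2 `^ sg * (r * N)^-1.
  by field; rewrite !gt_eqF.
exact: lerD.
Qed.

Lemma mem_weight_ks (K : nat) (k : int) : (`|k| <= K)%N -> k \in weight_ks K.
Proof.
case: k => [[|m]|m] kK; rewrite /weight_ks inE//= mem_cat; apply/orP.
  by left; apply/mapP; exists m => //; rewrite mem_iota.
by right; apply/mapP; exists m; rewrite ?mem_iota// NegzE.
Qed.

Lemma weight_v_ge0 N k : 0 <= weight_v N k. Proof. exact: powR_ge0. Qed.

Lemma weight_le_comb N (K : nat) t : 0 < N -> `|t| <= 2 * K%:R * (pi * N) ->
  (1 + t ^+ 2) `^ (- sg) <= comb N (weight_ks K) (weight_v (pi * N)) t.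
Proof.
move=> N0 tK; have pN : 0 < pi * N by rewrite mulr_gt0 ?pi_gt0.
(* Rounding to the nearest integer selects the window that contains [t]. *)
pose k := Num.floor (t / (2 * (pi * N)) + 1 / 2).
have /andP[] := floor_itv (t / (2 * (pi * N)) + 1 / 2); rewrite -/k intrD => k1 k2.
pose x := t / (2 * (pi * N)).
have tE : t = x * (2 * (pi * N)) by rewrite /x divfK// gt_eqF// mulr_gt0.
rewrite -/x in k1 k2.
have pN2 : 0 < 2 * (pi * N) by rewrite mulr_gt0.
have kx : `|x - k%:~R| <= 1 / 2 by rewrite ler_norml; apply/andP; split; lra.
have tk : `|t - 2 * pi * N * k%:~R| <= pi * N.
  have -> : t - 2 * pi * N * k%:~R = (x - k%:~R) * (2 * (pi * N)) by rewrite tE; ring.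
  rewrite normrM (gtr0_norm pN2); apply: le_trans (ler_wpM2r (ltW pN2) kx) _.
  lra.
have kle : 2 * `|k%:~R : R| - 1 <= 2 * `|x|.
  have := ler_normD (k%:~R - x) x; rewrite subrK distrC; lra.
have absx : `|t| = `|x| * (2 * (pi * N)) by rewrite {1}tE normrM (gtr0_norm pN2).
have kK : (`|k| <= K)%N.
  have : `|x| <= K%:R.
    by rewrite -(ler_pM2r pN2) -absx (le_trans tK)// le_eqVlt; apply/orP; left; apply/eqP; ring.
  (* Rounding only gives [|k| <= K + 1 / 2]; integrality recovers [|k| <= K]. *)
  move=> xK; have : `|k%:~R : R| < (K.+1)%:R by rewrite -natr1; lra.
  by rewrite -intr_norm -natr_absz ltr_nat ltnS.
have v_le : (1 + t ^+ 2) `^ (- sg) <= weight_v (pi * N) k.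
  apply: ler_powRN; first by rewrite ltr_pwDl// sqr_ge0.
  rewrite lerD2l -[leRHS]real_normK ?num_real// -[leLHS]real_normK ?num_real//.
  rewrite lerXn2r ?nnegrE// normrM (gtr0_norm pN) absx.
  have [->|k0] := eqVneq k 0.
    rewrite mulr0z normr0 mulr0; apply: mulr_ge0 => //.
    by apply: mulr_ge0 => //; exact: ltW.
  have : 1 <= `|k%:~R : R|.
    by rewrite -intr_norm -natr_absz ler1n absz_gt0.
  move=> y1; have : `|k%:~R : R| <= 2 * `|x| by lra.
  move/(ler_wpM2l (ltW pN)) => H; apply: (le_trans H); rewrite le_eqVlt; apply/orP; left; apply/eqP; ring.
(* Adjacent windows share end points, which is harmless: the other terms are nonnegative and a lower
   bound is wanted. *)
apply: (le_trans v_le); rewrite /comb (big_rem k) ?mem_weight_ks//=.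
rewrite {1}/window tk mulr1 lerDl sumr_ge0// => l _.
by rewrite mulr_ge0 ?weight_v_ge0 ?window_ge0.
Qed.

Lemma comb_ge0 N ks (v : int -> R) t : (forall k, 0 <= v k) -> 0 <= comb N ks v t.
Proof. by move=> v0; apply: sumr_ge0 => k _; rewrite mulr_ge0 ?window_ge0. Qed.

End weight_1d.

(** * The weight in several variables *)

Section weight_rV.
Variables (R : realType) (d : nat) (s : R).
Hypotheses (d1 : (1 <= d)%N) (s_gt : d%:R / 2 < s).
Local Notation V := 'rV[R]_d.
Local Notation mu := (lebesgue_rV R d).
Local Notation nc := (@Normc.normc R).
Local Notation rc := (real_complex R).
Implicit Types (xi : V) (N : R).

Let sg : R := s / d%:R.

Let dR0 : 0 < d%:R :> R. Proof. by rewrite ltr0n. Qed.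

Let sg_gt : 1 / 2 < sg.
Proof. by rewrite /sg ltr_pdivlMr// mulrAC mul1r. Qed.

Definition weight_cst : R := 2 * 2 `^ sg / (2 * sg - 1).

Lemma weight_cst_ge0 : 0 <= weight_cst.
Proof. by rewrite !mulr_ge0 ?powR_ge0 ?invr_ge0//; move: sg_gt; lra. Qed.

Lemma weight_prod_le xi :
  (1 + sqnorm xi) `^ (- s) <= \prod_(j < d) (1 + xi 0 j ^+ 2) `^ (- sg).
Proof.
have S0 := sqnorm_ge0 xi.
have -> : (1 + sqnorm xi) `^ (- s) = \prod_(j < d) (1 + sqnorm xi) `^ (- sg).
  rewrite prodr_const card_ord -powR_mulrn ?powR_ge0// -powRrM mulNr.
  by rewrite /sg divfK// gt_eqF.
apply: ler_prod => j _; rewrite powR_ge0/=.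
apply: (ler_powRN sg_gt); first by rewrite ltr_pwDl// sqr_ge0.
by rewrite lerD2l sqr_coord_le_sqnorm.
Qed.

(** With finitely many windows per axis the step function dominates the weight only on a bounded
    region; this is the indicator of such a region, increasing to 1 with [K]. *)
Definition big_box N (K : nat) xi : R :=
  \prod_(j < d) window 0 (2 * K%:R * (pi * N)) (xi 0 j).

Lemma measurable_big_box N K : measurable_fun setT (big_box N K).
Proof.
apply: (@measurable_prod _ V _ _ _ _ (fun j xi => window 0 (2 * K%:R * (pi * N)) (xi 0 j))) => j _.
exact: (measurableT_comp (@measurable_window R 0 _) (measurable_coord j)).
Qed.

Lemma big_box_ge0 N K xi : 0 <= big_box N K xi.
Proof. by apply: prodr_ge0 => j _; exact: window_ge0. Qed.

Lemma big_box_weight_le N K xi : 0 < N ->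
  big_box N K xi * (1 + sqnorm xi) `^ (- s) <=
  combd N (weight_ks K) (weight_v sg (pi * N)) xi.
Proof.
move=> N0; apply: (le_trans (ler_wpM2l (big_box_ge0 _ _ _) (weight_prod_le xi))).
rewrite /big_box -big_split; apply: ler_prod => j _.
rewrite mulr_ge0 ?window_ge0 ?powR_ge0//= /window subr0.
have [H|_] := boolP (`|xi 0 j| <= 2 * K%:R * (pi * N)).
  by rewrite mul1r; exact: weight_le_comb.
by rewrite mul0r; apply: comb_ge0 => k; exact: weight_v_ge0.
Qed.

Lemma cvg_big_box N xi : 0 < N -> big_box N K xi @[K --> \oo] --> (1 : R).
Proof.
move=> N0; apply: cvg_near_cst; exists (Num.truncn (\sum_(j < d) `|xi 0 j| / (pi * N))).+1 => //.
move=> K /= hK; rewrite /big_box big1// => j _.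
have pN : 0 < pi * N by rewrite mulr_gt0 ?pi_gt0.
rewrite /window subr0; suff -> : `|xi 0 j| <= 2 * K%:R * (pi * N) by [].
have h1 : `|xi 0 j| / (pi * N) <= \sum_(j < d) `|xi 0 j| / (pi * N).
  rewrite (bigD1 j)//= lerDl sumr_ge0// => i _.
  by rewrite divr_ge0// ltW.
have h2 : `|xi 0 j| / (pi * N) <= K%:R.
  apply: (le_trans h1); apply: (le_trans (ltW (truncnS_gt _))).
  by rewrite ler_nat.
rewrite -ler_pdivrMr//; apply: (le_trans h2); rewrite ler_peMl//.
by rewrite (ler_nat _ 1 2).
Qed.

Lemma measurable_weight (q : R) : measurable_fun setT (fun xi => (1 + sqnorm xi) `^ q).
Proof.
apply: (measurableT_comp (measurable_powR q)).
by apply: measurable_funD => //; exact: measurable_sqnorm.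
Qed.

Lemma cmfun_trigpoly N (J : seq 'rV[int]_d) (a : 'rV[int]_d -> R[i]) :
  cmfun (fun xi => trigpoly N J a xi).
Proof.
apply: (@cmfun_sum _ _ _ _ _ (fun n xi => a n * expi (dotp (sample_point N n) xi))) => n.
apply: cmfunM; first exact: cmfun_cst.
by apply: cmfun_expi; exact: measurable_dotp.
Qed.

(** Bounds [comb_weight ^+ d] for every [K]: on one axis the steps sum to at most
    [1 + weight_cst / (pi * N)], and [1 / pi <= 1]. *)
Definition weight_bound N : R := (2 * pi * (N + weight_cst)) ^+ d.

(** On each box the weight is replaced by the step function, for which orthogonality gives a bound
    independent of the box; Fatou lets the box grow. *)
Lemma weighted_trigpoly N (J : seq 'rV[int]_d) (a : 'rV[int]_d -> R[i]) :
  0 < N -> uniq J ->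
  mu.-integrable setT (fun xi => (nc (trigpoly N J a xi) ^+ 2 * (1 + sqnorm xi) `^ (- s))%:E) /\
  \int[mu]_xi (nc (trigpoly N J a xi) ^+ 2 * (1 + sqnorm xi) `^ (- s)) <=
    weight_bound N * \sum_(n <- J) nc (a n) ^+ 2.
Proof.
move=> N0 uJ; set B := weight_bound N * _; set F := fun xi => nc _ ^+ 2 * _.
have mA : measurable_fun setT (fun xi => nc (trigpoly N J a xi) ^+ 2).
  by apply: measurable_funX; apply: measurable_normc; exact: cmfun_trigpoly.
have mF : measurable_fun setT F by apply: measurable_funM => //; exact: measurable_weight.
have F0 xi : 0 <= F xi by rewrite mulr_ge0 ?sqr_ge0 ?powR_ge0.
have main : (\int[mu]_xi (F xi)%:E <= B%:E)%E.
  apply: (@fatou_bound _ _ _ _ (fun K xi => F xi * big_box N K xi)).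
  - by move=> K; apply: measurable_funM => //; exact: measurable_big_box.
  - by move=> K xi; rewrite mulr_ge0 ?big_box_ge0.
  - move=> xi; rewrite -[X in _ --> X]mulr1; apply: cvgM; first exact: cvg_cst.
    exact: cvg_big_box.
  - move=> K; set v := weight_v sg (pi * N).
    have [i1 I1] := Rintegral_sqr_trigpoly N0 (weight_ks K) v a uJ.
    apply: (@le_trans _ _ (\int[mu]_xi (nc (trigpoly N J a xi) ^+ 2 *
        combd N (weight_ks K) v xi)%:E)%E).
      apply: ge0_le_integral => //.
      + by move=> xi _; rewrite lee_fin mulr_ge0 ?big_box_ge0.
      + apply/measurable_EFinP; apply: measurable_funM => //; exact: measurable_big_box.
      + exact: measurable_int i1.
      + move=> xi _; rewrite lee_fin /F -mulrA ler_wpM2l ?sqr_ge0// mulrC.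
        exact: big_box_weight_le.
    rewrite -[leLHS]fineK; last exact: integrable_fin_num.
    rewrite lee_fin; move: I1; rewrite /Rintegral => ->.
    rewrite /B ler_wpM2r//; first by apply: sumr_ge0 => n _; exact: sqr_ge0.
    have pN : 0 < pi * N by apply: mulr_gt0 => //; exact: pi_gt0.
    have pi2 : 0 <= 2 * pi :> R by apply: mulr_ge0 => //; exact: pi_ge0.
    rewrite /weight_bound lerXn2r// ?nnegrE.
    - rewrite /comb_weight; apply: mulr_ge0; last by apply: sumr_ge0 => k _; exact: weight_v_ge0.
      by apply: mulr_ge0 => //; exact: ltW.
    - by apply: mulr_ge0 => //; apply: addr_ge0; [exact: ltW|exact: weight_cst_ge0].
    rewrite /comb_weight -[leLHS]mulrA ler_wpM2l//.
    have := weight_v_sum sg_gt K pN; rewrite -/weight_cst => H.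
    apply: (le_trans (ler_wpM2l (ltW N0) H)); rewrite mulrDr mulr1 lerD2l.
    rewrite mulrCA -[leRHS]mulr1 ler_wpM2l ?weight_cst_ge0//.
    by rewrite invfM mulrCA mulfV ?gt_eqF// mulr1 invf_le1 ?pi_gt0// (le_trans _ (pi_ge2 R))// (ler_nat _ 1 2).
have iF : mu.-integrable setT (fun xi => (F xi)%:E).
  by apply: ge0_integrable => //; exact: le_lt_trans main (ltry B).
split=> //; rewrite -lee_fin /Rintegral fineK//; exact: integrable_fin_num.
Qed.

(** The case of the constant polynomial 1, at [N = 1]. *)
Lemma integrable_weight :
  mu.-integrable setT (fun xi => ((1 + sqnorm xi) `^ (- s))%:E).
Proof.
have := (weighted_trigpoly (fun=> 1) ltr01 (isT : uniq [:: 0 : 'rV[int]_d])).1.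
apply: eq_integrable => // xi _.
by rewrite /trigpoly big_seq1 mul1r normc_expi expr1n mul1r.
Qed.

End weight_rV.

(** * Inverse transforms of functions of finite Bessel energy *)

Section spectral.
Variables (R : realType) (d : nat) (s : R).
Hypotheses (d1 : (1 <= d)%N) (s_gt : d%:R / 2 < s).
Local Notation V := 'rV[R]_d.
Local Notation mu := (lebesgue_rV R d).
Local Notation nc := (@Normc.normc R).
Local Notation rc := (real_complex R).
Implicit Types (xi x : V) (N : R).
Variable g : V -> R[i].
Hypothesis mg : cmfun g.
Hypothesis ig : mu.-integrable setT (fun xi => ((1 + sqnorm xi) `^ s * nc (g xi) ^+ 2)%:E).
Let q : R := (Num.sqrt (2 * pi) ^+ d)^-1.

Let w1 xi : 1 <= 1 + sqnorm xi. Proof. by rewrite lerDl sqnorm_ge0. Qed.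

Let w0 xi : 0 < 1 + sqnorm xi. Proof. exact: lt_le_trans (w1 xi). Qed.

Let s0 : 0 < s. Proof. by apply: le_lt_trans s_gt; rewrite divr_ge0. Qed.

Let ws1 xi : 1 <= (1 + sqnorm xi) `^ s.
Proof. by rewrite -[leLHS](powRr0 (1 + sqnorm xi)); apply: ler_powR => //; exact: ltW. Qed.

Let half_weight (t : R) xi : ((1 + sqnorm xi) `^ (t / 2)) ^+ 2 = (1 + sqnorm xi) `^ t.
Proof. by rewrite -powR_mulrn ?powR_ge0// -powRrM divfK. Qed.

Let half_weightK xi : (1 + sqnorm xi) `^ (- s / 2) * (1 + sqnorm xi) `^ (s / 2) = 1.
Proof.
rewrite -powRD; last by apply/implyP => _; rewrite gt_eqF.
by rewrite mulNr addNr powRr0.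
Qed.

Let m_half (t : R) (h : V -> R) : measurable_fun setT h ->
  measurable_fun setT (fun xi => h xi * (1 + sqnorm xi) `^ t).
Proof. by move=> mh; apply: measurable_funM => //; exact: measurable_weight. Qed.

Let i_half : mu.-integrable setT (fun xi => ((nc (g xi) * (1 + sqnorm xi) `^ (s / 2)) ^+ 2)%:E).
Proof. by move: ig; under eq_fun do rewrite -half_weight mulrC -exprMn. Qed.

(** Cauchy-Schwarz, with [(1 + |xi|^2)^(-s/2)] square integrable because [s > d / 2]. It makes the
    samples absolutely convergent integrals. *)
Lemma sobolev_cintble : cintble mu g.
Proof.
have iw : mu.-integrable setT (fun xi => (((1 + sqnorm xi) `^ (- s / 2)) ^+ 2)%:E).
  by under eq_fun do rewrite half_weight; exact: integrable_weight.
have := integrable_prod_sqr (@measurable_weight R d (- s / 2)) (m_half (s / 2) (measurable_normc mg)) iw i_half.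
under eq_fun do rewrite mulrCA half_weightK mulr1.
by move=> H; apply: le_cintble H.
Qed.

Lemma sobolev_sqr_integrable : mu.-integrable setT (fun xi => (nc (g xi) ^+ 2)%:E).
Proof.
apply: le_integrable ig => //.
  by apply/measurable_EFinP; apply: measurable_funX; exact: measurable_normc.
move=> xi _ /=; rewrite lee_fin [leLHS]ger0_norm ?sqr_ge0//.
rewrite [leRHS]ger0_norm; first by rewrite ler_peMl ?sqr_ge0.
by rewrite mulr_ge0 ?powR_ge0 ?sqr_ge0.
Qed.

Lemma sobolev_sqr_le :
  \int[mu]_xi nc (g xi) ^+ 2 <= \int[mu]_xi ((1 + sqnorm xi) `^ s * nc (g xi) ^+ 2).
Proof.
apply: le_Rintegral => //; first exact: sobolev_sqr_integrable.
by move=> xi _; rewrite ler_peMl ?sqr_ge0.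
Qed.

Let i_expg x := cintble_expi x sobolev_cintble.

Lemma sum_inverse_fourier N (J : seq 'rV[int]_d) (a : 'rV[int]_d -> R[i]) :
  cintble mu (fun xi => trigpoly N J a xi * g xi) /\
  \sum_(n <- J) a n * inverse_fourier g (sample_point N n) =
    rc q * cint mu (fun xi => trigpoly N J a xi * g xi).
Proof.
have E xi : trigpoly N J a xi * g xi =
    \sum_(n <- J) a n * (expi (dotp (sample_point N n) xi) * g xi).
  by rewrite /trigpoly mulr_suml; apply: eq_bigr => n _; rewrite mulrA.
have iE n : cintble mu (fun xi => a n * (expi (dotp (sample_point N n) xi) * g xi)).
  by apply: cintbleZ; exact: i_expg.
split; first by under eq_fun do rewrite E; exact: cintble_sum.
rewrite (eq_cint _ E) cint_sum// mulr_sumr; apply: eq_bigr => n _.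
rewrite cintZ; last exact: i_expg.
by rewrite mulrCA.
Qed.

(* By duality: pairing the samples of the transform of [g] with themselves
   tests [g] against a trigonometric polynomial. *)
Lemma sampling_bound N (J : seq 'rV[int]_d) : 0 < N -> uniq J ->
  \sum_(n <- J) nc (inverse_fourier g (sample_point N n)) ^+ 2 <=
    (N + weight_cst d s) ^+ d * \int[mu]_xi ((1 + sqnorm xi) `^ s * nc (g xi) ^+ 2).
Proof.
move=> N0 uJ; set X := \sum_(n <- J) _; set E := Rintegral _ _ _.
pose a n := conjc (inverse_fourier g (sample_point N n)).
have [iA XE] := sum_inverse_fourier N J a.
have q0 : 0 < q by rewrite invr_gt0 exprn_gt0// sqrt2pi_gt0.
have {}XE : rc X = rc q * cint mu (fun xi => trigpoly N J a xi * g xi).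
  rewrite -XE real_complex_sum; apply: eq_bigr => n _.
  by rewrite /a mulrC mulc_conj.
have X0 : 0 <= X by apply: sumr_ge0 => n _; exact: sqr_ge0.
have E0 : 0 <= E by apply: Rintegral_ge0 => xi _; rewrite mulr_ge0 ?powR_ge0 ?sqr_ge0.
pose A xi := nc (trigpoly N J a xi) * (1 + sqnorm xi) `^ (- s / 2).
pose B xi := nc (g xi) * (1 + sqnorm xi) `^ (s / 2).
have mA : measurable_fun setT A.
  by apply: m_half; apply: measurable_normc; exact: cmfun_trigpoly.
have mB : measurable_fun setT B by apply: m_half; exact: measurable_normc.
have [iA2 A2] := weighted_trigpoly d1 s_gt a N0 uJ.
have A2E xi : nc (trigpoly N J a xi) ^+ 2 * (1 + sqnorm xi) `^ (- s) = A xi ^+ 2.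
  by rewrite /A exprMn half_weight.
have {}iA2 : mu.-integrable setT (fun xi => (A xi ^+ 2)%:E).
  by move: iA2; under eq_fun do rewrite A2E.
have {}A2 : \int[mu]_xi A xi ^+ 2 <= weight_bound d s N * X.
  move: A2; under eq_Rintegral do rewrite A2E.
  by rewrite (_ : \sum_(n <- J) nc (a n) ^+ 2 = X)//; apply: eq_bigr => n _; rewrite normc_conj.
have B2 : \int[mu]_xi B xi ^+ 2 = E.
  by apply: eq_Rintegral => xi _; rewrite /B exprMn half_weight mulrC.
have XAB : X <= q * \int[mu]_xi (A xi * B xi).
  have -> : X = nc (rc X) by rewrite normc_real ger0_norm.
  rewrite XE Normc.normcM normc_real (gtr0_norm q0) ler_pM2l//.
  apply: (le_trans (normc_cint_le iA)); rewrite le_eqVlt; apply/orP; left; apply/eqP.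
  apply: eq_Rintegral => xi _; rewrite /A /B Normc.normcM.
  by rewrite mulrACA half_weightK mulr1.
have CS := cauchy_schwarz_sqr mA mB iA2 i_half.
have W0 : 0 <= weight_bound d s N.
  apply: exprn_ge0; apply: mulr_ge0; first by apply: mulr_ge0 => //; exact: pi_ge0.
  by apply: addr_ge0; [exact: ltW|exact: weight_cst_ge0].
(* [X] recurs on the right because the coefficients [a] are the conjugate samples; one factor is
   cancelled at the end, with [X = 0] treated apart. *)
have X2 : X ^+ 2 <= q ^+ 2 * (weight_bound d s N * X * E).
  apply: (@le_trans _ _ ((q * \int[mu]_xi (A xi * B xi)) ^+ 2)).
    have X1 := le_trans X0 XAB.
    by apply: lerXn2r XAB; rewrite nnegrE; [exact: X0|exact: X1].
  rewrite exprMn ler_wpM2l ?sqr_ge0//; apply: (le_trans CS).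
  by rewrite -/B B2 ler_wpM2r.
have qE : q ^+ 2 * weight_bound d s N = (N + weight_cst d s) ^+ d.
  rewrite /weight_bound [in LHS]exprMn mulrA /q exprVn -exprM mulnC exprM sqr_sqrtr; last first.
    by apply: mulr_ge0 => //; exact: pi_ge0.
  by rewrite mulVf ?mul1r// expf_neq0// mulf_neq0 ?gt_eqF ?pi_gt0.
move: X0; rewrite le_eqVlt => /predU1P[<-|X0].
  by rewrite -qE; apply: mulr_ge0 => //; apply: mulr_ge0 => //; exact: sqr_ge0.
by rewrite -(ler_pM2r X0) -expr2 (le_trans X2)// -qE !mulrA mulrAC.
Qed.

(** The error pairs [g] with [exp_remainder], whose square integral over the cube is known exactly;
    Cauchy-Schwarz concludes. The factor [N^d] is [(2 pi)^(-d) * (2 pi N)^d]. *)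
Lemma band_limited_error N (J : seq 'rV[int]_d) x : 0 < N -> uniq J ->
  (forall xi, g xi = g xi * rc (boxw N xi)) ->
  nc (inverse_fourier g x -
      \sum_(n <- J) inverse_fourier g (sample_point N n) * rc (cardinal_fun N n x)) ^+ 2 <=
  N ^+ d * (1 - \sum_(n <- J) cardinal_fun N n x ^+ 2) * \int[mu]_xi nc (g xi) ^+ 2.
Proof.
move=> N0 uJ gb; have q0 : 0 < q by rewrite invr_gt0 exprn_gt0// sqrt2pi_gt0.
have [iT ET] := sum_inverse_fourier N J (fun n => rc (cardinal_fun N n x)).
have -> : inverse_fourier g x -
      \sum_(n <- J) inverse_fourier g (sample_point N n) * rc (cardinal_fun N n x) =
    rc q * cint mu (fun xi => exp_remainder N J x xi * g xi).
  rewrite (eq_bigr (fun n => rc (cardinal_fun N n x) * inverse_fourier g (sample_point N n))); last first.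
    by move=> n _; rewrite mulrC.
  rewrite ET /inverse_fourier -/q -mulrBr -cintB//.
  by congr (_ * _); apply: eq_cint => xi; rewrite /exp_remainder mulrBl.
have iR : cintble mu (fun xi => exp_remainder N J x xi * g xi).
  rewrite (_ : (fun xi => _) = (fun xi => expi (dotp x xi) * g xi -
      trigpoly N J (fun n => rc (cardinal_fun N n x)) xi * g xi)); first exact: cintbleB.
  by apply/funext => xi; rewrite /exp_remainder mulrBl.
pose A xi := nc (exp_remainder N J x xi) * boxw N xi.
have b0 xi : 0 <= boxw N xi by rewrite -boxw_sqr sqr_ge0.
have [iA A2] := Rintegral_exp_remainder N0 x uJ.
have AE xi : nc (exp_remainder N J x xi) ^+ 2 * boxw N xi = A xi ^+ 2.
  by rewrite /A exprMn boxw_sqr.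
have {}iA : mu.-integrable setT (fun xi => (A xi ^+ 2)%:E).
  by move: iA; under eq_fun do rewrite AE.
have {}A2 : \int[mu]_xi A xi ^+ 2 = (2 * pi * N) ^+ d * (1 - \sum_(n <- J) cardinal_fun N n x ^+ 2).
  by rewrite -A2; apply: eq_Rintegral => xi _; rewrite AE.
have mA : measurable_fun setT A.
  apply: measurable_funM.
    apply: measurable_normc; apply: cmfunB; last exact: cmfun_trigpoly.
    by apply: cmfun_expi; exact: measurable_dotp.
  exact: measurable_boxw.
have CS := cauchy_schwarz_sqr mA (measurable_normc mg) iA sobolev_sqr_integrable.
rewrite Normc.normcM exprMn normc_real (gtr0_norm q0).
apply: (@le_trans _ _ (q ^+ 2 * (\int[mu]_xi (A xi * nc (g xi))) ^+ 2)).
  rewrite ler_wpM2l ?sqr_ge0// lerXn2r ?nnegrE ?normc_ge0//.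
    by apply: Rintegral_ge0 => xi _; rewrite !mulr_ge0 ?normc_ge0.
  apply: (le_trans (normc_cint_le iR)); rewrite le_eqVlt; apply/orP; left; apply/eqP.
  apply: eq_Rintegral => xi _; rewrite Normc.normcM /A -mulrA; congr (_ * _).
  by rewrite {1}gb Normc.normcM normc_real ger0_norm// mulrC.
apply: (le_trans (ler_wpM2l (sqr_ge0 q) CS)); rewrite A2 !mulrA ler_wpM2r//.
  by apply: Rintegral_ge0 => xi _; exact: sqr_ge0.
rewrite [in leLHS]exprMn !mulrA /q exprVn -exprM mulnC exprM sqr_sqrtr; last first.
  by apply: mulr_ge0 => //; exact: pi_ge0.
by rewrite mulVf ?mul1r// expf_neq0// mulf_neq0 ?gt_eqF ?pi_gt0.
Qed.

End spectral.

(** * Cardinal series *)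

Section cardinal_sums.
Variables (R : realType) (d : nat) (N : R).
Hypothesis N0 : 0 < N.
Local Notation V := 'rV[R]_d.
Local Notation mu := (lebesgue_rV R d).
Local Notation nc := (@Normc.normc R).
Local Notation rc := (real_complex R).
Local Notation card := (@cardinal_fun R d N).
Implicit Types (b : 'rV[int]_d -> R[i]) (J : seq 'rV[int]_d).

Definition cardinal_sum b J (x : V) : R[i] := \sum_(n <- J) b n * rc (card n x).

(** The arithmetic-geometric inequality termwise, then Bessel's inequality. Square-summable
    coefficients thus give absolute convergence at every point. *)
Lemma normc_cardinal_sum_le b J x : uniq J ->
  \sum_(n <- J) nc (b n * rc (card n x)) <= (\sum_(n <- J) nc (b n) ^+ 2 + 1) / 2.
Proof.
move=> uJ; have := bessel_cardinal N0 x uJ => B.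
apply: (@le_trans _ _ ((\sum_(n <- J) nc (b n) ^+ 2 + \sum_(n <- J) card n x ^+ 2) / 2)); last first.
  by rewrite ler_pM2r// lerD2l.
rewrite -big_split mulr_suml; apply: ler_sum => n _.
rewrite Normc.normcM normc_real -(real_normK (num_real (card n x))) /=.
by have := sqr_ge0 (nc (b n) - `|card n x|); lra.
Qed.

(** The function supported in the cube whose inverse transform is [cardinal_sum b J]. The double
    conjugation writes [sum b_n e^(- i n.xi / N)] through [trigpoly], to which the orthogonality
    statements apply. *)
Definition cardinal_spectrum b J (xi : V) : R[i] :=
  rc ((Num.sqrt (2 * pi) ^+ d)^-1 * (2 * pi * N) ^+ d)^-1 *
  (conjc (trigpoly N J (fun n => conjc (b n)) xi) * rc (boxw N xi)).

Lemma inverse_fourier_cardinal_spectrum b J :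
  cintble mu (cardinal_spectrum b J) /\
  inverse_fourier (cardinal_spectrum b J) = cardinal_sum b J.
Proof.
pose P : R := (2 * pi * N) ^+ d; pose q : R := (Num.sqrt (2 * pi) ^+ d)^-1.
have q0 : 0 < q by rewrite invr_gt0 exprn_gt0// sqrt2pi_gt0.
have P0 : 0 < P by rewrite exprn_gt0// !mulr_gt0// pi_gt0.
pose X x n xi := b n * (expi (dotp x xi - dotp (sample_point N n) xi) * rc (boxw N xi)).
have iX x n : cintble mu (X x n) by apply: cintbleZ; exact: (cint_expi_box N0 x n).1.
have XE x xi : expi (dotp x xi) * cardinal_spectrum b J xi =
    rc (q * P)^-1 * \sum_(n <- J) X x n xi.
  rewrite /cardinal_spectrum -/q -/P /trigpoly conjc_sum mulrCA mulr_suml [X in _ * X]mulr_sumr.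
  congr (_ * _); apply: eq_bigr => n _; rewrite /X conjcM conjcK conjc_expi expiD.
  by ring.
split.
  have -> : cardinal_spectrum b J = (fun xi => rc (q * P)^-1 * \sum_(n <- J) X 0 n xi).
    apply/funext => xi; rewrite -XE (_ : dotp 0 xi = 0) ?expi0 ?mul1r//.
    by rewrite /dotp big1// => i _; rewrite mxE mul0r.
  by apply: cintbleZ; exact: cintble_sum.
apply/funext => x; rewrite /inverse_fourier -/q (eq_cint _ (XE x)) cintZ; last exact: cintble_sum.
rewrite cint_sum// mulrA -real_complexM mulr_sumr; apply: eq_bigr => n _.
rewrite cintZ; last exact: (cint_expi_box N0 x n).1.
rewrite (cint_expi_box N0 x n).2 mulrCA -real_complexM; congr (_ * rc _).
by rewrite -/P; field; rewrite !gt_eqF.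
Qed.

Lemma cmfun_cardinal_sum b J : cmfun (cardinal_sum b J).
Proof.
have [ih <-] := inverse_fourier_cardinal_spectrum b J.
exact: cmfun_inverse_fourier.
Qed.

(** Plancherel transports the question to the cube, where the exponentials are orthogonal; the
    normalisations combine to [N^(-d)]. *)
Lemma cardinal_sum_L2 b J : uniq J ->
  (\int[mu]_x (nc (cardinal_sum b J x) ^+ 2)%:E <=
    ((N ^+ d)^-1 * \sum_(n <- J) nc (b n) ^+ 2)%:E)%E.
Proof.
move=> uJ; pose P : R := (2 * pi * N) ^+ d.
pose q : R := (Num.sqrt (2 * pi) ^+ d)^-1; pose k := (q * P)^-1.
have q0 : 0 < q by rewrite invr_gt0 exprn_gt0// sqrt2pi_gt0.
have P0 : 0 < P by rewrite exprn_gt0// !mulr_gt0// pi_gt0.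
have [] := inverse_fourier_cardinal_spectrum b J.
set h := cardinal_spectrum b J => ih hE.
pose T xi := trigpoly N J (fun n => conjc (b n)) xi.
have h2 xi : nc (h xi) ^+ 2 = k ^+ 2 * (nc (T xi) ^+ 2 * boxw N xi).
  rewrite /h /cardinal_spectrum -/q -/P -/k !Normc.normcM normc_conj !normc_real.
  by rewrite !exprMn !real_normK ?num_real// boxw_sqr.
have [iT IT] := Rintegral_sqr_trigpoly_box N0 (fun n => conjc (b n)) uJ.
have ih2 : mu.-integrable setT (fun xi => (nc (h xi) ^+ 2)%:E).
  by under eq_fun do rewrite h2 EFinM; exact: integrableZl.
have := plancherel_le ih ih2; rewrite hE => H; apply: (le_trans H).
rewrite -[leLHS]fineK; last exact: integrable_fin_num.
rewrite lee_fin -/(Rintegral mu setT (fun x => nc (h x) ^+ 2)).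
under eq_Rintegral do rewrite h2.
rewrite RintegralZl// IT -/P.
rewrite (eq_bigr (fun n => nc (b n) ^+ 2)) => [|n _]; last by rewrite normc_conj.
rewrite mulrA le_eqVlt; apply/orP; left; apply/eqP; congr (_ * _).
rewrite /k; have -> : P = q ^- 2 * N ^+ d.
  rewrite /P exprMn /q -exprVn invrK -exprM mulnC exprM sqr_sqrtr//.
  by apply: mulr_ge0 => //; exact: pi_ge0.
have ND : 0 < N ^+ d by rewrite exprn_gt0.
by field; rewrite !gt_eqF.
Qed.

End cardinal_sums.

(** * Sums over a countable index set and complex limits *)

Section countable_sums.
Variables (R : realType) (I : countType).
Implicit Types (F : I -> R) (J : seq I).

(** Codes that represent no element are skipped, which leaves repetition-free lists increasing to
    the whole of [I]. *)
Definition first_terms (m : nat) : seq I := pmap (@pickle_inv I) (iota 0 m).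

Lemma first_terms_uniq m : uniq (first_terms m).
Proof. by apply: pmap_uniq; [exact: pickle_invK|exact: iota_uniq]. Qed.

Lemma mem_first_terms m i : (i \in first_terms m) = (choice.pickle i < m)%N.
Proof.
rewrite mem_pmap; apply/mapP/idP => [[k]|im].
  rewrite mem_iota add0n => /= km /esym ki.
  by have := @pickle_invK I k; rewrite ki /= => ->.
by exists (choice.pickle i); rewrite ?mem_iota// pickleK_inv.
Qed.

Lemma first_terms_exhaust J : exists m0, forall m, (m0 <= m)%N -> {subset J <= first_terms m}.
Proof.
exists (\max_(i <- J) (choice.pickle i).+1) => m hm i iJ; rewrite mem_first_terms.
by apply: leq_trans hm; exact: (@leq_bigmax_seq _ J xpredT (fun i => (choice.pickle i).+1) i iJ).
Qed.

Lemma sum_first_terms F m :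
  \sum_(i <- first_terms m) F i = series (fun k => oapp F 0 (pickle_inv k : option I)) m.
Proof.
rewrite /series /first_terms /= big_mkord -(big_mkord xpredT (fun k => oapp F 0 (pickle_inv k : option I))).
rewrite /index_iota subn0.
by elim: (iota 0 m) => [|k r IH]; rewrite ?big_nil//= big_cons -IH; case: pickle_inv => [i|] /=;
  rewrite ?big_cons ?add0r.
Qed.

Lemma sum_first_terms_cvg F (B : R) :
  (forall J, uniq J -> \sum_(i <- J) `|F i| <= B) ->
  cvgn (fun m => \sum_(i <- first_terms m) F i).
Proof.
move=> FB; rewrite (_ : (fun m => _) = series (fun k => oapp F 0 (pickle_inv k : option I))); last first.
  by apply/funext => m; exact: sum_first_terms.
apply: normed_cvg; apply: nondecreasing_is_cvgn.
  by apply: nondecreasing_series => k _ _; exact: normr_ge0.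
exists B => _ [m _ <-]; apply: le_trans (FB _ (first_terms_uniq m)).
rewrite (sum_first_terms (fun i => `|F i|)) /series /=.
by apply: ler_sum => k _; case: pickle_inv => //=; rewrite normr0.
Qed.

(** The limit of the partial sums along the enumeration bounds every finite sum; once a partial sum
    is within [e] of it, no disjoint set can add more than [e]. *)
Lemma sum_tail_small F (B e : R) : (forall i, 0 <= F i) ->
  (forall J, uniq J -> \sum_(i <- J) F i <= B) -> 0 < e ->
  exists m, forall J, uniq J -> {in J, forall i, i \notin first_terms m} ->
    \sum_(i <- J) F i <= e.
Proof.
move=> F0 FB e0; pose u m := \sum_(i <- first_terms m) F i.
have cu : cvgn u.
  by apply: (sum_first_terms_cvg (B := B)) => J uJ; under eq_bigr do rewrite ger0_norm//; exact: FB.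
have nu : {homo u : m n / (m <= n)%N >-> m <= n}.
  move=> m n mn; apply: ler_sum_uniq => //; [exact: first_terms_uniq..|].
  by move=> i; rewrite !mem_first_terms => /leq_trans; apply.
have /cvgrPdist_le /(_ _ e0) [m _ /(_ m (leqnn _)) /=] := cu.
rewrite ler_distl => /andP[_ hm]; exists m => J uJ Jm.
have ul : \sum_(i <- first_terms m ++ J) F i <= limn u.
  have [M hM] := first_terms_exhaust (first_terms m ++ J).
  apply: le_trans (nondecreasing_cvgn_le nu cu M).
  apply: ler_sum_uniq => //; [|exact: first_terms_uniq|exact: hM].
  rewrite cat_uniq first_terms_uniq uJ andbT /=.
  by apply/hasPn => i /Jm.
by move: ul hm; rewrite big_cat/= -/(u m); lra.
Qed.

End countable_sums.

Section complex_limits.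
Variable R : realType.
Local Notation nc := (@Normc.normc R).
Implicit Types (u v : nat -> R[i]) (k l : R[i]).

Definition ccvg u l : Prop :=
  (complex.Re (u n) @[n --> \oo] --> complex.Re l) /\
  (complex.Im (u n) @[n --> \oo] --> complex.Im l).

Lemma ccvgB u v k l : ccvg u k -> ccvg v l -> ccvg (fun n => u n - v n) (k - l).
Proof.
move=> [u1 u2] [v1 v2]; split.
  by under eq_fun do rewrite ReD ReN; rewrite ReD ReN; exact: cvgB.
by under eq_fun do rewrite ImD ImN; rewrite ImD ImN; exact: cvgB.
Qed.

Lemma ccvg_cst k : ccvg (fun=> k) k.
Proof. by split; exact: cvg_cst. Qed.

Lemma ccvg_shift M u l : ccvg u l -> ccvg (fun n => u (n + M)%N) l.
Proof.
move=> [u1 u2]; split.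
  by rewrite (cvg_shiftn M (fun n => complex.Re (u n))).
by rewrite (cvg_shiftn M (fun n => complex.Im (u n))).
Qed.

Lemma ccvg_normc_sqr u l : ccvg u l -> nc (u n) ^+ 2 @[n --> \oo] --> nc l ^+ 2.
Proof.
move=> [u1 u2]; under eq_fun do rewrite normcE2; rewrite normcE2 !expr2.
by apply: cvgD; apply: cvgM.
Qed.

Lemma ccvg_sqr_le0 u :
  (forall e : R, 0 < e -> exists m0, forall m, (m0 <= m)%N -> nc (u m) ^+ 2 <= e) -> ccvg u 0.
Proof.
move=> H; have K (p : R[i] -> R) : (forall z, `|p z| <= nc z) -> p (u n) @[n --> \oo] --> 0.
  move=> pn; apply/cvgrPdist_le => e e0.
  have [m0 hm] := H _ (exprn_gt0 2 e0); exists m0 => // m /= /hm.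
  rewrite sub0r normrN => h; apply: (le_trans (pn _)).
  by rewrite -(@ler_pXn2r _ 2) ?nnegrE ?normc_ge0 ?(ltW e0).
by split; apply: K => z; [exact: Re_le_normc|exact: Im_le_normc].
Qed.

End complex_limits.

(** * The sum of the cardinal series *)

Section cardinal_series.
Variables (R : realType) (d : nat) (N : R).
Hypothesis N0 : 0 < N.
Local Notation V := 'rV[R]_d.
Local Notation mu := (lebesgue_rV R d).
Local Notation nc := (@Normc.normc R).
Local Notation rc := (real_complex R).
Local Notation card := (@cardinal_fun R d N).
Local Notation terms := (first_terms 'rV[int]_d).
Variables (b : 'rV[int]_d -> R[i]) (B : R).
Hypothesis bB : forall J, uniq J -> \sum_(n <- J) nc (b n) ^+ 2 <= B.
Implicit Types (J K : seq 'rV[int]_d) (x : V).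

(** A pointwise limit along one enumeration. Both limits exist by [cardinal_series_cvg], so no
    default value of [limn] is involved; unconditional convergence in [L^2] is
    [cardinal_series_L2]. *)
Definition cardinal_series x : R[i] :=
  (limn (fun m => complex.Re (cardinal_sum N b (terms m) x)) +i*
   limn (fun m => complex.Im (cardinal_sum N b (terms m) x)))%C.

Lemma cardinal_series_cvg x :
  ccvg (fun m => cardinal_sum N b (terms m) x) (cardinal_series x).
Proof.
have H (p : R[i] -> R) J : (forall z, `|p z| <= nc z) -> uniq J ->
    \sum_(n <- J) `|p (b n * rc (card n x))| <= (B + 1) / 2.
  move=> pn uJ; apply: (@le_trans _ _ (\sum_(n <- J) nc (b n * rc (card n x)))).
    by apply: ler_sum.
  apply: (le_trans (normc_cardinal_sum_le N0 b x uJ)).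
  by rewrite ler_pM2r// lerD2r; exact: bB.
split=> /=.
  suff : cvgn (fun m => complex.Re (cardinal_sum N b (terms m) x)) by [].
  under eq_fun do rewrite /cardinal_sum Re_sum.
  by apply: (sum_first_terms_cvg (B := (B + 1) / 2)) => J; apply: H; exact: Re_le_normc.
suff : cvgn (fun m => complex.Im (cardinal_sum N b (terms m) x)) by [].
under eq_fun do rewrite /cardinal_sum Im_sum.
by apply: (sum_first_terms_cvg (B := (B + 1) / 2)) => J; apply: H; exact: Im_le_normc.
Qed.

Lemma cmfun_cardinal_series : cmfun cardinal_series.
Proof.
split.
  apply: (measurable_fun_cvg (h := fun m x => complex.Re (cardinal_sum N b (terms m) x))) => [m|x _].
    exact: (cmfun_cardinal_sum N0 b (terms m)).1.
  exact: (cardinal_series_cvg x).1.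
apply: (measurable_fun_cvg (h := fun m x => complex.Im (cardinal_sum N b (terms m) x))) => [m|x _].
  exact: (cmfun_cardinal_sum N0 b (terms m)).2.
exact: (cardinal_series_cvg x).2.
Qed.

Lemma cardinal_sum_subset J K x : uniq J -> uniq K -> {subset J <= K} ->
  cardinal_sum N b K x - cardinal_sum N b J x = cardinal_sum N b [seq n <- K | n \notin J] x.
Proof.
move=> uJ uK JK; rewrite /cardinal_sum big_filter (bigID (mem J) predT)/=.
rewrite -(big_filter K (mem J)) (perm_big J); first by rewrite addrAC subrr add0r.
apply: uniq_perm => //; first by rewrite filter_uniq.
move=> n; rewrite mem_filter; apply/andP/idP => [[]//|nJ].
by split=> //; exact: JK.
Qed.

Lemma cardinal_series_L2 (e : R) : 0 < e ->
  exists m, forall J, uniq J -> {subset terms m <= J} ->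
    (\int[mu]_x (nc (cardinal_series x - cardinal_sum N b J x) ^+ 2)%:E <= e%:E)%E.
Proof.
move=> e0; have ND : 0 < N ^+ d by rewrite exprn_gt0.
(* The tolerance [N^d * e] offsets the factor [N^(-d)] of [cardinal_sum_L2]. *)
have [m hm] := sum_tail_small (fun n => sqr_ge0 (nc (b n))) bB (mulr_gt0 ND e0).
(* From [M] on the enumeration contains [J], so the difference of the two sums runs over nodes
   outside [J], hence outside [terms m]. *)
exists m => J uJ mJ; have [M hM] := first_terms_exhaust J.
apply: (@fatou_bound _ _ _ _
    (fun k x => nc (cardinal_sum N b (terms (k + M)%N) x - cardinal_sum N b J x) ^+ 2)).
- move=> k; apply: measurable_funX; apply: measurable_normc.
  by apply: cmfunB; exact: cmfun_cardinal_sum.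
- by move=> k x; exact: sqr_ge0.
- move=> x; apply: ccvg_normc_sqr; apply: ccvgB; last exact: ccvg_cst.
  exact: (ccvg_shift M (cardinal_series_cvg x)).
- move=> k; pose K := [seq n <- terms (k + M)%N | n \notin J].
  have uK : uniq K by rewrite filter_uniq// first_terms_uniq.
  rewrite (eq_integral (fun x => (nc (cardinal_sum N b K x) ^+ 2)%:E)) => [|x _]; last first.
    rewrite (cardinal_sum_subset x uJ (first_terms_uniq _ _))//.
    by apply: hM; rewrite leq_addl.
  apply: (le_trans (cardinal_sum_L2 N0 b uK)); rewrite lee_fin ler_pdivrMl//.
  apply: hm => // n; rewrite mem_filter => /andP[nJ _].
  by apply: contra nJ => /mJ.
Qed.

End cardinal_series.

(** * The remainder of the sampling series *)

Section remainder.
Variables (R : realType) (d : nat) (s : R).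
Hypotheses (d1 : (1 <= d)%N) (s_gt : d%:R / 2 < s).
Local Notation V := 'rV[R]_d.
Local Notation mu := (lebesgue_rV R d).
Local Notation nc := (@Normc.normc R).
Local Notation rc := (real_complex R).
Local Notation sp := (@sample_point R d).
Local Notation terms := (first_terms 'rV[int]_d).
Local Notation weight := (fun xi : V => (1 + sqnorm xi) `^ s).
Variable N : R.
Hypothesis N0 : 0 < N.
Variable fhat : V -> R[i].
Hypothesis mf : cmfun fhat.
Hypothesis ifh : mu.-integrable setT (fun xi => (weight xi * nc (fhat xi) ^+ 2)%:E).
Let f := inverse_fourier fhat.
Let c := weight_cst d s.
(** The inverse transforms of [low] and [high] are the parts [G1] and [G2] of the overview; [E2] is
    the energy of [fhat] outside the cube. *)
Let low xi := fhat xi * rc (boxw N xi).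
Let high xi := fhat xi * rc (1 - boxw N xi).
Let E2 := \int[mu]_xi (weight xi * nc (high xi) ^+ 2).

Definition sampling_series : V -> R[i] := cardinal_series N (fun n => f (sp N n)).

Let c0 : 0 <= c. Proof. exact: weight_cst_ge0. Qed.

Let mbox := @measurable_boxw R d N.

Let box01 (xi : V) : boxw N xi = 0 \/ boxw N xi = 1.
Proof. by rewrite boxwE indicE; case: (_ \in _); [right|left]. Qed.

Let mlow : cmfun low. Proof. by apply: cmfunM => //; exact: cmfun_real. Qed.

Let mhigh : cmfun high.
Proof. by apply: cmfunM => //; apply: cmfun_real; exact: measurable_funB. Qed.

Let i_part (h : V -> R[i]) : cmfun h -> (forall xi, nc (h xi) <= nc (fhat xi)) ->
  mu.-integrable setT (fun xi => (weight xi * nc (h xi) ^+ 2)%:E).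
Proof.
move=> mh hf; apply: le_integrable ifh => //.
  apply/measurable_EFinP; apply: measurable_funM; first exact: measurable_weight.
  by apply: measurable_funX; exact: measurable_normc.
move=> xi _ /=; have w0 := powR_ge0 (1 + sqnorm xi) s.
rewrite lee_fin !normrM !(ger0_norm w0) ler_wpM2l// -!normrM -!expr2 !ger0_norm ?sqr_ge0//.
by rewrite lerXn2r ?nnegrE ?normc_ge0.
Qed.

Let ilow : mu.-integrable setT (fun xi => (weight xi * nc (low xi) ^+ 2)%:E).
Proof.
apply: i_part => // xi; rewrite Normc.normcM normc_real.
by case: (box01 xi) => ->; rewrite ?normr0 ?normr1 ?mulr0 ?mulr1 ?normc_ge0.
Qed.

Let ihigh : mu.-integrable setT (fun xi => (weight xi * nc (high xi) ^+ 2)%:E).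
Proof.
apply: i_part => // xi; rewrite Normc.normcM normc_real.
by case: (box01 xi) => ->; rewrite ?subr0 ?subrr ?normr0 ?normr1 ?mulr0 ?mulr1 ?normc_ge0.
Qed.

Let samples_bound (J : seq 'rV[int]_d) : uniq J ->
  \sum_(n <- J) nc (f (sp N n)) ^+ 2 <=
    (N + c) ^+ d * \int[mu]_xi (weight xi * nc (fhat xi) ^+ 2).
Proof. exact: sampling_bound. Qed.

Lemma cmfun_sampling_series : cmfun sampling_series.
Proof. exact: cmfun_cardinal_series samples_bound. Qed.

Lemma sampling_series_L2 (e : R) : 0 < e ->
  exists m, forall J, uniq J -> {subset terms m <= J} ->
    (\int[mu]_x (nc (sampling_series x - cardinal_sum N (fun n => f (sp N n)) J x) ^+ 2)%:E <= e%:E)%E.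
Proof. exact: cardinal_series_L2 samples_bound _. Qed.

Let f_split x : f x = inverse_fourier low x + inverse_fourier high x.
Proof.
have il := cintble_expi x (sobolev_cintble d1 s_gt mlow ilow).
have ih := cintble_expi x (sobolev_cintble d1 s_gt mhigh ihigh).
rewrite /f /inverse_fourier -mulrDr -cintD//; congr (_ * _); apply: eq_cint => xi.
by rewrite /low /high -!mulrDr -rmorphD /= addrC subrK rmorph1 mulr1.
Qed.

(** By [band_limited_error] the squared error is governed by the Parseval defect at [x], which
    [parseval_cardinal] makes small and which can only decrease along the enumeration. *)
Let low_cvg x : ccvg (fun m => inverse_fourier low x -
  cardinal_sum N (fun n => inverse_fourier low (sp N n)) (terms m) x) 0.
Proof.
apply: ccvg_sqr_le0 => e e0.
pose M := \int[mu]_xi nc (low xi) ^+ 2.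
have M0 : 0 <= M by apply: Rintegral_ge0 => xi _; exact: sqr_ge0.
have ND : 0 < N ^+ d by rewrite exprn_gt0.
(* [M + 1] replaces [M] to keep the denominator positive. *)
have e'0 : 0 < e / (N ^+ d * (M + 1)) by rewrite divr_gt0// mulr_gt0// ltr_wpDl.
have [J uJ hJ] := parseval_cardinal N x e'0.
have [m0 hm0] := first_terms_exhaust J; exists m0 => m /hm0 Jm.
have lowb xi : low xi = low xi * rc (boxw N xi).
  rewrite /low -mulrA -real_complexM; congr (_ * rc _).
  by case: (box01 xi) => ->; rewrite ?mulr0 ?mulr1.
have um := first_terms_uniq 'rV[int]_d m.
apply: (le_trans (band_limited_error d1 s_gt mlow ilow x N0 um lowb)); rewrite -/M.
have S_le := ler_sum_uniq uJ um Jm (fun n => sqr_ge0 (cardinal_fun N n x)).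
set S := \sum_(n <- terms m) _ in S_le *.
have {}hJ : 1 - S <= e / (N ^+ d * (M + 1)) by lra.
have S1 : 0 <= 1 - S by rewrite subr_ge0; exact: bessel_cardinal.
apply: (@le_trans _ _ (N ^+ d * (1 - S) * (M + 1))).
  by rewrite ler_wpM2l ?lerDl// mulr_ge0// ltW.
by rewrite mulrAC -ler_pdivlMl// ?mulr_gt0// ?ltr_wpDl// mulrC.
Qed.

(** The partial remainder of [f] is the sum of those of its two parts, and the low one tends to
    0. *)
Lemma sampling_remainder_cvg x : ccvg (fun m => inverse_fourier high x -
  cardinal_sum N (fun n => inverse_fourier high (sp N n)) (terms m) x) (f x - sampling_series x).
Proof.
have := ccvgB (ccvgB (ccvg_cst (f x)) (cardinal_series_cvg N0 samples_bound x)) (low_cvg x).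
rewrite subr0; congr ccvg; apply/funext => m.
rewrite /cardinal_sum f_split; set S := \sum_(n <- _) f _ * _; set S1 := \sum_(n <- _) _.
have -> : S = S1 + \sum_(n <- terms m) inverse_fourier high (sp N n) * rc (cardinal_fun N n x).
  by rewrite -big_split; apply: eq_bigr => n _; rewrite f_split mulrDl.
ring.
Qed.

Let normc_sqrB_le (z w : R[i]) : nc (z - w) ^+ 2 <= 2 * nc z ^+ 2 + 2 * nc w ^+ 2.
Proof.
rewrite !normcE2 ReD ImD ReN ImN.
have := sqr_ge0 (complex.Re z + complex.Re w).
have := sqr_ge0 (complex.Im z + complex.Im w); lra.
Qed.

(** The leading 2 is the price of splitting the square of a difference; the 1 is Plancherel for
    [high]; [(1 + c / N)^d] is the factor [(N + c)^d] of [sampling_bound] times the [N^(-d)] of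
    [cardinal_sum_L2]. Fatou passes to the limit. *)
Lemma sampling_remainder_le :
  (\int[mu]_x (nc (f x - sampling_series x) ^+ 2)%:E <=
    (2 * (1 + (1 + c / N) ^+ d) * E2)%:E)%E.
Proof.
have ih := sobolev_cintble d1 s_gt mhigh ihigh.
have ih2 := sobolev_sqr_integrable s_gt mhigh ihigh.
have mG := cmfun_inverse_fourier ih.
pose S m := cardinal_sum N (fun n => inverse_fourier high (sp N n)) (terms m).
have mS m : cmfun (S m) by exact: cmfun_cardinal_sum.
have m2 (h : V -> R[i]) : cmfun h -> measurable_fun setT (fun x => nc (h x) ^+ 2).
  by move=> mh; apply: measurable_funX; exact: measurable_normc.
apply: (@fatou_bound _ _ _ _ (fun m x => nc (inverse_fourier high x - S m x) ^+ 2)).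
- by move=> m; apply: m2; exact: cmfunB.
- by move=> m x; exact: sqr_ge0.
- by move=> x; apply: ccvg_normc_sqr; exact: sampling_remainder_cvg.
move=> m.
have G2 : (\int[mu]_x (nc (inverse_fourier high x) ^+ 2)%:E <= E2%:E)%E.
  apply: (le_trans (plancherel_le ih ih2)).
  rewrite -[leLHS]fineK; last exact: integrable_fin_num.
  by rewrite lee_fin; exact: (sobolev_sqr_le s_gt mhigh ihigh).
have S2 : (\int[mu]_x (nc (S m x) ^+ 2)%:E <= ((1 + c / N) ^+ d * E2)%:E)%E.
  apply: (le_trans (cardinal_sum_L2 N0 _ (first_terms_uniq _ _))).
  rewrite lee_fin ler_pdivrMl ?exprn_gt0// mulrA -exprMn mulrDr mulr1.
  rewrite (mulrC N (c / N)) divfK ?gt_eqF//.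
  exact: (sampling_bound d1 s_gt mhigh ihigh N0 (first_terms_uniq _ _)).
apply: (@le_trans _ _ (\int[mu]_x (2%:E * (nc (inverse_fourier high x) ^+ 2)%:E +
    2%:E * (nc (S m x) ^+ 2)%:E))%E).
  apply: ge0_le_integral => //.
  - by move=> x _; rewrite lee_fin sqr_ge0.
  - by apply/measurable_EFinP; apply: m2; exact: cmfunB.
  - apply: emeasurable_funD; apply/measurable_EFinP; apply: measurable_funM => //; exact: m2.
  - by move=> x _; rewrite -!EFinM -EFinD lee_fin; exact: normc_sqrB_le.
rewrite ge0_integralD//; last 4 first.
- by move=> x _; rewrite -EFinM lee_fin mulr_ge0 ?sqr_ge0.
- by apply/measurable_EFinP; apply: measurable_funM => //; exact: m2.
- by move=> x _; rewrite -EFinM lee_fin mulr_ge0 ?sqr_ge0.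
- by apply/measurable_EFinP; apply: measurable_funM => //; exact: m2.
rewrite !ge0_integralZl_EFin//; last 4 first.
- by move=> x _; rewrite lee_fin sqr_ge0.
- by apply/measurable_EFinP; exact: m2.
- by move=> x _; rewrite lee_fin sqr_ge0.
- by apply/measurable_EFinP; exact: m2.
have -> : 2 * (1 + (1 + c / N) ^+ d) * E2 = 2 * E2 + 2 * ((1 + c / N) ^+ d * E2) by ring.
by rewrite [leRHS](EFinD (2 * E2)); apply: leeD; rewrite [leRHS]EFinM; apply: lee_wpmul2l.
Qed.

Lemma bessel_energy_high : bessel_energy s (~` cube 0 (pi * N)) fhat = E2%:E.
Proof.
rewrite /bessel_energy integral_mkcond /E2 /Rintegral fineK; last exact: integrable_fin_num.
apply: eq_integral => xi _; rewrite patchE /high Normc.normcM normc_real boxwE indicE in_setC.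
case: (xi \in _) => /=; rewrite ?subrr ?subr0 ?normr0 ?normr1 ?mulr0 ?mulr1//.
by rewrite expr0n mulr0.
Qed.

End remainder.

(** * The [L^2] norm and the final constant *)

Section L2_norm.
Variables (R : realType) (d : nat).
Local Notation nc := (@Normc.normc R).
Implicit Types h : 'rV[R]_d -> R[i].

Lemma L2normE h : L2norm h = ((\int[lebesgue_rV R d]_x (nc (h x) ^+ 2)%:E) `^ 2^-1)%E.
Proof.
rewrite /L2norm unlock /Lnorm; congr (_ `^ _)%E; apply: eq_integral => x _.
by rewrite /= ger0_norm ?normc_ge0// powR_mulrn// normc_ge0.
Qed.

Lemma L2norm_le h (A : R) : 0 <= A ->
  (\int[lebesgue_rV R d]_x (nc (h x) ^+ 2)%:E <= A%:E)%E ->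
  (L2norm h <= (A `^ 2^-1)%:E)%E.
Proof.
move=> A0 hA; rewrite L2normE -poweR_EFin.
have I0 : (0 <= \int[lebesgue_rV R d]_x (nc (h x) ^+ 2)%:E)%E.
  by apply: integral_ge0 => x _; rewrite lee_fin sqr_ge0.
by apply: gt0_ler_poweR => //; rewrite in_itv /= leey ?lee_fin ?A0 ?I0.
Qed.

End L2_norm.

(** For [N >= 1] one has [1 + c / N <= 1 + c], and for [N < 1] one has [1 + c / N <= (1 + c) / N];
    the sum of the two bounds serves for all [N]. *)
Lemma sampling_cst_le (R : realType) (d : nat) (c N : R) : 0 <= c -> 0 < N ->
  2 * (1 + (1 + c / N) ^+ d) <=
    (2 * Num.sqrt ((1 + c) ^+ d) * (1 + N `^ (- (d%:R / 2)))) ^+ 2.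
Proof.
move=> c0 N0; set y := N `^ _.
have y0 : 0 <= y by exact: powR_ge0.
have y2 : y ^+ 2 = (N^-1) ^+ d.
  rewrite /y -powR_mulrn ?powR_ge0// -powRrM mulNr divfK//.
  by rewrite powRN powR_mulrn ?ltW// exprVn.
have C0 : 0 <= (1 + c) ^+ d by rewrite exprn_ge0// addr_ge0.
rewrite !exprMn sqr_sqrtr//.
have w1 : 1 <= (1 + c / N) ^+ d.
  by rewrite exprn_ege1// lerDl divr_ge0// ltW.
have w2 : (1 + c / N) ^+ d <= (1 + c) ^+ d * (1 + y ^+ 2).
  rewrite y2 mulrDr mulr1 -exprMn.
  have V0 : 0 < N^-1 by rewrite invr_gt0.
  have [N1|N1] := lerP 1 N.
    apply: (@le_trans _ _ ((1 + c) ^+ d)); last first.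
      by rewrite lerDl exprn_ge0// mulr_ge0 ?addr_ge0// ltW.
    rewrite lerXn2r ?nnegrE ?addr_ge0 ?divr_ge0 ?(ltW N0)// lerD2l.
    by rewrite ler_piMr// invf_le1.
  apply: (@le_trans _ _ (((1 + c) * N^-1) ^+ d)); last by rewrite lerDr.
  rewrite lerXn2r ?nnegrE ?addr_ge0 ?divr_ge0 ?mulr_ge0 ?addr_ge0 ?(ltW V0) ?(ltW N0)//.
  by rewrite mulrDl mul1r lerD2r invf_ge1// ltW.
have : (1 + c) ^+ d * (1 + y ^+ 2) <= (1 + c) ^+ d * (1 + y) ^+ 2.
  by rewrite ler_wpM2l// sqrrD !expr1n mul1r; lra.
rewrite -[2 ^+ 2 * _ * _]mulrA; lra.
Qed.

Theorem theorem2p1 (R : realType) (d : nat) (d_ge1 : (1 <= d)%N)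
    (s : R) (s_gt : d%:R / 2 < s) :
  exists C : R,
    forall (u : functional R d) (fhat f : 'rV[R]_d -> R[i]),
      bessel_potential s u fhat -> continuous_representative u f ->
      forall N : R, 0 < N ->
        exists Rem : 'rV[R]_d -> R[i],
          [/\ inL2 Rem,
              (L2norm Rem <= (C * (1 + N `^ (- (d%:R / 2))))%:E *
                 (bessel_energy s (~` cube 0 (pi * N)) fhat) `^ 2^-1)%E &
              L2_sum
                (fun (n : 'rV[int]_d) x =>
                   f (sample_point N n) * real_complex R (cardinal_fun N n x))
                (fun x => f x - Rem x)].
Proof.
(* Its square [4 * (1 + c)^d] absorbs [2 * (1 + (1 + c / N)^d)], both summants being at most
   [(1 + c)^d * (1 + N^(-d))]. *)
pose c := weight_cst d s; exists (2 * Num.sqrt ((1 + c) ^+ d)).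
move=> u fhat f [_ ufhat fin] uf N N0.
have mf : cmfun fhat := ufhat.1.
have ifh : (lebesgue_rV R d).-integrable setT
    (fun xi => ((1 + sqnorm xi) `^ s * Normc.normc (fhat xi) ^+ 2)%:E).
  have m : measurable_fun setT (fun xi => (1 + sqnorm xi) `^ s * Normc.normc (fhat xi) ^+ 2).
    apply: measurable_funM; first exact: measurable_weight.
    by apply: measurable_funX; exact: measurable_normc.
  by apply: ge0_integrable => // xi; rewrite mulr_ge0 ?powR_ge0 ?sqr_ge0.
have ih := sobolev_cintble d_ge1 s_gt mf ifh.
have fE : f = inverse_fourier fhat.
  by apply/funext => a; exact: fourier_inversion ufhat uf ih.
pose S := sampling_series N fhat.
have mS : cmfun S by exact: (cmfun_sampling_series d_ge1 s_gt N0 mf ifh).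
have c0 : 0 <= c by exact: weight_cst_ge0.
set K := 2 * Num.sqrt _ * _.
have K0 : 0 <= K by rewrite !mulr_ge0 ?sqrtr_ge0 ?addr_ge0 ?powR_ge0.
have Rem_le := sampling_remainder_le d_ge1 s_gt N0 mf ifh.
have En := bessel_energy_high N mf ifh.
set E2 := Rintegral _ _ _ in Rem_le En.
have E20 : 0 <= E2 by apply: Rintegral_ge0 => xi _; rewrite mulr_ge0 ?powR_ge0 ?sqr_ge0.
have {}Rem_le : (L2norm (fun x => (f x - S x)%R) <= (K * E2 `^ 2^-1)%:E)%E.
  have -> : K * E2 `^ 2^-1 = (K ^+ 2 * E2) `^ 2^-1.
    rewrite powRM ?sqr_ge0//; congr (_ * _).
    by rewrite -powR_mulrn// -powRrM mulfV// powRr1.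
  apply: L2norm_le; first by rewrite mulr_ge0 ?sqr_ge0.
  rewrite fE; apply: (le_trans Rem_le); rewrite lee_fin ler_wpM2r//.
  exact: sampling_cst_le.
exists (fun x => f x - S x); split.
- split; last by apply: le_lt_trans Rem_le _; rewrite ltry.
  by apply: cmfunB => //; rewrite fE; exact: cmfun_inverse_fourier.
- by rewrite En poweR_EFin -EFinM.
(* The tolerance [(e / 2)^2] on the square integral gives norm at most [e / 2], hence the strict
   inequality. *)
move=> e e0; have [m hm] := sampling_series_L2 d_ge1 s_gt N0 mf ifh (exprn_gt0 2 (divr_gt0 e0 (ltr0n R 2))).
exists [fset n in first_terms 'rV[int]_d m]%fset => J mJ.
apply: (@le_lt_trans _ _ ((e / 2)%:E)); last by rewrite lte_fin; lra.
have -> : e / 2 = ((e / 2) ^+ 2) `^ 2^-1.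
  by rewrite -powR_mulrn ?divr_ge0 ?(ltW e0)// -powRrM mulfV// powRr1// divr_ge0// ltW.
apply: L2norm_le; first exact: sqr_ge0.
have := hm J (fset_uniq J); rewrite -/S fE => H.
under eq_integral do rewrite subKr.
apply: H => n nm; have /fsubsetP := mJ; apply.
by rewrite !inE.
Qed.
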